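(* Let $M$ be a linear maximal monotone operator on a real Hilbert space that is normal, with resolvent $L=(I+M)^{-1}$. Then $\sigma(L)\subseteq\{\zeta\in\mathbb{C}:|\zeta-\tfrac12|\le\tfrac12\}$, the spectral floor $s=\operatorname{dist}(1,\sigma(L))$ is well defined, and: (i) Let $K\ge1$, $N=\lfloor(K+2)/2\rfloor$ and $q_J(u)=\big(\frac1N\sum_{j=0}^{N-1}u^j\big)^2$. If $s>0$, then for every $y_0$ the point $y_K=q_J(L)y_0$ satisfies $\|r(y_K)\|\le\frac{16\,d_0}{(K+1)^2s}$. (ii) For every $K\ge1$, the barrier is attained inside the class of normal operators: the extremal instance $(M_K^\star,y_0^\star)$ (defined in the context) is skew-adjoint, hence normal, has floor $\sin\frac{\pi}{2(K+1)}$, and every method in $\mathcal{A}_\infty$ satisfies $\|r(y_K)\|\ge\frac1{K+1}$ on it. (iii) Consequently the phase transition at the critical scale $s\asymp1/K$ holds for the whole class of normal operators with unchanged constants: (a) if $sK=O(1)$, the uniform barrier $\Theta(1/K)$ cannot be beaten by any method in $\mathcal{A}_\infty$: for every sequence $s_K>0$ with $s_KK$ bounded, $\liminf_{K\to\infty}K\cdot\inf_{\text{methods in }\mathcal{A}_\infty}\sup\|r(y_K)\|>0$, the supremum being over normal instances with $d_0=1$ and $\operatorname{dist}(1,\sigma(L))\ge s_K$; at $s=\sin\frac{\pi}{2(K+1)}$ the barrier value is exactly $\frac1{K+1}$; (b) if $sK\to\infty$, the barrier is escaped: $\|r(y_K)\|=o(d_0/K)$ is achieved; and for fixed $s>0$,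 Anderson acceleration/GMRES restarted every $m\ge1$ steps converges geometrically with per-cycle factor given by the Chebyshev number $\min_{q(1)=1,\ \deg q\le m}\max\{|q(\zeta)|:|\zeta-1|\ge s,\ |\zeta|\le1\}$. Moreover, the exact minimax over normal instances, $\inf_{\text{methods in }\mathcal{A}_\infty}\sup\|r(y_K)\|$ with the supremum over normal maximal monotone $M$ and $y_0$ with $d_0=1$, equals $\frac1{K+1}$.
   Context: $M$ is called normal if its resolvent $L$ is a normal bounded operator (linear relations such as the normal cone operator of $\{0\}$ are allowed). $\sigma(L)$ is the spectrum of the complexification of $L$. $r(y)=Ly-y$; $d_0$ is the distance of $y_0$ to the zero set of $M$. Class $\mathcal{A}_\infty$: a method which from $y_0$ performs at each iteration $k=0,1,2,\dots$ exactly one resolvent evaluation $x_k=J(v_k)$ (here $J=L$) at a query point $v_k$ in the affine hull of $\{y_0,x_0,\dots,x_{k-1}\}$ and then chooses $y_{k+1}$ in the affine hull of $\{y_0,x_0,\dots,x_k\}$, all (real, sum-one) coefficients being allowed to depend arbitrarily on everything observed so far. Anderson acceleration (full memory within a cycle): with $x_k=L(y_k)$, $r_k=x_k-y_k$, choose $\gamma$ with $\sum_i\gamma_i=1$ minimizing $\|\sum_i\gamma_ir_i\|$ over the window and set $y_{k+1}=\sum_i\gamma_ix_i$; on linear problems this corresponds to GMRES for $(I-L)y=0$; restarting means discarding the window every $m$ steps. Extremal instance ($\mathbb{R}^2$ identified with $\mathbb{C}$): $n=K+1$, $\phi_j=\frac{(2j+1)\pi}{n}$, $\omega_j=e^{i\phi_j}$,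 $w_j=\frac1{n^2}\csc^2\frac{\phi_j}2$ for $j=0,\dots,n-1$. $M_K^\star$ is the skew-adjoint operator on $\mathbb{R}^{2n}=(\mathbb{R}^2)^n$ whose $j$-th block is multiplication by $-i\tan(\phi_j/2)$, with the convention that a block with $\phi_j=\pi$ is the normal cone operator of $\{0\}$ (resolvent $0$ on it); equivalently its resolvent acts on block $j$ as multiplication by $\frac{1+\omega_j}2$. $y_0^\star$ has norm $\sqrt{w_j}$ on block $j$; then $\|y_0^\star\|=d_0=1$. *)

(* Defs.v *)
From HB Require Import structures.
From mathcomp Require Import all_boot all_order all_algebra.
From mathcomp Require Import complex.
From mathcomp Require Import all_classical all_reals all_analysis.
From mathcomp Require Import ring lra.

Set Implicit Arguments.
Unset Strict Implicit.
Unset Printing Implicit Defensive.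

Import Order.TTheory GRing.Theory Num.Theory.
Import numFieldNormedType.Exports.

Local Open Scope classical_set_scope.
Local Open Scope ring_scope.

(* Real Hilbert spaces: complete normed modules whose norm comes from an inner
   product. *)
HB.mixin Record CompleteNormedModule_isHilbert (R : realType) V
    & CompleteNormedModule R V := {
  dot : V -> V -> R;
  dotC : forall x y, dot x y = dot y x;
  dot_linear : forall (a : R) x y z, dot (a *: x + y) z = a * dot x z + dot y z;
  dot_norm : forall x, dot x x = `|x| ^+ 2
}.

#[short(type="hilbertType")]
HB.structure Definition Hilbert (R : realType) :=
  {V of CompleteNormedModule R V & CompleteNormedModule_isHilbert R V}.

Local Notation Re := complex.Re.
Local Notation Im := complex.Im.

Notation cmod := ComplexField.Normc.normc.

Section Operators.
Context {R : realType} {H : hilbertType R}.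
Implicit Types (M : H -> set H) (L : H -> H).

Definition bounded_operator L :=
  linear L /\ exists C : R, forall x, `|L x| <= C * `|x|.

Definition normal_operator L :=
  bounded_operator L /\
  exists A : H -> H, (forall x y, dot (L x) y = dot x (A y)) /\
                     (forall x, L (A x) = A (L x)).

(* A set-valued operator M is given by its values: [M x u] means u \in M(x). *)
Definition linear_relation M :=
  M 0 0 /\
  forall (a : R) x u y v, M x u -> M y v -> M (a *: x + y) (a *: u + v).

Definition monotone_relation M :=
  forall x u y v, M x u -> M y v -> 0 <= dot (x - y) (u - v).

Definition maximal_monotone M :=
  monotone_relation M /\
  forall N : H -> set H, monotone_relation N ->
    (forall x, M x `<=` N x) -> forall x, N x `<=` M x.

Definition adjoint_relation M : H -> set H :=
  fun y w => forall x u, M x u -> dot u y = dot x w.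

(* M^* = - M as relations *)
Definition skew_adjoint M :=
  forall y w, adjoint_relation M y w <-> M y (- w).

(* (I + M)^-1: the point y with x - y \in M(y); it exists and is unique for
   every x when M is maximal monotone. *)
Definition resolvent M : H -> H := fun x => xget 0 [set y | M y (x - y)].

Definition normal_maximal_monotone M :=
  [/\ linear_relation M, maximal_monotone M & normal_operator (resolvent M)].

Definition zeros M : set H := [set z | M z 0].

Definition dist_to (A : set H) (y : H) : R := inf [set `|y - z| | z in A].

Definition residual L (y : H) : H := L y - y.

Definition poly_op (p : {poly R}) L (x : H) : H :=
  \sum_(i < size p) p`_i *: iter i L x.

End Operators.

(* The complexification H + iH of H, a pair (x, y) standing for x + iy. *)
Definition complexification {R : realType} (H : hilbertType R) : Type :=
  (H * H)%type.

Section Complexification.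
Context {R : realType} {H : hilbertType R}.

HB.instance Definition _ := GRing.Zmodule.copy (complexification H) (H * H)%type.

Definition cscale (z : R[i]) (u : complexification H) : complexification H :=
  (Re z *: u.1 - Im z *: u.2, Re z *: u.2 + Im z *: u.1).

Lemma cscaleA a b u : cscale a (cscale b u) = cscale (a * b) u.
Proof.
case: a b u => [a a'] [b b'] [x y]; rewrite /cscale /=; congr pair.
  rewrite !scalerBr !scalerDr !scalerBl !scalerDl !scalerA !opprD -!addrA.
  by congr (_ + _); rewrite addrA addrC.
rewrite !scalerBr !scalerDr !scalerBl !scalerDl !scalerA -!addrA.
by congr (_ + _); rewrite addrA addrC.
Qed.

Lemma cscale1 : left_id 1 cscale.
Proof. by case=> x y; rewrite /cscale /= !scale1r !scale0r subr0 addr0. Qed.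

Lemma cscaleDr : right_distributive cscale +%R.
Proof.
move=> a [x y] [x' y']; rewrite /cscale; congr pair => /=.
  by rewrite !scalerDr opprD addrACA.
by rewrite !scalerDr addrACA.
Qed.

Lemma cscaleDl u : {morph cscale^~ u : a b / a + b}.
Proof.
case: u => x y [a a'] [b b']; rewrite /cscale; congr pair => /=.
  by rewrite !scalerDl opprD addrACA.
by rewrite !scalerDl addrACA.
Qed.

HB.instance Definition _ := GRing.Zmodule_isLmodule.Build R[i]
  (complexification H) cscaleA cscale1 cscaleDr cscaleDl.

Definition cnorm (u : complexification H) : R :=
  Num.sqrt (`|u.1| ^+ 2 + `|u.2| ^+ 2).

Definition complexify (L : H -> H) (u : complexification H) :
  complexification H := (L u.1, L u.2).

Definition boundedly_invertible (T : complexification H -> complexification H) :=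
  exists S : complexification H -> complexification H,
    [/\ linear S, exists C : R, forall u, cnorm (S u) <= C * cnorm u,
        cancel T S & cancel S T].

Definition spectrum (L : H -> H) : set R[i] :=
  [set z | ~ boundedly_invertible (fun u => complexify L u - z *: u)].

Definition floor_distances (L : H -> H) : set R :=
  [set cmod (1 - z) | z in spectrum L].

Definition spectral_floor (L : H -> H) : R := inf (floor_distances L).

End Complexification.

Section Methods.
Context {R : realType}.

Definition combination {H : hilbertType R} (w : nat -> R) (h : seq H) : H :=
  \sum_(i < size h) w i *: h`_i.

(* At iteration k the observed history is [:: y_0; x_0; ...; x_(k-1)].  It
   determines k (through its length) and all earlier query points and iterates,
   so the coefficients are arbitrary functions of the history. *)
Record method := Method {
  query_coef : forall H : hilbertType R, seq H -> nat -> R;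
  output_coef : forall H : hilbertType R, seq H -> nat -> R;
  query_coef_sum1 : forall (H : hilbertType R) (h : seq H), (0 < size h)%N ->
    \sum_(i < size h) query_coef h i = 1;
  output_coef_sum1 : forall (H : hilbertType R) (h : seq H), (0 < size h)%N ->
    \sum_(i < size h) output_coef h i = 1
}.

Section Run.
Context {H : hilbertType R}.
Variables (A : method) (J : H -> H) (y0 : H).

Fixpoint history (k : nat) : seq H :=
  if k is k'.+1 then
    let h := history k' in rcons h (J (combination (query_coef A h) h))
  else [:: y0].

Definition iterate (k : nat) : H :=
  if k is 0%N then y0
  else combination (output_coef A (history k)) (history k).

End Run.

Definition instance_class := forall H : hilbertType R, (H -> set H) -> H -> Prop.

Definition normal_instances : instance_class := fun H M y0 =>
  normal_maximal_monotone M /\ dist_to (zeros M) y0 = 1.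

Definition normal_instances_floor (s : R) : instance_class := fun H M y0 =>
  normal_instances M y0 /\ s <= spectral_floor (resolvent M).

Definition worst_residual (A : method) (K : nat) (C : instance_class) : \bar R :=
  ereal_sup [set e | exists (H : hilbertType R) (M : H -> set H) (y0 : H),
    C H M y0 /\
    e = (`|residual (resolvent M) (iterate A (resolvent M) y0 K)|)%:E].

Definition minimax (K : nat) (C : instance_class) : \bar R :=
  ereal_inf [set e | exists A : method, e = worst_residual A K C].

Definition qJ (K : nat) : {poly R} :=
  let N := K.+2./2 in (N%:R^-1 *: \sum_(j < N) 'X^j) ^+ 2.

(* Anderson acceleration whose window is emptied every m steps: the window at
   step k consists of the indices i with m * (k %/ m) <= i <= k. *)
Definition anderson_restarted {H : hilbertType R} (m : nat) (L : H -> H)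
    (y : nat -> H) :=
  forall k, exists gamma : nat -> R,
    let W := (m * (k %/ m))%N in
    [/\ \sum_(W <= i < k.+1) gamma i = 1,
        forall delta : nat -> R, \sum_(W <= i < k.+1) delta i = 1 ->
          `|\sum_(W <= i < k.+1) gamma i *: residual L (y i)| <=
          `|\sum_(W <= i < k.+1) delta i *: residual L (y i)|
      & y k.+1 = \sum_(W <= i < k.+1) gamma i *: L (y i)].

(* GMRES(m) for (I - L) y = 0: z_(c+1) minimizes the residual norm over
   z_c + span {r, L r, ..., L^(m-1) r}, r = r(z_c). *)
Definition gmres_restarted {H : hilbertType R} (m : nat) (L : H -> H)
    (z : nat -> H) :=
  let krylov y (a : 'I_m -> R) :=
    y + \sum_(i < m) a i *: iter i L (residual L y) in
  forall c, exists a : 'I_m -> R,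
    z c.+1 = krylov (z c) a /\
    forall b, `|residual L (krylov (z c) a)| <= `|residual L (krylov (z c) b)|.

Definition chebyshev_number (m : nat) (s : R) : R :=
  inf [set sup [set cmod q.[z] | z in [set z : R[i] | s <= cmod (z - 1) /\
                                                      cmod z <= 1]]
      | q in [set q : {poly R[i]} | q.[1] = 1 /\ (size q <= m.+1)%N]].

End Methods.
Arguments method : clear implicits.
Arguments instance_class : clear implicits.

(* R^(2n) as the space of n blocks in C = R^2, with the Euclidean norm. *)
Definition blocks (R : realType) (n : nat) : Type := {ffun 'I_n -> Rcomplex R}.

Section Blocks.
Variables (R : realType) (n : nat).

HB.instance Definition _ :=
  GRing.Lmodule.copy (blocks R n) {ffun 'I_n -> Rcomplex R}.

Definition bdot (x y : blocks R n) : R :=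
  \sum_j (Re (x j) * Re (y j) + Im (x j) * Im (y j)).

Definition bnorm (x : blocks R n) : R := Num.sqrt (\sum_j cmod (x j) ^+ 2).

Lemma bdotC x y : bdot x y = bdot y x.
Proof. by apply: eq_bigr => j _; rewrite mulrC [in X in _ + X]mulrC. Qed.

Lemma bdot_linear (a : R) x y z :
  bdot (a *: x + y) z = a * bdot x z + bdot y z.
Proof.
rewrite /bdot mulr_sumr -big_split; apply: eq_bigr => j _ /=.
rewrite !ffunE; case: (x j) (y j) (z j) => [x1 x2] [y1 y2] [z1 z2] /=.
by rewrite !mulrDl mulrDr !mulrA addrACA.
Qed.

Lemma cmod_sqr (z : R[i]) : cmod z ^+ 2 = Re z * Re z + Im z * Im z.
Proof.
by case: z => a b; rewrite sqr_sqrtr ?addr_ge0 ?sqr_ge0// !expr2.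
Qed.

Lemma bnorm_sqr x : bnorm x ^+ 2 = bdot x x.
Proof.
rewrite sqr_sqrtr; first by apply: eq_bigr => j _; rewrite cmod_sqr.
by apply: sumr_ge0 => j _; exact: sqr_ge0.
Qed.

Lemma bnorm_ge0 x : 0 <= bnorm x. Proof. exact: sqrtr_ge0. Qed.

Lemma bdot_ge0 x : 0 <= bdot x x. Proof. by rewrite -bnorm_sqr sqr_ge0. Qed.

Lemma bnormE x : bnorm x = Num.sqrt (bdot x x).
Proof. by rewrite -bnorm_sqr sqrtr_sqr ger0_norm// bnorm_ge0. Qed.

Lemma bnormZ (a : R) x : bnorm (a *: x) = `|a| * bnorm x.
Proof.
have linZ u : bdot (a *: x) u = a * bdot x u.
  have z0 : bdot 0 u = 0.
    by rewrite /bdot big1// => j _; rewrite !ffunE /= !mul0r addr0.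
  by rewrite -[a *: x]addr0 bdot_linear z0 addr0.
rewrite !bnormE linZ bdotC linZ mulrA -expr2 sqrtrM ?sqr_ge0//.
by rewrite sqrtr_sqr.
Qed.

Lemma bnorm0_eq0 x : bnorm x = 0 -> x = 0.
Proof.
move=> x0; apply/ffunP => j; rewrite ffunE.
have : bnorm x ^+ 2 = 0 by rewrite x0 expr0n.
rewrite sqr_sqrtr; last by apply: sumr_ge0 => i _; exact: sqr_ge0.
move=> /eqP; rewrite psumr_eq0 => [|i _]; last exact: sqr_ge0.
by move=> /allP /(_ j (mem_index_enum _)); rewrite sqrf_eq0 => /eqP
  /ComplexField.Normc.eq0_normc.
Qed.

Lemma bnormD_sqr x y : bnorm (x + y) ^+ 2 =
  bnorm x ^+ 2 + bdot x y *+ 2 + bnorm y ^+ 2.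
Proof.
rewrite !bnorm_sqr -[x in LHS]scale1r !bdot_linear !mul1r.
rewrite [bdot x _]bdotC [bdot y _]bdotC -[x in LHS]scale1r !bdot_linear !mul1r.
by rewrite scale1r [bdot y x]bdotC mulr2n -!addrA.
Qed.


Lemma bdot0 u : bdot 0 u = 0.
Proof. by rewrite /bdot big1// => j _; rewrite !ffunE /= !mul0r addr0. Qed.

Lemma bdotZ (a : R) x y : bdot (a *: x) y = a * bdot x y.
Proof. by rewrite -[a *: x]addr0 bdot_linear bdot0 addr0. Qed.

Lemma bdot_le x y : bdot x y <= bnorm x * bnorm y.
Proof.
have [/bnorm0_eq0 ->|x0] := eqVneq (bnorm x) 0.
  by rewrite bdot0 mulr_ge0 ?bnorm_ge0.
have [/bnorm0_eq0 ->|y0] := eqVneq (bnorm y) 0.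
  by rewrite bdotC bdot0 mulr_ge0 ?bnorm_ge0.
have xy0 : 0 < bnorm x * bnorm y.
  by rewrite mulr_gt0// lt_neqAle bnorm_ge0 eq_sym ?x0 ?y0.
have := bdot_ge0 (bnorm y *: x + - bnorm x *: y).
rewrite -bnorm_sqr bnormD_sqr !bnormZ normrN !ger0_norm ?bnorm_ge0//.
by rewrite bdotZ bdotC bdotZ [bdot y x]bdotC; nra.
Qed.

Lemma bnormD x y : bnorm (x + y) <= bnorm x + bnorm y.
Proof.
rewrite -(@ler_pXn2r _ 2)// ?nnegrE ?addr_ge0 ?bnorm_ge0// bnormD_sqr sqrrD.
by rewrite lerD2r lerD2l lerMn2r bdot_le.
Qed.

HB.instance Definition _ :=
  Lmodule_isNormed.Build R (blocks R n) bnormD bnormZ bnorm0_eq0.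

Lemma blocks_coord (x : blocks R n) j :
  `|Re (x j)| <= `|x| /\ `|Im (x j)| <= `|x|.
Proof.
have h : cmod (x j) ^+ 2 <= `|x| ^+ 2.
  rewrite [X in _ <= X ^+ 2]/(bnorm x) sqr_sqrtr.
    by rewrite (bigD1 j)//= lerDl sumr_ge0// => i _; exact: sqr_ge0.
  by apply: sumr_ge0 => i _; exact: sqr_ge0.
rewrite cmod_sqr in h.
by split; rewrite -(@ler_pXn2r _ 2)// ?nnegrE// real_normK ?num_real//; nra.
Qed.

Lemma blocks_complete (F : set_system (blocks R n)) :
  ProperFilter F -> cauchy F -> cvg F.
Proof.
move=> FF /cauchy_ballP cF.
have coord_cvg (f : blocks R n -> R) :
    (forall x y, `|f x - f y| <= `|x - y|) -> cvg (f @ F).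
  move=> fN; apply/cauchy_cvgP/cauchy_ballP => e e0.
  rewrite !near_simpl.
  apply: filterS (cF e e0) => -[x y] /=.
  by rewrite -!ball_normE /=; exact: le_lt_trans.
have reN j (x y : blocks R n) : `|Re (x j) - Re (y j)| <= `|x - y|.
  have [+ _] := blocks_coord (x - y) j.
  by rewrite !ffunE; case: (x j) (y j) => [? ?] [].
have imN j (x y : blocks R n) : `|Im (x j) - Im (y j)| <= `|x - y|.
  have [_ +] := blocks_coord (x - y) j.
  by rewrite !ffunE; case: (x j) (y j) => [? ?] [].
pose l : blocks R n := [ffun j =>
  Complex (lim ((fun x : blocks R n => Re (x j)) @ F))
          (lim ((fun x : blocks R n => Im (x j)) @ F)) : Rcomplex R].
apply/cvg_ex; exists l; apply/cvgrPdist_lt => e e0.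
pose d : R := e / (2 * n.+1%:R).
have d0 : 0 < d by rewrite divr_gt0// mulr_gt0.
have near_coord : \forall x \near F, let x : blocks R n := x in forall j : 'I_n,
    `|Re (l j) - Re (x j)| < d /\ `|Im (l j) - Im (x j)| < d.
  apply: filter_forall => j; rewrite ffunE /=.
  have /cvgrPdist_lt /(_ d d0) rj := coord_cvg _ (reN j).
  have /cvgrPdist_lt /(_ d d0) ij := coord_cvg _ (imN j).
  by apply: filterS2 rj ij => x.
apply: filterS near_coord => x xd.
rewrite -(@ltr_pXn2r _ 2)// ?nnegrE// ?(ltW e0)//.
rewrite [X in X ^+ 2](_ : _ = bnorm (l - x))// bnorm_sqr.
apply: (@le_lt_trans _ _ (\sum_(j < n) (d ^+ 2 + d ^+ 2))).
  apply: ler_sum => j _.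
  have [rd id] := xd j.
  have -> : (l - x) j = l j - x j by rewrite !ffunE.
  case: (l j) (x j) rd id => [a a'] [b b'] /= rd id.
  have sq (u : R) : `|u| < d -> u * u <= d ^+ 2.
    move=> ud; rewrite -expr2 -(real_normK (num_real u)).
    by rewrite ler_pXn2r ?nnegrE ?(ltW ud) ?(ltW d0).
  by rewrite lerD// sq.
rewrite sumr_const card_ord -mulr_natl.
have n0 : 0 <= n%:R :> R by [].
have -> : e = d * (2 * n.+1%:R) by rewrite divfK// mulf_neq0// pnatr_eq0.
by rewrite -natr1; nra.
Qed.

HB.instance Definition _ :=
  Uniform_isComplete.Build (blocks R n) blocks_complete.

Lemma bdot_norm (x : blocks R n) : bdot x x = `|x| ^+ 2.
Proof. by rewrite -bnorm_sqr. Qed.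

HB.instance Definition _ := CompleteNormedModule_isHilbert.Build R (blocks R n)
  bdotC bdot_linear bdot_norm.

End Blocks.

Section Extremal.
Variables (R : realType) (K : nat).

Definition phi (j : 'I_K.+1) : R := (2 * j + 1)%:R * pi / K.+1%:R.

Definition extremal_weight (j : 'I_K.+1) : R :=
  (K.+1%:R ^+ 2 * sin (phi j / 2) ^+ 2)^-1.

(* Blocks with phi_j = pi carry the normal cone of {0}. *)
Definition extremal_operator (x : blocks R K.+1) : set (blocks R K.+1) :=
  [set u | forall j, if phi j == pi then x j = 0
                     else u j = Complex 0 (- tan (phi j / 2)) * x j].

Definition extremal_start (y : blocks R K.+1) :=
  forall j, cmod (y j) = Num.sqrt (extremal_weight j).

End Extremal.

(* Main.v *)
(* A method in the class produces [y_K = p(L) y_0] with p real, deg p <= K and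
   p(1) = 1, and every such family p_K arises from a method.

   Upper bounds.  For normal N some point of the spectrum has modulus |N|: if
   |x| = 1 and |N x| is close to C = |N|, log-convexity of |N^k x| keeps
   |C^-k N^k x| close to 1, so averaging the truncated Neumann sums of x over
   the n-th roots of unity yields a point of the circle of radius C where N is
   not bounded below by O(n^-1/2); compactness of the circle concludes.
   Factoring p - z over the complex numbers then gives
   |p(L)| <= sup |p| over the spectrum.  The minimax bound 1/(K+1) needs only
   the nonexpansive reflection T = 2L - 1, of which one takes ergodic means.

   Lower bounds.  On a L, with L the extremal resolvent and 0 < a <= 1, the
   weights turn the residual into the l^2 norm of P(w) = p(a (1 + w) / 2) at the
   (K+1)-th roots of -1, that is, by Parseval, of its coefficients, while
   P(2/a - 1) = 1.  The case a = 1 is the extremal instance and a = 1 - s has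
   spectral floor at least s.

   Anderson acceleration ends a cycle with L p(L) y where p minimizes in degree
   m - 1 only, so the extra factor L must be paid for: passing from
   {|z| <= 1, |z - 1| >= s} to the actual spectral region, which z -> 2z - 1
   maps into {|z| <= 1, |z - 1| >= 2s}, gains at least one degree for m >= 3,
   while |L|^2 <= 1 - s^2 suffices for m <= 2. *)
Require Import Defs.
From HB Require Import structures.
From mathcomp Require Import all_boot all_order all_algebra.
From mathcomp Require Import complex.
From mathcomp Require Import all_classical all_reals all_analysis.
From mathcomp Require Import ring lra.

Set Implicit Arguments.
Unset Strict Implicit.
Unset Printing Implicit Defensive.

Import Order.TTheory GRing.Theory Num.Theory.
Import numFieldNormedType.Exports.

Local Open Scope classical_set_scope.
Local Open Scope ring_scope.

Local Notation Re := complex.Re.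
Local Notation Im := complex.Im.

(** No spectral measure is involved. The only spectral input is a point of the spectrum whose
    modulus equals the norm, and it is used for p(L), which is again normal, instead of L; norm
    bounds for p(L) then follow without any further functional calculus.

    Instances are built backwards, from the resolvent: a normal L with |L x|^2 <= <L x, x> is the
    resolvent of the relation L^-1 - I, which is then maximal monotone. Hence the scaled operators a
    L need no explicit M, and the block of the extremal operator carrying a normal cone needs no
    separate treatment.

    For Anderson acceleration the obstacle is stagnation: the iterates of a cycle might fail to span
    the Krylov space, and optimality over their affine hull would then be weaker than optimality
    over polynomials. Firmness of L excludes this as long as the residual is not zero. *)

Lemma linear_pack (F : pzRingType) (V : lmodType F) (T : V -> V) :
  linear T -> exists f : {linear V -> V}, T = f.
Proof.
by move=> linT; exists (HB.pack_for {linear V -> V} T (GRing.isLinear.Build _ _ _ _ T linT)).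
Qed.

(** * Polynomials in a linear operator *)

Section OperatorPolynomial.
Context {F : comNzRingType} {V : lmodType F}.

(** Same formula as [poly_op], over an arbitrary commutative ring, because it is needed over the
    reals on H and over the complex numbers on the complexification. *)
Definition opoly (T : V -> V) (p : {poly F}) (x : V) : V :=
  \sum_(i < size p) p`_i *: iter i T x.

Variable T : {linear V -> V}.
Implicit Types (p q : {poly F}) (x y : V).

Lemma iter_linearP n (a : F) x y :
  iter n T (a *: x + y) = a *: iter n T x + iter n T y.
Proof. by elim: n => //= n ->; rewrite linearP. Qed.

Lemma opoly_widen n p x : (size p <= n)%N ->
  opoly T p x = \sum_(i < n) p`_i *: iter i T x.
Proof.
move=> pn; rewrite /opoly (big_ord_widen _ (fun i => p`_i *: iter i T x) pn).
rewrite big_mkcond /=; apply: eq_bigr => i _.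
by case: ltnP => // /(nth_default 0) ->; rewrite scale0r.
Qed.

Lemma opolyP p (a : F) x y :
  opoly T p (a *: x + y) = a *: opoly T p x + opoly T p y.
Proof.
rewrite /opoly scaler_sumr -big_split; apply: eq_bigr => i _ /=.
by rewrite iter_linearP scalerDr !scalerA mulrC.
Qed.

Lemma opoly_lin p (a : F) q x :
  opoly T (a *: p + q) x = a *: opoly T p x + opoly T q x.
Proof.
pose n := maxn (size (a *: p + q)) (maxn (size p) (size q)).
rewrite !(@opoly_widen n) ?leq_max ?leqnn ?orbT//.
rewrite scaler_sumr -big_split; apply: eq_bigr => i _ /=.
by rewrite coefD coefZ scalerDl scalerA.
Qed.

Lemma opoly0p x : opoly T 0 x = 0.
Proof. by rewrite /opoly size_poly0 big_ord0. Qed.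

Lemma opolyD p q x : opoly T (p + q) x = opoly T p x + opoly T q x.
Proof. by have := opoly_lin p 1 q x; rewrite !scale1r. Qed.

Lemma opolyZ (a : F) p x : opoly T (a *: p) x = a *: opoly T p x.
Proof. by have := opoly_lin p a 0 x; rewrite opoly0p !addr0. Qed.

Lemma opolyN p x : opoly T (- p) x = - opoly T p x.
Proof. by rewrite -[- p]scaleN1r opolyZ scaleN1r. Qed.

Lemma opolyB p q x : opoly T (p - q) x = opoly T p x - opoly T q x.
Proof. by rewrite opolyD opolyN. Qed.

Lemma opoly_sum n (f : 'I_n -> {poly F}) x :
  opoly T (\sum_i f i) x = \sum_i opoly T (f i) x.
Proof.
elim: n f => [|n IH] f; first by rewrite !big_ord0 opoly0p.
by rewrite !big_ord_recr /= opolyD IH.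
Qed.

Lemma opolyC (a : F) x : opoly T a%:P x = a *: x.
Proof. by rewrite (@opoly_widen 1) ?size_polyC_leq1// big_ord1 coefC. Qed.

Lemma opoly1 x : opoly T 1 x = x.
Proof. by rewrite opolyC scale1r. Qed.

Lemma opolyMX p x : opoly T (p * 'X) x = opoly T p (T x).
Proof.
have [->|p0] := eqVneq p 0; first by rewrite mul0r !opoly0p.
rewrite (@opoly_widen (size p).+1) ?size_mulX// big_ord_recl coefMX scale0r.
by rewrite add0r; apply: eq_bigr => i _; rewrite coefMX /= -iterSr.
Qed.

Lemma opoly_comm p x : T (opoly T p x) = opoly T p (T x).
Proof.
rewrite /opoly linear_sum; apply: eq_bigr => i _.
by rewrite linearZ /= -iterS iterSr.
Qed.

Lemma opolyM p q x : opoly T (p * q) x = opoly T p (opoly T q x).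
Proof.
elim/poly_ind: p => [|p c IH] in x *; first by rewrite mul0r !opoly0p.
rewrite mulrDl -mulrA (mulrC (polyX F)) mulrA !opolyD !opolyMX IH mul_polyC.
rewrite opolyZ.
by rewrite opolyC opoly_comm.
Qed.

Lemma opolyX x : opoly T 'X x = T x.
Proof. by rewrite -['X]mul1r opolyMX opoly1. Qed.

Lemma opoly_fix p x : T x = x -> opoly T p x = p.[1] *: x.
Proof.
move=> Tx; rewrite /opoly horner_coef scaler_suml; apply: eq_bigr => i _.
by rewrite expr1n mulr1; congr (_ *: _); elim: (nat_of_ord i) => //= n ->.
Qed.

Lemma opoly0 p : opoly T p 0 = 0.
Proof. by rewrite /opoly big1// => i _; rewrite iter_fix ?linear0 ?scaler0. Qed.

Lemma opolyBx p x y : opoly T p (x - y) = opoly T p x - opoly T p y.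
Proof.
have := opolyP p (-1) y x.
by rewrite !scaleN1r addrC => ->; rewrite addrC.
Qed.

End OperatorPolynomial.

(** * Roots of unity and Parseval's identity *)

Section ComplexModulus.
Context {R : realType}.
Implicit Types (z w : R[i]) (a b : R).
Local Open Scope complex_scope.

Lemma cmod_ge0 z : 0 <= cmod z.
Proof. by case: z => a b; exact: sqrtr_ge0. Qed.

Lemma cmodM z w : cmod (z * w) = cmod z * cmod w.
Proof. exact: ComplexField.Normc.normcM. Qed.

Lemma cmod0 : cmod (0 : R[i]) = 0.
Proof. exact: ComplexField.Normc.normc0. Qed.

Lemma cmod1 : cmod (1 : R[i]) = 1.
Proof. exact: ComplexField.Normc.normc1. Qed.

Lemma cmodN z : cmod (- z) = cmod z.
Proof. by case: z => a b /=; rewrite !sqrrN. Qed.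

Lemma cmodC z w : cmod (z - w) = cmod (w - z).
Proof. by rewrite -cmodN opprB. Qed.

Lemma cmod_eq0 z : (cmod z == 0) = (z == 0).
Proof.
by apply/eqP/eqP => [/ComplexField.Normc.eq0_normc|->] //; rewrite cmod0.
Qed.

Lemma cmod_gt0 z : (0 < cmod z) = (z != 0).
Proof. by rewrite lt0r cmod_ge0 andbT cmod_eq0. Qed.

Lemma cmodV z : cmod z^-1 = (cmod z)^-1.
Proof. exact: ComplexField.Normc.normcV. Qed.

Lemma cmodD z w : cmod (z + w) <= cmod z + cmod w.
Proof. exact: le_normcD. Qed.

Lemma cmodB z w : cmod (z - w) <= cmod z + cmod w.
Proof. by rewrite -[in leRHS](cmodN w) cmodD. Qed.

Lemma cmodX z n : cmod (z ^+ n) = cmod z ^+ n.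
Proof. by elim: n => [|n IH]; rewrite ?expr0 ?cmod1// !exprS cmodM IH. Qed.

Lemma cmod_real a : cmod a%:C = `|a|.
Proof. by rewrite /= expr0n addr0 sqrtr_sqr. Qed.

Lemma cmod_nat n : cmod (n%:R : R[i]) = n%:R.
Proof. by rewrite -(rmorph_nat (real_complex R)) cmod_real normr_nat. Qed.

Lemma cmod_conj z : cmod (conjc z) = cmod z.
Proof. by case: z => a b /=; rewrite sqrrN. Qed.

Lemma cmod_sum n (f : 'I_n -> R[i]) : cmod (\sum_i f i) <= \sum_i cmod (f i).
Proof.
elim: n f => [|n IH] f; first by rewrite !big_ord0 cmod0.
by rewrite !big_ord_recr /= (le_trans (cmodD _ _))// lerD2r IH.
Qed.

Lemma cmod_sqrC z : (cmod z ^+ 2)%:C = z * conjc z.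
Proof.
by rewrite cmod_sqr; case: z => a b; apply/eqP; rewrite eq_complex /=;
  apply/andP; split; apply/eqP; ring.
Qed.

Lemma cmod_sqrE z : cmod z ^+ 2 = Re z ^+ 2 + Im z ^+ 2.
Proof. by rewrite cmod_sqr !expr2. Qed.

Lemma ler_cmod z w : (cmod z <= cmod w) = (cmod z ^+ 2 <= cmod w ^+ 2).
Proof. by rewrite ler_pXn2r// nnegrE cmod_ge0. Qed.

Lemma conjcM z w : conjc (z * w) = conjc z * conjc w.
Proof. by case: z => a b; case: w => c d; congr Complex; ring. Qed.

Lemma conjcD z w : conjc (z + w) = conjc z + conjc w.
Proof. by case: z => a b; case: w => c d; congr Complex; ring. Qed.

Lemma conjcX z n : conjc (z ^+ n) = conjc z ^+ n.
Proof. by elim: n => [|n IH]; rewrite ?conjc1// !exprS conjcM IH. Qed.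

Lemma conjc_sum n (f : 'I_n -> R[i]) :
  conjc (\sum_i f i) = \sum_i conjc (f i).
Proof.
elim: n f => [|n IH] f; first by rewrite !big_ord0 conjc0.
by rewrite !big_ord_recr /= conjcD IH.
Qed.

Lemma Re_sub z w : Re (z - w) = Re z - Re w.
Proof. by case: z; case: w. Qed.

Lemma Im_sub z w : Im (z - w) = Im z - Im w.
Proof. by case: z; case: w. Qed.

Definition expi (t : R) : R[i] := Complex (cos t) (sin t).

Lemma cmod_expi t : cmod (expi t) = 1.
Proof. by rewrite /= cos2Dsin2 sqrtr1. Qed.

Lemma expiD s t : expi (s + t) = expi s * expi t.
Proof.
apply/eqP; rewrite eq_complex /= cosD sinD eqxx /=.
by rewrite addrC [X in _ + X]mulrC [cos s * _]mulrC mulrC.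
Qed.

Lemma expi0 : expi 0 = 1.
Proof. by rewrite /expi cos0 sin0. Qed.

Lemma expiMn t n : expi (t *+ n) = expi t ^+ n.
Proof.
by elim: n => [|n IH]; rewrite ?mulr0n ?expi0// mulrS expiD IH exprS.
Qed.

Lemma expi_conj t : conjc (expi t) = (expi t)^-1.
Proof.
have e0 : expi t != 0 by rewrite -cmod_gt0 cmod_expi.
apply: (mulfI e0); rewrite divff// -cmod_sqrC cmod_expi expr1n.
by [].
Qed.

Lemma expi_neq1 t : 0 < t < pi *+ 2 -> expi t != 1.
Proof.
move=> /andP[t0 t2]; rewrite eq_complex /=; apply/negP => /andP[/eqP c1 _].
have : 0 < sin (t / 2) by apply: sin_gt0_pi; rewrite -mulr_natl in t2; lra.
have e : t = (t / 2) *+ 2 by rewrite -mulr_natr; lra.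
by move=> s0; move: c1; rewrite e cos_mulr2n cos2sin2; have := mulr_gt0 s0 s0; nra.
Qed.

Section UnityRoots.
Variables (n : nat) (t0 : R).

(** The n-th roots of [expi (n t0)]: t0 = 0 gives the roots of unity used for the spectral radius,
    t0 = pi / n the roots of -1, which are the omega_j of the extremal instance. *)
Definition uroot (j : 'I_n) : R[i] := expi (t0 + pi * (2 * j)%:R / n%:R).

Lemma cmod_uroot j : cmod (uroot j) = 1.
Proof. exact: cmod_expi. Qed.

(** The d-th powers form a geometric progression with ratio z = exp(2 pi i d / n), where z^n = 1 and
    z != 1 because 0 < d < n. *)
Lemma sum_uroot d : (0 < d < n)%N -> \sum_j uroot j ^+ d = 0.
Proof.
move=> /andP[d0 dn]; have n0 : (0 < n)%N by case: (n) dn.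
have n0' : n%:R != 0 :> R by rewrite pnatr_eq0 -lt0n.
pose z := expi (pi * (2 * d)%:R / n%:R).
have E j : uroot j ^+ d = expi (t0 *+ d) * z ^+ j.
  rewrite /uroot /z -!expiMn -expiD; congr expi.
  rewrite mulrnDl -(mulr_natr (_ / _) d) -(mulr_natr (_ / _) j).
  move: (pi : R) => p.
  rewrite !natrM.
  by congr (_ + _); field.
under eq_bigr do rewrite E; rewrite -mulr_sumr.
apply/eqP; rewrite mulf_eq0; apply/orP; right.
have z1 : z != 1.
  apply: expi_neq1; rewrite -(mulr_natr pi) natrM.
  have n0r : 0 < n%:R :> R by rewrite ltr0n.
  have pi0 := pi_gt0 R.
  rewrite divr_gt0 ?mulr_gt0 ?ltr0n//= ltr_pdivrMr//.
  by rewrite -mulrA ltr_pM2l// ltr_pM2l// ltr_nat.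
have : (z - 1) * \sum_(j < n) z ^+ j = 0.
  rewrite -subrX1 /z -expiMn -(mulr_natr (_ / _) n) divfK// natrM mulrA.
  rewrite mulr_natr expiMn mulr_natr /expi cos2pi sin2pi.
  by rewrite -[Complex 1 0]/(1 : R[i]) expr1n subrr.
by move/eqP; rewrite mulf_eq0 subr_eq0 (negbTE z1).
Qed.

Lemma uroot_orthogonal (k l : 'I_n) :
  \sum_j uroot j ^+ k * conjc (uroot j ^+ l) = (n * (k == l))%:R.
Proof.
have wn0 j : uroot j != 0 by rewrite -cmod_gt0 cmod_uroot.
have wc j : conjc (uroot j) = (uroot j)^-1 by exact: expi_conj.
have main (k' l' : 'I_n) : (l' <= k')%N ->
    \sum_j uroot j ^+ k' * conjc (uroot j ^+ l') = (n * (k' == l'))%:R.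
  move=> lk; under eq_bigr => j _.
    by rewrite conjcX wc exprVn -expfB_cond ?(negbTE (wn0 j))//; over.
  move: lk; rewrite leq_eqVlt => /orP[/eqP e|lk].
    under eq_bigr do rewrite e subnn expr0.
    by rewrite sumr_const card_ord -val_eqE /= e eqxx muln1.
  rewrite sum_uroot ?subn_gt0 ?lk ?(leq_ltn_trans (leq_subr _ _))//.
  by rewrite -val_eqE gtn_eqF// muln0.
(* The case k < l is the complex conjugate of the case just proved. *)
have [/main//|/ltnW /main H] := leqP l k.
rewrite eq_sym -(conjc_nat R) -{}H conjc_sum; apply: eq_bigr => j _.
by rewrite conjcM conjcK mulrC.
Qed.

(** An arbitrary kernel [B] makes the scalar and the vector-valued Parseval identities two
    instances, with [B k l] a product or an inner product. *)
Lemma uroot_mean (B : 'I_n -> 'I_n -> R[i]) :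
  \sum_j \sum_(k < n) \sum_(l < n) uroot j ^+ k * conjc (uroot j ^+ l) * B k l =
  n%:R * \sum_k B k k.
Proof.
rewrite exchange_big mulr_sumr; apply: eq_bigr => k _ /=.
rewrite exchange_big (bigD1 k)//= -mulr_suml uroot_orthogonal eqxx muln1.
rewrite big1 ?addr0// => l lk.
by rewrite -mulr_suml uroot_orthogonal eq_sym (negbTE lk) muln0 mul0r.
Qed.

Lemma uroot_parseval (c : 'I_n -> R) :
  \sum_j cmod (\sum_(k < n) (c k)%:C * uroot j ^+ k) ^+ 2 =
  n%:R * \sum_k c k ^+ 2.
Proof.
apply: complexI; rewrite rmorph_sum rmorphM rmorph_nat rmorph_sum /=.
have := uroot_mean (fun k l => (c k)%:C * (c l)%:C).
under [in RHS]eq_bigr do rewrite -rmorphM /= -expr2.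
move=> <-; apply: eq_bigr => j _; rewrite cmod_sqrC conjc_sum mulr_suml.
apply: eq_bigr => k _; rewrite mulr_sumr; apply: eq_bigr => l _.
by rewrite conjcM conjc_real; ring.
Qed.

End UnityRoots.

(** Cauchy-Schwarz against the constant vector, by expanding the nonnegative double sum of (c k - c
    l)^2. *)
Lemma sum_sqr_le n (c : 'I_n -> R) : (\sum_k c k) ^+ 2 <= n%:R * \sum_k c k ^+ 2.
Proof.
have H : 0 <= \sum_k \sum_l (c k - c l) ^+ 2.
  by apply: sumr_ge0 => k _; apply: sumr_ge0 => l _; exact: sqr_ge0.
set S := \sum_k c k; set Q := \sum_k c k ^+ 2.
have E k : \sum_l (c k - c l) ^+ 2 = n%:R * c k ^+ 2 - c k * S *+ 2 + Q.
  under eq_bigr do rewrite sqrrB; rewrite big_split sumrB /= sumr_const.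
  by rewrite card_ord -[_ *+ n]mulr_natl sumrMnl -mulr_sumr.
move: H; under eq_bigr do rewrite E.
rewrite big_split sumrB /= -mulr_sumr sumrMnl -mulr_suml sumr_const card_ord.
by rewrite -[_ *+ n]mulr_natl -/S -/Q; lra.
Qed.

End ComplexModulus.

(** * Inner product calculus in a real Hilbert space *)

Section HilbertSpace.
Context {R : realType} {H : hilbertType R}.
Implicit Types (x y z : H) (a b : R).

Lemma dotDl x y z : dot (x + y) z = dot x z + dot y z.
Proof. by have := dot_linear 1 x y z; rewrite scale1r mul1r. Qed.

Lemma dot0l z : dot 0 z = 0.
Proof. by have := dotDl 0 0 z; rewrite addr0; lra. Qed.

Lemma dotZl a x z : dot (a *: x) z = a * dot x z.
Proof. by have := dot_linear a x 0 z; rewrite dot0l !addr0. Qed.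

Lemma dotNl x z : dot (- x) z = - dot x z.
Proof. by rewrite -scaleN1r dotZl mulN1r. Qed.

Lemma dotBl x y z : dot (x - y) z = dot x z - dot y z.
Proof. by rewrite dotDl dotNl. Qed.

Lemma dotDr x y z : dot x (y + z) = dot x y + dot x z.
Proof. by rewrite dotC dotDl !(dotC x). Qed.

Lemma dotZr a x z : dot x (a *: z) = a * dot x z.
Proof. by rewrite dotC dotZl dotC. Qed.

Lemma dotNr x z : dot x (- z) = - dot x z.
Proof. by rewrite dotC dotNl dotC. Qed.

Lemma dotBr x y z : dot x (y - z) = dot x y - dot x z.
Proof. by rewrite dotDr dotNr. Qed.

Lemma dot0r x : dot x 0 = 0.
Proof. by rewrite dotC dot0l. Qed.

Lemma dot_le x y : dot x y <= `|x| * `|y|.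
Proof.
have [->|x0] := eqVneq x 0; first by rewrite dot0l normr0 mul0r.
have [->|y0] := eqVneq y 0; first by rewrite dot0r normr0 mulr0.
have xy0 : 0 < `|x| * `|y| by rewrite mulr_gt0 ?normr_gt0.
have : 0 <= `| `|y| *: x - `|x| *: y | ^+ 2 by rewrite sqr_ge0.
rewrite -dot_norm dotBl !dotBr !dotZl !dotZr !dot_norm (dotC y x).
by move: (dot x y) `|x| `|y| xy0 => d a b; nra.
Qed.

End HilbertSpace.

(** * The complexified Hilbert space *)

Section ComplexHilbertSpace.
Context {R : realType} {H : hilbertType R}.
Local Notation HC := (complexification H).
Implicit Types (u v w : HC) (z : R[i]).
Local Open Scope complex_scope.

Lemma scaleC1 z u : (z *: u).1 = Re z *: u.1 - Im z *: u.2.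
Proof. by []. Qed.

Lemma scaleC2 z u : (z *: u).2 = Re z *: u.2 + Im z *: u.1.
Proof. by []. Qed.

Definition hdot u v : R[i] :=
  Complex (dot u.1 v.1 + dot u.2 v.2) (dot u.2 v.1 - dot u.1 v.2).

Lemma hdotC u v : hdot v u = conjc (hdot u v).
Proof.
by congr Complex; rewrite ?opprB (dotC v.1) (dotC v.2).
Qed.

Lemma hdotDl u v w : hdot (u + v) w = hdot u w + hdot v w.
Proof. by congr Complex; rewrite /= !dotDl; ring. Qed.

Lemma hdotZl z u w : hdot (z *: u) w = z * hdot u w.
Proof.
case: z => a b; congr Complex; rewrite scaleC1 scaleC2 /=;
  by rewrite !dotDl !dotNl !dotZl; ring.
Qed.

Lemma hdotZr z u w : hdot u (z *: w) = conjc z * hdot u w.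
Proof. by rewrite hdotC hdotZl conjcM -hdotC. Qed.

Lemma hdot_suml n (f : 'I_n -> HC) w :
  hdot (\sum_i f i) w = \sum_i hdot (f i) w.
Proof.
elim: n f => [|n IH] f; last by rewrite !big_ord_recr /= hdotDl IH.
by rewrite !big_ord0; congr Complex; rewrite /= !dot0l; ring.
Qed.

Lemma hdot_sumr n (f : 'I_n -> HC) w :
  hdot w (\sum_i f i) = \sum_i hdot w (f i).
Proof.
by rewrite hdotC hdot_suml conjc_sum; apply: eq_bigr => i _; rewrite -hdotC.
Qed.

Lemma cnorm_ge0 u : 0 <= cnorm u.
Proof. exact: sqrtr_ge0. Qed.

Lemma cnorm_sqr u : cnorm u ^+ 2 = `|u.1| ^+ 2 + `|u.2| ^+ 2.
Proof. by rewrite sqr_sqrtr// addr_ge0// sqr_ge0. Qed.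

Lemma hdot_cnorm u : hdot u u = (cnorm u ^+ 2)%:C.
Proof.
by rewrite cnorm_sqr -!dot_norm; congr Complex; rewrite dotC subrr.
Qed.

Lemma Re_hdot_le u v : Re (hdot u v) <= cnorm u * cnorm v.
Proof.
rewrite /=; have := dot_le u.1 v.1; have := dot_le u.2 v.2.
move: (dot u.1 v.1) (dot u.2 v.2) => d1 d2 h2 h1.
apply: (le_trans (lerD h1 h2)).
rewrite -(@ler_pXn2r _ 2)// ?nnegrE ?addr_ge0 ?mulr_ge0 ?cnorm_ge0//.
rewrite exprMn !cnorm_sqr.
move: `|u.1| `|u.2| `|v.1| `|v.2| => a b c d.
by have := sqr_ge0 (a * d - b * c); nra.
Qed.

Lemma cnorm0 : cnorm (0 : HC) = 0.
Proof. by rewrite /cnorm normr0 expr0n addr0 sqrtr0. Qed.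

Lemma cnormZ z u : cnorm (z *: u) = cmod z * cnorm u.
Proof.
apply: (@pexpIrn _ 2); rewrite ?nnegrE ?mulr_ge0 ?cnorm_ge0 ?cmod_ge0//.
apply: (@complexI R); rewrite -hdot_cnorm hdotZl hdotZr hdot_cnorm mulrA.
by rewrite -cmod_sqrC exprMn -rmorphM.
Qed.

Lemma cnormN u : cnorm (- u) = cnorm u.
Proof. by rewrite -scaleN1r cnormZ cmodN cmod1 mul1r. Qed.

Lemma cnormD_sqr u v :
  cnorm (u + v) ^+ 2 = cnorm u ^+ 2 + Re (hdot u v) *+ 2 + cnorm v ^+ 2.
Proof.
rewrite !cnorm_sqr /= -!dot_norm !dotDl !dotDr (dotC v.1 u.1) (dotC v.2 u.2).
by ring.
Qed.

Lemma cnormD u v : cnorm (u + v) <= cnorm u + cnorm v.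
Proof.
rewrite -(@ler_pXn2r _ 2)// ?nnegrE ?addr_ge0 ?cnorm_ge0//.
by rewrite cnormD_sqr sqrrD lerD2r lerD2l lerMn2r Re_hdot_le.
Qed.

Lemma cnormB u v : cnorm (u - v) <= cnorm u + cnorm v.
Proof. by rewrite -[in leRHS](cnormN v) cnormD. Qed.

Lemma cnormBC u v : cnorm (u - v) = cnorm (v - u).
Proof. by rewrite -cnormN opprB. Qed.

Lemma cnorm_eq0 u : cnorm u = 0 -> u = 0.
Proof.
move=> u0; have := cnorm_sqr u; rewrite u0 expr0n => /esym/eqP.
rewrite paddr_eq0 ?sqr_ge0// !sqrf_eq0 !normr_eq0 => /andP[/eqP h1 /eqP h2].
by case: u h1 h2 {u0} => a b /= -> ->.
Qed.

Lemma cnorm_gt0 u : u != 0 -> 0 < cnorm u.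
Proof.
move=> u0; rewrite lt0r cnorm_ge0 andbT.
by apply: contra u0 => /eqP/cnorm_eq0 ->.
Qed.

Lemma norm1_le_cnorm u : `|u.1| <= cnorm u.
Proof.
by rewrite -(@ler_pXn2r _ 2)// ?nnegrE ?cnorm_ge0// cnorm_sqr lerDl sqr_ge0.
Qed.

Lemma norm2_le_cnorm u : `|u.2| <= cnorm u.
Proof.
by rewrite -(@ler_pXn2r _ 2)// ?nnegrE ?cnorm_ge0// cnorm_sqr lerDr sqr_ge0.
Qed.

Lemma cnorm_le u : cnorm u <= `|u.1| + `|u.2|.
Proof.
rewrite -(@ler_pXn2r _ 2)// ?nnegrE ?cnorm_ge0 ?addr_ge0// cnorm_sqr.
by have := normr_ge0 u.1; have := normr_ge0 u.2; nra.
Qed.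

Lemma cnorm_real x : cnorm ((x, 0) : HC) = `|x|.
Proof. by rewrite /cnorm /= normr0 expr0n addr0 sqrtr_sqr normr_id. Qed.

End ComplexHilbertSpace.

Lemma geometric_cvg (R : realType) (V : completeNormedModType R)
    (u : nat -> V) (a q : R) : 0 <= q < 1 ->
  (forall n, `|u n.+1 - u n| <= a * q ^+ n) -> cvgn u.
Proof.
move=> /andP[q0 q1] du.
pose d n := u n.+1 - u n.
have -> : u = (fun n => u 0 + series d n).
  by apply/funext => n; exact: eq_sum_telescope.
apply: is_cvgD; first exact: is_cvg_cst.
apply: normed_cvg.
have : cvgn (series (geometric a q)).
  by apply: is_cvg_geometric_series; rewrite ger0_norm.
apply: series_le_cvg => n //=.
  by apply: le_trans (du n).
exact: du.
Qed.

(** * Bounded invertibility and perturbation *)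

Section BoundedInvertibility.
Context {R : realType} {H : hilbertType R}.
Local Notation HC := (complexification H).
Implicit Types (u v w : HC) (z : R[i]) (T E : HC -> HC).

(** The complexification carries its norm only as the function [cnorm], so completeness is
    transported from the two components. *)
Lemma complexification_cvg (u : nat -> HC) (a q : R) : 0 <= q < 1 ->
  (forall n, cnorm (u n.+1 - u n) <= a * q ^+ n) ->
  exists l, forall e : R, 0 < e -> \forall n \near \oo, cnorm (u n - l) < e.
Proof.
move=> q01 du.
have c1 : cvgn (fun n => (u n).1).
  apply: (geometric_cvg q01) => n.
  exact: (le_trans (norm1_le_cnorm (u n.+1 - u n)) (du n)).
have c2 : cvgn (fun n => (u n).2).
  apply: (geometric_cvg q01) => n.
  exact: (le_trans (norm2_le_cnorm (u n.+1 - u n)) (du n)).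
exists (lim ((fun n => (u n).1) @ \oo), lim ((fun n => (u n).2) @ \oo)) => e e0.
have e2 : 0 < e / 2 by rewrite divr_gt0.
move/cvgrPdist_lt : c1 => /(_ _ e2) c1.
move/cvgrPdist_lt : c2 => /(_ _ e2) c2.
near=> n; apply: (le_lt_trans (cnorm_le _)); rewrite (splitr e) ltrD//=.
  by rewrite distrC; near: n.
by rewrite distrC; near: n.
Unshelve. all: by end_near. Qed.

Lemma boundedly_invertible_below T : boundedly_invertible T ->
  exists2 c : R, 0 < c & forall u, c * cnorm u <= cnorm (T u).
Proof.
move=> [S [_ [C SC] TS _]].
(* The bound C of the inverse need not be positive, hence the enlargement before inverting. *)
have C1 : 0 < `|C| + 1 by rewrite ltr_wpDl.
exists (`|C| + 1)^-1; first by rewrite invr_gt0.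
move=> u; rewrite mulrC ler_pdivrMr// -{1}(TS u).
apply: (le_trans (SC _)); rewrite mulrC ler_wpM2l ?cnorm_ge0//.
by rewrite (le_trans (ler_norm _))// lerDl.
Qed.

(** Boundedness from below makes preimages unique, so those picked by choice form a linear map, with
    bound c^-1. *)
Lemma boundedly_invertible_intro T (c : R) : linear T -> 0 < c ->
  (forall u, c * cnorm u <= cnorm (T u)) -> (forall v, exists u, T u = v) ->
  boundedly_invertible T.
Proof.
move=> linT c0 Tc /choice[S TS].
have Tinj u v : T u = T v -> u = v.
  move=> uv; apply/subr0_eq/cnorm_eq0/le_anti; rewrite cnorm_ge0 andbT.
  rewrite -(pmulr_rle0 _ c0) (le_trans (Tc _))//.
  case: (linear_pack linT) uv => f ->; rewrite linearB => ->.
  by rewrite subrr cnorm0.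
exists S; split => //.
- by move=> a u v; apply: Tinj; rewrite linT !TS.
- by exists c^-1 => u; rewrite mulrC ler_pdivlMr// mulrC -{2}(TS u).
- by move=> u; apply: Tinj.
Qed.

(** With S the inverse of T, solving T u - E u = v means finding a fixed point of w -> S (v + E w),
    which contracts with ratio d / c; the iteration starts at 0. *)
Lemma boundedly_invertible_perturb T E (c d : R) : linear T -> linear E ->
  boundedly_invertible T -> (forall u, c * cnorm u <= cnorm (T u)) ->
  (forall u, cnorm (E u) <= d * cnorm u) -> 0 <= d < c ->
  boundedly_invertible (fun u => T u - E u).
Proof.
move=> linT linE [S [linS _ TS ST]] Tc Ed /andP[d0 dc].
have c0 : 0 < c by exact: le_lt_trans dc.
have Sc u : cnorm (S u) <= c^-1 * cnorm u.
  by rewrite mulrC ler_pdivlMr// mulrC -{2}(ST u).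
case: (linear_pack linT) (linear_pack linE) (linear_pack linS) => T' eT.
move=> [E' eE] [S' eS]; subst T E S.
apply: (@boundedly_invertible_intro _ (c - d)).
- by move=> a u v; rewrite !linearP scalerDr addrACA.
- by rewrite subr_gt0.
- move=> u; rewrite mulrBl lerBlDr (le_trans (Tc u))//.
  rewrite -{1}(subrK (E' u) (T' u)) (le_trans (cnormD _ _))// lerD2l.
  exact: Ed.
- move=> v; pose u n := iter n (fun w => S' (v + E' w)) 0.
  have q01 : 0 <= c^-1 * d < 1.
    by rewrite mulr_ge0 ?invr_ge0 ?(ltW c0)//= mulrC ltr_pdivrMr// mul1r.
  have SE w : cnorm (S' (E' w)) <= c^-1 * d * cnorm w.
    by rewrite (le_trans (Sc _))// -mulrA ler_pM2l ?invr_gt0.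
  have un n : u n.+1 = S' (v + E' (u n)) by [].
  have SB x y : S' (v + E' x) - S' (v + E' y) = S' (E' (x - y)).
    by rewrite -linearB opprD addrACA subrr add0r -linearB.
  have [|l ul] := @complexification_cvg u (cnorm (u 1%N)) _ q01.
    elim=> [|n IH]; first by rewrite subr0 expr0 mulr1.
    rewrite (un n.+1) [in X in _ - X](un n) SB exprS mulrCA.
    rewrite (le_trans (SE _))// ler_wpM2l//.
    by case/andP: q01.
  exists l.
  suff -> : T' l - E' l = v by [].
  suff lE : l = S' (v + E' l) by rewrite [in T' l]lE ST addrK.
  apply/esym/subr0_eq/cnorm_eq0/le_anti; rewrite cnorm_ge0 andbT.
  apply/ler_addgt0Pr => e e0; rewrite add0r.
  have e2 : 0 < e / 2 by rewrite divr_gt0.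
  have [n _ ue] := ul _ e2.
  rewrite -(subrKA (u n.+1)) {1}un SB.
  rewrite (le_trans (cnormD _ _))// (splitr e) lerD//; last first.
    exact/ltW/ue/leqnSn.
  rewrite (le_trans (SE _))// -[leRHS]mul1r ler_pM ?cnorm_ge0//.
    by case/andP: q01.
    by case/andP: q01 => _ /ltW.
    by rewrite cnormBC; exact/ltW/ue/leqnn.
Qed.

End BoundedInvertibility.

(** * The spectral radius of a normal operator *)

Section SpectralRadius.
Context {R : realType} {H : hilbertType R}.
Local Notation HC := (complexification H).
Implicit Types (u v w : HC) (z : R[i]) (T E : HC -> HC).
Local Open Scope complex_scope.

Lemma uroot_parseval_vector n (t0 : R) (v : 'I_n -> HC) :
  \sum_(j < n) cnorm (\sum_(k < n) uroot t0 j ^+ k *: v k) ^+ 2 =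
  n%:R * \sum_k cnorm (v k) ^+ 2.
Proof.
apply: (@complexI R); rewrite rmorph_sum rmorphM rmorph_nat rmorph_sum /=.
under [in RHS]eq_bigr do rewrite -hdot_cnorm.
have <- := uroot_mean t0 (fun k l : 'I_n => hdot (v k) (v l)).
apply: eq_bigr => j _; rewrite -hdot_cnorm hdot_suml.
apply: eq_bigr => k _; rewrite hdot_sumr; apply: eq_bigr => l _.
by rewrite hdotZl hdotZr mulrA.
Qed.

Variables (N : {linear HC -> HC}) (Ns : HC -> HC).
Hypothesis adjN : forall u v, hdot (N u) v = hdot u (Ns v).
Hypothesis comN : forall u, N (Ns u) = Ns (N u).

Lemma cnorm_adjoint u : cnorm (Ns u) = cnorm (N u).
Proof.
apply: (@pexpIrn _ 2); rewrite ?nnegrE ?cnorm_ge0//; apply: (@complexI R).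
by rewrite -!hdot_cnorm -adjN comN -[LHS]conjcK -hdotC -adjN -hdotC.
Qed.

(* [|N u|^2 = <Ns (N u), u>] and [|Ns (N u)| = |N (N u)|] by normality. *)
Lemma normal_log_convex u : cnorm (N u) ^+ 2 <= cnorm u * cnorm (N (N u)).
Proof.
have -> : cnorm (N u) ^+ 2 = Re (hdot u (Ns (N u))).
  by rewrite -adjN hdot_cnorm.
by rewrite (le_trans (Re_hdot_le _ _))// cnorm_adjoint.
Qed.

(** By log-convexity the ratios |N^(k+1) u| / |N^k u| do not decrease, so the first one bounds all
    of them from below. *)
Lemma normal_iter_growth (C r : R) u : 0 <= r ->
  (forall v, cnorm (N v) <= C * cnorm v) -> r * cnorm u <= cnorm (N u) ->
  forall k, r * cnorm (iter k N u) <= cnorm (iter k.+1 N u).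
Proof.
move=> r0 NC ru; elim=> [//|k IH]; rewrite !iterS in IH *.
set v := iter k N u in IH *; have := normal_log_convex v.
have [v0|v0] := eqVneq (cnorm v) 0.
  move=> _; have : cnorm (N v) <= 0 by rewrite (le_trans (NC v))// v0 mulr0.
  by move/(ler_wpM2l r0); rewrite mulr0 => /le_trans; apply; exact: cnorm_ge0.
have {}v0 : 0 < cnorm v by rewrite lt0r v0 cnorm_ge0.
move=> h; rewrite -(ler_pM2l v0); apply: le_trans h.
by rewrite mulrA (mulrC _ r) expr2 ler_wpM2r ?cnorm_ge0.
Qed.

Lemma iter_bound (C : R) u : 0 <= C ->
  (forall v, cnorm (N v) <= C * cnorm v) ->
  forall k, cnorm (iter k N u) <= C ^+ k * cnorm u.
Proof.
move=> C0 NC; elim=> [|k IH]; first by rewrite mul1r.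
by rewrite iterS exprS -mulrA (le_trans (NC _))// ler_wpM2l.
Qed.

(* For [w] on the unit circle the truncated Neumann sum
   [\sum_(k < n) (w / C) ^ k N ^ k u] is an approximate eigenvector of [N] for
   the point [C / w]: applying [N - C / w] telescopes. *)
Lemma approximate_eigenvector (C : R) (w : R[i]) u n : 0 < C -> cmod w = 1 ->
  (forall v, cnorm (N v) <= C * cnorm v) -> cnorm u <= 1 ->
  forall x, x = \sum_(k < n) w ^+ k *: ((C^-1)%:C ^+ k *: iter k N u) ->
  cnorm (N x - (C%:C * w^-1) *: x) <= 2 * C.
Proof.
move=> C0 w1 NC u1 x xE.
have w0 : w != 0 by rewrite -cmod_gt0 w1.
have C0' : C%:C != 0 by rewrite -cmod_gt0 cmod_real normr_gt0 gt_eqF.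
pose v k := w ^+ k *: ((C^-1)%:C ^+ k *: iter k N u).
have Nv k : N (v k) = (C%:C * w^-1) *: v k.+1.
  rewrite /v !linearZ /= !scalerA; congr (_ *: _).
  by rewrite !exprS fmorphV /=; field; rewrite w0 C0'.
have -> : N x - (C%:C * w^-1) *: x = (C%:C * w^-1) *: (v n - v 0).
  rewrite xE linear_sum; under eq_bigr do rewrite -/(v _) Nv.
  rewrite -scaler_sumr -scalerBr; congr (_ *: _).
  rewrite -sumrB (eq_bigr (fun k : 'I_n => v k.+1 - v k))//.
  by rewrite -(big_mkord xpredT (fun k => v k.+1 - v k)) telescope_sumr.
rewrite cnormZ cmodM cmodV w1 invr1 mulr1 cmod_real gtr0_norm// mulrC.
rewrite ler_pM2r// (le_trans (cnormB _ _))// (_ : 2 = 1 + 1)// lerD//.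
  rewrite !cnormZ !cmodX w1 expr1n mul1r cmod_real gtr0_norm ?invr_gt0//.
  rewrite exprVn mulrC ler_pdivrMr ?exprn_gt0// mul1r.
  rewrite (le_trans (iter_bound _ (ltW C0) NC _))//.
  by rewrite ler_piMr// exprn_ge0// ltW.
by rewrite /v !expr0 !scale1r.
Qed.

(** The supremum runs over the ball rather than the sphere, so that the set is nonempty even on the
    zero space. *)
Definition op_norm : R := sup [set cnorm (N u) | u in [set u | cnorm u <= 1]].

Hypothesis bndN : exists C : R, forall u, cnorm (N u) <= C * cnorm u.

Lemma op_norm_has_sup : has_sup [set cnorm (N u) | u in [set u | cnorm u <= 1]].
Proof.
split; first by exists (cnorm (N 0)), 0 => //=; rewrite cnorm0.
case: bndN => C NC; exists `|C| => _ [u /= u1 <-].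
rewrite (le_trans (NC u))// (le_trans (ler_norm _))// normrM.
by rewrite ler_piMr// ger0_norm// cnorm_ge0.
Qed.

Lemma op_norm_ge0 : 0 <= op_norm.
Proof.
apply: ub_le_sup; first by case: op_norm_has_sup.
by exists 0; rewrite /= ?cnorm0// linear0 cnorm0.
Qed.

Lemma op_norm_bound u : cnorm (N u) <= op_norm * cnorm u.
Proof.
have [->|u0] := eqVneq u 0; first by rewrite linear0 !cnorm0 mulr0.
have {}u0 := cnorm_gt0 u0; rewrite -ler_pdivrMr//.
apply: ub_le_sup; first by case: op_norm_has_sup.
have cu : cmod ((cnorm u)^-1)%:C = (cnorm u)^-1.
  by rewrite cmod_real gtr0_norm// invr_gt0.
exists (((cnorm u)^-1)%:C *: u); rewrite ?linearZ /= cnormZ cu.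
  by rewrite mulVf// gt_eqF.
by rewrite mulrC.
Qed.

Lemma expi_near (t e : R) : 0 < e ->
  \forall s \near t, cmod (expi s - expi t) < e.
Proof.
move=> e0; have e2 : 0 < e / 2 by rewrite divr_gt0.
have /cvgrPdist_lt /(_ _ e2) c := @continuous_cos R t.
have /cvgrPdist_lt /(_ _ e2) s := @continuous_sin R t.
apply: filterS2 c s => x /= c s.
rewrite distrC in c; rewrite distrC in s.
apply: (@le_lt_trans _ _ (`|cos x - cos t| + `|sin x - sin t|)); last first.
  by rewrite (splitr e) ltrD.
rewrite -(@ler_pXn2r _ 2)// ?nnegrE ?sqrtr_ge0 ?addr_ge0//.
rewrite sqr_sqrtr ?addr_ge0 ?sqr_ge0//.
move: (cos x - cos t) (sin x - sin t) => a b.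
have <- : `|a| ^+ 2 = a ^+ 2 by rewrite real_normK ?num_real.
have <- : `|b| ^+ 2 = b ^+ 2 by rewrite real_normK ?num_real.
by have := mulr_ge0 (normr_ge0 a) (normr_ge0 b); nra.
Qed.

(** A lower bound c at one angle persists as c / 2 at nearby angles, and compactness extracts a
    single constant. The angles range over [-2 pi, 0] because the bound is applied at the inverses
    of the roots of unity. *)
Lemma circle_uniform_bound (C : R) : 0 <= C ->
  (forall t, boundedly_invertible (fun u => N u - (C%:C * expi t) *: u)) ->
  exists m : nat, forall t u, - (pi *+ 2) <= t <= 0 ->
    cnorm u <= m%:R * cnorm (N u - (C%:C * expi t) *: u).
Proof.
move=> C0 inv.
have /compact_near_coveringP cov := @segment_compact R (- (pi *+ 2)) 0.
pose P (m : nat) (t : R) := forall u,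
  cnorm u <= m%:R * cnorm (N u - (C%:C * expi t) *: u).
have [|m _ Pm] := cov nat \oo P _.
  move=> t _; have [c c0 cN] := boundedly_invertible_below (inv t).
  (* Points of the unit circle this close move the operator by at most c / 2; the summand 1 covers C
     = 0. *)
  have d0 : 0 < c / 2 / (C + 1) by rewrite !divr_gt0// ltr_wpDl.
  near=> s m => u /=.
  have st : cmod (expi s - expi t) < c / 2 / (C + 1).
    by near: s; exact: expi_near.
  have st' : C * cmod (expi s - expi t) <= c / 2.
    rewrite ltr_pdivlMr ?ltr_wpDl// in st.
    rewrite (le_trans _ (ltW st))// mulrC ler_wpM2l ?cmod_ge0//.
    by rewrite lerDl.
  have mc : 2 / c <= m%:R by near: m; exact: nbhs_infty_ger.
  have : c / 2 * cnorm u <= cnorm (N u - (C%:C * expi s) *: u).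
    have := cN u; rewrite -(subrKA ((C%:C * expi s) *: u)) -scalerBl -mulrBr.
    move=> h; have := le_trans h (cnormD _ _).
    rewrite cnormZ cmodM cmod_real ger0_norm//.
    have := ler_wpM2r (cnorm_ge0 u) st'.
    by move: (cnorm (N u - _)) => n; lra.
  move=> h; have := ler_wpM2l (ltW (divr_gt0 (ltr0Sn R 1) c0)) h.
  rewrite mulrA (_ : 2 / c * (c / 2) = 1) ?mul1r; last by field; rewrite gt_eqF.
  by move=> /le_trans; apply; rewrite ler_wpM2r// cnorm_ge0.
by exists m => t u t0; apply: (Pm m (leqnn m)); rewrite /= in_itv.
Unshelve. all: by end_near. Qed.

Lemma normal_iter_lower n u : (0 < n)%N -> 0 < op_norm -> cnorm u <= 1 ->
  (1 - (4 * n%:R)^-1) * op_norm <= cnorm (N u) ->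
  n%:R / 2 <= \sum_(k < n) cnorm ((op_norm^-1)%:C ^+ k *: iter k N u) ^+ 2.
Proof.
move=> n0 C0 u1 Nu; set C := op_norm in C0 Nu *.
set e := (4 * n%:R)^-1 in Nu.
have n0' : 0 < n%:R :> R by rewrite ltr0n.
have e0 : 0 < e by rewrite invr_gt0 mulr_gt0.
have ne : n%:R * e = 4^-1 by rewrite /e; field; rewrite gt_eqF.
have e1 : e <= 4^-1.
  by rewrite -ne ler_peMl ?(ltW e0)// ler1n.
have r0 : 0 <= (1 - e) * C by rewrite mulr_ge0 ?(ltW C0)//; lra.
(* The extra factor 1 - e accounts for [u] itself, which lies in the unit ball and is only known to
   have norm at least 1 - e. *)
have grow : forall k, (1 - e) ^+ k.+1 * C ^+ k <= cnorm (iter k N u).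
  elim=> [|k IH].
    rewrite expr1 mulr1 -(ler_pM2r C0) (le_trans Nu)// mulrC.
    exact: op_norm_bound.
  apply: (@le_trans _ _ ((1 - e) * C * cnorm (iter k N u))).
    by rewrite exprS [C ^+ _]exprS mulrACA ler_wpM2l.
  by apply: (normal_iter_growth r0 op_norm_bound); rewrite (le_trans _ Nu)// ler_piMr.
have -> : n%:R / 2 = \sum_(k < n) (1 / 2) :> R.
  by rewrite sumr_const card_ord -(mulr_natl (1 / 2)) mul1r.
apply: ler_sum => k _.
have h : (1 - e) ^+ n <= cnorm ((C^-1)%:C ^+ k *: iter k N u).
  rewrite cnormZ cmodX cmod_real gtr0_norm ?invr_gt0// exprVn mulrC.
  rewrite ler_pdivlMr ?exprn_gt0// (le_trans _ (grow k))//.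
  by rewrite ler_wpM2r ?exprn_ge0 ?(ltW C0)// ler_wiXn2l//; lra.
(* Bernoulli's inequality: with n e = 1/4 the power is at least 3/4, and (3/4)^2 > 1/2. *)
have b : 1 - n%:R * e <= (1 - e) ^+ n.
  elim: (n) => [|k' IH]; first by rewrite mul0r subr0.
  rewrite exprS -natr1; have : 0 <= (1 - e) by lra.
  move=> /ler_wpM2l /(_ _ _ IH) /(le_trans _); apply.
  by have := ler0n R k'; nra.
by rewrite ne in b; nra.
Qed.

Lemma normal_spectral_radius : (exists u, u != 0) -> exists z,
  ~ boundedly_invertible (fun u => N u - z *: u) /\
  forall u, cnorm (N u) <= cmod z * cnorm u.
Proof.
move=> [u0 u0n]; have [C0|C0] := eqVneq op_norm 0.
  exists 0; split=> [|u]; last first.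
    by rewrite cmod0 mul0r (le_trans (op_norm_bound u))// C0 mul0r.
  move=> /boundedly_invertible_below[c c0 /(_ u0)].
  rewrite scale0r subr0 => h; have := le_trans h (op_norm_bound u0).
  by rewrite C0 mul0r pmulr_rle0// leNgt cnorm_gt0.
have {}C0 : 0 < op_norm by rewrite lt0r C0 op_norm_ge0.
apply: contrapT => /forallNP noz.
have inv t : boundedly_invertible (fun u => N u - (op_norm%:C * expi t) *: u).
  apply: contrapT => h; apply: (noz (op_norm%:C * expi t)); split => // u.
  rewrite cmodM cmod_expi mulr1 cmod_real gtr0_norm//; exact: op_norm_bound.
have [m mb] := circle_uniform_bound (ltW C0) inv.
pose B := m%:R * (2 * op_norm).
(* If the whole circle were regular, each of the n Neumann averages would have norm at most B, while
   by Parseval their squared norms have mean at least n / 2; this is contradictory once n > 2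
   B^2. *)
pose n := (Num.truncn (2 * B ^+ 2)).+1.
have nB : 2 * B ^+ 2 < n%:R.
  by rewrite /n; apply: truncnS_gt.
have n0 : 0 < n%:R :> R by rewrite ltr0n.
have [_ [u /= u1 <-] Nu] : exists2 a, [set cnorm (N u) | u in [set u | cnorm u <= 1]] a &
    op_norm - (4 * n%:R)^-1 * op_norm < a.
  apply: sup_adherent; last exact: op_norm_has_sup.
  by rewrite mulr_gt0// invr_gt0 mulr_gt0.
have low : n%:R / 2 <= \sum_(k < n) cnorm ((op_norm^-1)%:C ^+ k *: iter k N u) ^+ 2.
  by apply: normal_iter_lower => //; rewrite mulrBl mul1r ltW.
pose x j := \sum_(k < n) (@uroot R n 0 j) ^+ k *: ((op_norm^-1)%:C ^+ k *: iter k N u).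
have := uroot_parseval_vector 0 (fun k : 'I_n => (op_norm^-1)%:C ^+ k *: iter k N u).
apply/eqP; rewrite lt_eqF// -/(x _).
apply: (@le_lt_trans _ _ (n%:R * B ^+ 2)); last first.
  by rewrite ltr_pM2l// (lt_le_trans _ low)//; lra.
rewrite mulr_natl -[n in B ^+ 2 *+ n]card_ord -sumr_const.
apply: ler_sum => j _; rewrite ler_pXn2r ?nnegrE ?cnorm_ge0//; last first.
  by rewrite /B !mulr_ge0// ltW.
have W : (uroot 0 j)^-1 = expi (- (pi * (2 * j)%:R / n%:R)) :> R[i].
  rewrite /uroot add0r; apply: (@mulfI _ (expi (pi * (2 * j)%:R / n%:R))).
    by rewrite -cmod_gt0 cmod_expi.
  by rewrite -expiD subrr expi0 divff// -cmod_gt0 cmod_expi.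
apply: (le_trans (mb (- (pi * (2 * j)%:R / n%:R)) _ _)).
  have pi0 := pi_gt0 R.
  rewrite oppr_le0 lerN2 divr_ge0 ?mulr_ge0 ?(ltW pi0)//= andbT.
  rewrite ler_pdivrMr// -[pi *+ 2]mulr_natr -mulrA ler_pM2l// natrM.
  by rewrite ler_pM2l// ler_nat ltnW.
rewrite -W ler_wpM2l//; apply: approximate_eigenvector u1 _ _ => //.
  exact: cmod_uroot.
exact: op_norm_bound.
Qed.

End SpectralRadius.

(** * Polynomial functional calculus *)

Section FunctionalCalculus.
Context {R : realType} {H : hilbertType R}.
Local Notation HC := (complexification H).
Implicit Types (u v w : HC) (z : R[i]) (T E : HC -> HC) (L A : H -> H).
Local Open Scope complex_scope.

Lemma complexify_linear L : linear L -> linear (complexify L).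
Proof.
move=> /linear_pack[f ->] z u v; rewrite /complexify.
by congr pair; rewrite /= ?scaleC1 ?scaleC2 /= linearD ?linearB ?linearD /= !linearZ.
Qed.

Lemma boundedly_invertible_comp T1 T2 : boundedly_invertible T1 ->
  boundedly_invertible T2 -> boundedly_invertible (T1 \o T2).
Proof.
move=> [S1 [lin1 [C1 b1] TS1 ST1]] [S2 [lin2 [C2 b2] TS2 ST2]].
exists (S2 \o S1); split.
- by move=> a u v /=; rewrite lin1 lin2.
- exists (`|C2| * C1) => u /=; rewrite (le_trans (b2 _))// -mulrA.
  rewrite (le_trans (ler_wpM2r (cnorm_ge0 _) (ler_norm _)))//.
  by rewrite ler_wpM2l.
- by move=> u /=; rewrite TS1 TS2.
- by move=> u /=; rewrite ST2 ST1.
Qed.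

Lemma boundedly_invertible_scale z : z != 0 ->
  boundedly_invertible (fun u => z *: u).
Proof.
move=> z0; exists (fun u => z^-1 *: u); split.
- by move=> a u v; rewrite scalerDr !scalerA mulrC.
- by exists (cmod z^-1) => u; rewrite cnormZ.
- by move=> u; rewrite scalerA mulVf// scale1r.
- by move=> u; rewrite scalerA mulfV// scale1r.
Qed.

Lemma boundedly_invertible_prod (T : {linear HC -> HC}) (s : seq R[i]) :
  (forall z, z \in s -> boundedly_invertible (fun u => T u - z *: u)) ->
  boundedly_invertible (opoly T (\prod_(z <- s) ('X - z%:P))).
Proof.
elim: s => [|z s IH] sP.
  rewrite big_nil; have -> : opoly T 1 = (fun u => 1 *: u).
    by apply/funext => u; rewrite opoly1 scale1r.
  exact: boundedly_invertible_scale (oner_neq0 _).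
rewrite big_cons.
have -> : opoly T (('X - z%:P) * \prod_(j <- s) ('X - j%:P)) =
    (fun u => T u - z *: u) \o opoly T (\prod_(j <- s) ('X - j%:P)).
  by apply/funext => u /=; rewrite opolyM opolyB opolyX opolyC.
apply: boundedly_invertible_comp; first exact/sP/mem_head.
by apply: IH => w ws; apply: sP; rewrite in_cons ws orbT.
Qed.

Lemma adjoint_linear L A : (forall x y, dot (L x) y = dot x (A y)) -> linear A.
Proof.
move=> adj a x y; apply/subr0_eq/normr0_eq0/eqP.
rewrite -sqrf_eq0 -dot_norm; apply/eqP; set d := _ - _.
by rewrite dotBr dotDr dotZr -!adj dotDr dotZr subrr.
Qed.

Lemma hdot_complexify L A : (forall x y, dot (L x) y = dot x (A y)) ->
  forall u v, hdot (complexify L u) v = hdot u (complexify A v).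
Proof. by move=> adj u v; congr Complex; rewrite /= !adj. Qed.

Lemma complexify_bounded L (C : R) : (forall x, `|L x| <= C * `|x|) ->
  forall u, cnorm (complexify L u) <= `|C| * cnorm u.
Proof.
move=> LC u; rewrite -(@ler_pXn2r _ 2)// ?nnegrE ?mulr_ge0 ?cnorm_ge0//.
rewrite exprMn !cnorm_sqr /= mulrDr -!exprMn lerD//.
  by rewrite ler_pXn2r ?nnegrE ?mulr_ge0// (le_trans (LC _))// ler_wpM2r// ler_norm.
by rewrite ler_pXn2r ?nnegrE ?mulr_ge0// (le_trans (LC _))// ler_wpM2r// ler_norm.
Qed.

Lemma opoly_bounded (T : {linear HC -> HC}) (C : R) (p : {poly R[i]}) : 0 <= C ->
  (forall u, cnorm (T u) <= C * cnorm u) ->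
  exists B : R, forall u, cnorm (opoly T p u) <= B * cnorm u.
Proof.
move=> C0 TC; elim/poly_ind: p => [|p c [B pB]].
  by exists 0 => u; rewrite opoly0p cnorm0 mul0r.
exists (`|B| * C + cmod c) => u; rewrite opolyD opolyMX opolyC.
rewrite (le_trans (cnormD _ _))// mulrDl cnormZ lerD2r (le_trans (pB _))//.
rewrite (le_trans (ler_wpM2r (cnorm_ge0 _) (ler_norm B)))//.
by rewrite -mulrA ler_wpM2l.
Qed.

Lemma opoly_intertwine (T : {linear HC -> HC}) (f : {linear HC -> HC})
    (p : {poly R[i]}) u : (forall v, T (f v) = f (T v)) ->
  opoly T p (f u) = f (opoly T p u).
Proof.
move=> Tf; rewrite /opoly linear_sum; apply: eq_bigr => i _.
rewrite linearZ /=; congr (_ *: _).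
by elim: (nat_of_ord i) => //= n ->; rewrite Tf.
Qed.

(** p(L) is normal: its adjoint is the polynomial with conjugated coefficients in the adjoint of L,
    and the two commute. *)
Lemma normal_opoly_radius L (p : {poly R[i]}) : normal_operator L ->
  (exists u : HC, u != 0) -> exists z,
  ~ boundedly_invertible (fun u => opoly (complexify L) p u - z *: u) /\
  forall u, cnorm (opoly (complexify L) p u) <= cmod z * cnorm u.
Proof.
move=> [[linL [C LC]] [A [adj com]]] nontriv.
have linA := adjoint_linear adj.
have adjC := hdot_complexify adj.
have bC := complexify_bounded LC.
have comC u : complexify L (complexify A u) = complexify A (complexify L u).
  by congr pair; rewrite /= com.
case: (linear_pack (complexify_linear linL)) adjC bC comC => T ->.
case: (linear_pack (complexify_linear linA)) => S -> adjC bC comC.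
have linN : linear (opoly T p) by move=> a u v; rewrite opolyP.
pose Ns v := \sum_(i < size p) conjc p`_i *: iter i S v.
have adjI i u v : hdot (iter i T u) v = hdot u (iter i S v).
  by elim: i v => //= i IH v; rewrite adjC IH -iterSr.
have adjN u v : hdot (opoly T p u) v = hdot u (Ns v).
  rewrite hdot_suml hdot_sumr; apply: eq_bigr => i _.
  by rewrite hdotZl hdotZr conjcK adjI.
have comN u : opoly T p (Ns u) = Ns (opoly T p u).
  have linp : linear (opoly T p) by move=> a w v; rewrite opolyP.
  have [B pB] := linear_pack linp.
  rewrite /Ns {1}pB linear_sum; apply: eq_bigr => i _; rewrite linearZ /= -pB.
  congr (_ *: _); elim: (nat_of_ord i) => //= n IH.
  by rewrite opoly_intertwine// IH.
have bN := opoly_bounded p (normr_ge0 C) bC.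
case: (linear_pack linN) adjN comN bN => N -> adjN comN bN.
exact: normal_spectral_radius adjN comN bN nontriv.
Qed.

Lemma normal_spectrum_nonempty L : normal_operator L ->
  (exists x : H, x != 0) -> exists z, spectrum L z.
Proof.
move=> norL [x x0].
have [|z [h _]] := normal_opoly_radius 'X norL.
  by exists (x, 0); apply: contra x0 => /eqP[->].
exists z; rewrite /spectrum /=; move: h.
have [[linL _] _] := norL.
case: (linear_pack (complexify_linear linL)) => T ->.
by under [X in boundedly_invertible X]funext do rewrite opolyX.
Qed.

(* [p - z] splits into linear factors, one of which must fail to be invertible
   at [L]. *)
Lemma spectral_mapping L (p : {poly R[i]}) z : linear L -> (1 < size p)%N ->
  ~ boundedly_invertible (fun u => opoly (complexify L) p u - z *: u) ->
  exists2 w, spectrum L w & p.[w] = z.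
Proof.
move=> linL p1; pose q := p - z%:P.
have q1 : (1 < size q)%N.
  by rewrite /q size_polyDl// size_polyN (leq_ltn_trans (size_polyC_leq1 _)).
have q0 : lead_coef q != 0.
  by rewrite lead_coef_eq0 -size_poly_gt0 (ltn_trans _ q1).
have [s qE] := closed_field_poly_normal q.
have [[w ws spw] _|nos] := pselect (exists2 w, w \in s & spectrum L w).
  exists w => //; have : root q w by rewrite qE rootZ// root_prod_XsubC.
  by rewrite rootE hornerD hornerN hornerC subr_eq0 => /eqP.
case; case: (linear_pack (complexify_linear linL)) => T eT.
have -> : (fun u => opoly (complexify L) p u - z *: u) =
    (fun u => lead_coef q *: u) \o opoly T (\prod_(w <- s) ('X - w%:P)).
  apply/funext => u /=; rewrite -opolyZ -qE /q opolyB opolyC eT//.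
apply: boundedly_invertible_comp; first exact: boundedly_invertible_scale.
apply: boundedly_invertible_prod => w ws; apply: contrapT => h.
by apply: nos; exists w => //; rewrite /spectrum /= eT.
Qed.

Theorem normal_poly_bound L (p : {poly R[i]}) (M : R) : normal_operator L ->
  (forall z, spectrum L z -> cmod p.[z] <= M) ->
  forall u, cnorm (opoly (complexify L) p u) <= M * cnorm u.
Proof.
move=> norL pM u; have [[linL _] _] := norL.
case: (linear_pack (complexify_linear linL)) => T eT.
have [->|u0] := eqVneq u 0; first by rewrite eT opoly0 cnorm0 mulr0.
have nontriv : exists x : H, x != 0.
  apply: contrapT => /forallNP h; move/eqP: u0; apply; case: u => x y.
  have z0 (t : H) : t = 0 by apply/eqP; have /negP := h t; rewrite negbK.
  by rewrite (z0 x) (z0 y).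
(* Spectral mapping requires a nonconstant p. For a constant one, M is compared with p at any point
   of the spectrum, which is nonempty because H is nontrivial. *)
have [p1|p1] := leqP (size p) 1.
  have [z0 /pM] := normal_spectrum_nonempty norL nontriv.
  rewrite (size1_polyC p1) hornerC eT opolyC cnormZ => h.
  by rewrite ler_wpM2r ?cnorm_ge0.
have [|z [ninv /(_ u) pz]] := normal_opoly_radius p norL; first by exists u.
have [w /pM + pw] := spectral_mapping linL p1 ninv.
by rewrite pw => h; rewrite (le_trans pz)// ler_wpM2r// cnorm_ge0.
Qed.

(** The Chebyshev number ranges over complex polynomials, while GMRES and Anderson mixing use real
    coefficients. On a real vector, (Re q)(L) x is the first component of q(L) x, so passing to real
    parts does not spoil a norm bound, and it preserves the value 1 at 1. *)
Definition poly_Re (q : {poly R[i]}) : {poly R} := \poly_(i < size q) Re q`_i.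

Lemma size_poly_Re q : (size (poly_Re q) <= size q)%N.
Proof. exact: size_poly. Qed.

Lemma horner_sum_Re (q : {poly R[i]}) : (poly_Re q).[1] = Re q.[1].
Proof.
rewrite horner_poly horner_coef; under eq_bigr do rewrite expr1n mulr1.
under [in RHS]eq_bigr do rewrite expr1n mulr1.
elim: (size q) => [|n IH]; first by rewrite !big_ord0.
by rewrite !big_ord_recr /= IH; case: (\sum_(i < n) _) => a b; case: (q`_n).
Qed.

Lemma poly_Re_map (p : {poly R}) : poly_Re (map_poly (real_complex R) p) = p.
Proof.
apply/polyP => i; rewrite coef_poly coef_map /=.
by rewrite size_map_poly; case: ltnP => // /(nth_default 0) ->.
Qed.

Lemma opoly_Re L (q : {poly R[i]}) x : linear L ->
  (opoly (complexify L) q (x, 0)).1 = opoly L (poly_Re q) x.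
Proof.
case/linear_pack => f ->.
have it i : iter i (complexify f) (x, 0) = (iter i f x, 0).
  by elim: i => //= i ->; rewrite /complexify /= linear0.
rewrite (opoly_widen f _ (size_poly_Re q)) /opoly.
have E i : (i < size q)%N -> (poly_Re q)`_i = Re q`_i.
  by move=> iq; rewrite coef_poly iq.
have -> : \sum_(i < size q) (poly_Re q)`_i *: iter i f x =
    \sum_(i < size q) Re q`_i *: iter i f x.
  by apply: eq_bigr => i _; rewrite E.
elim: (size q) => [|n IH]; first by rewrite !big_ord0.
by rewrite !big_ord_recr /= IH it /= scaler0 subr0.
Qed.

Lemma normal_poly_Re_bound L (q : {poly R[i]}) (M : R) : normal_operator L ->
  (forall z, spectrum L z -> cmod q.[z] <= M) ->
  forall x, `|opoly L (poly_Re q) x| <= M * `|x|.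
Proof.
move=> norL qM x; have [[linL _] _] := norL.
rewrite -opoly_Re// (le_trans (norm1_le_cnorm _))//.
by rewrite -[in leRHS](@cnorm_real _ _ x); exact: normal_poly_bound.
Qed.

Lemma normal_real_poly_bound L (p : {poly R}) (M : R) : normal_operator L ->
  (forall z, spectrum L z -> cmod (map_poly (real_complex R) p).[z] <= M) ->
  forall x, `|opoly L p x| <= M * `|x|.
Proof. by move=> norL pM x; rewrite -{1}(poly_Re_map p) normal_poly_Re_bound. Qed.

End FunctionalCalculus.

(** * Resolvents of monotone relations *)

Section Resolvents.
Context {R : realType} {H : hilbertType R}.
Local Notation HC := (complexification H).
Implicit Types (M N : H -> set H) (L : H -> H) (x y z u v : H).
Local Open Scope complex_scope.

Lemma norm_sqr_eq0 x : `|x| ^+ 2 <= 0 -> x = 0.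
Proof.
move=> h; apply/normr0_eq0/eqP; rewrite -sqrf_eq0.
by apply/eqP/le_anti; rewrite h sqr_ge0.
Qed.

Lemma monotone_unique M x y y' : monotone_relation M ->
  M y (x - y) -> M y' (x - y') -> y = y'.
Proof.
move=> mono My My'; apply/subr0_eq/norm_sqr_eq0; rewrite -dot_norm.
have := mono _ _ _ _ My My'.
have -> : x - y - (x - y') = - (y - y') by rewrite opprB addrC subrKA opprB.
by rewrite dotNr oppr_ge0.
Qed.

(* If [I + M] missed a point then linearity would make the totalized resolvent
   vanish, so M would live over [0] only and [{0} * H] would extend it. *)
Lemma resolventP M x : normal_maximal_monotone M ->
  M (resolvent M x) (x - resolvent M x).
Proof.
move=> [[M0 Mlin] [mono maxM] [[linL _] _]].
suff : exists y, M y (x - y) by exact: xgetPex.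
apply: contrapT => nox.
have dom0 w : ~ (exists y, M y (w - y)) -> resolvent M w = 0.
  by move=> /forallNP h; apply: xgetPN => y; exact: h.
have L0 w : resolvent M w = 0.
  have [[y My]|/dom0//] := pselect (exists y, M y (w - y)).
  have xw0 : resolvent M (x + w) = 0.
    apply: dom0 => -[y' My']; apply: nox; exists (-1 *: y + y').
    have := Mlin (-1) _ _ _ _ My My'; congr (M _ _).
    rewrite !scaleN1r opprB !opprD opprK !addrA.
    by rewrite [y - w + x]addrC addrA subrK.
  move: xw0; case: (linear_pack linL) (dom0 _ nox) => f -> x0.
  by rewrite linearD x0 add0r.
have My0 y u : M y u -> y = 0.
  move=> Myu; rewrite -(L0 (y + u)).
  have My' : M y (y + u - y) by rewrite addrC addKr.
  by apply: (monotone_unique mono My'); exact: (xgetI 0 (P := [set z | M z (y + u - z)]) My').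
pose N0 : H -> set H := fun y => [set u | y = 0].
apply: nox; exists 0; rewrite subr0.
apply: (maxM N0 _ _ 0 x (erefl 0 : N0 0 x)).
- by move=> y u y' u' /= -> ->; rewrite subrr dot0l.
- by move=> y u /My0.
Qed.

Lemma resolvent_eq M x y : normal_maximal_monotone M ->
  M y (x - y) <-> y = resolvent M x.
Proof.
move=> nM; split=> [My|->]; last exact: resolventP.
have [_ [mono _] _] := nM.
exact: (monotone_unique mono My (resolventP x nM)).
Qed.

Lemma zerosE M z : normal_maximal_monotone M ->
  zeros M z <-> resolvent M z = z.
Proof.
move=> nM; have := resolvent_eq z z nM; rewrite subrr => h.
by split=> [/h|/esym/h].
Qed.

Lemma resolvent_firm M x : normal_maximal_monotone M ->
  `|resolvent M x| ^+ 2 <= dot (resolvent M x) x.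
Proof.
move=> nM; have [[M0 _] [mono _] _] := nM.
have := mono _ _ _ _ (resolventP x nM) M0.
by rewrite !subr0 dotBr dot_norm subr_ge0.
Qed.

Lemma firm_half_norm L x : `|L x| ^+ 2 <= dot (L x) x ->
  `|L x - 2^-1 *: x| <= 2^-1 * `|x|.
Proof.
move=> h; rewrite -(@ler_pXn2r _ 2)// ?nnegrE ?mulr_ge0//.
rewrite exprMn -!dot_norm dotBl !dotBr !dotZl !dotZr (dotC x (L x)).
by rewrite !dot_norm; lra.
Qed.

Lemma firm_norm L x : `|L x| ^+ 2 <= dot (L x) x -> `|L x| <= `|x|.
Proof.
move=> h; have {h} := le_trans h (dot_le _ _).
have [->|x0] := eqVneq (L x) 0; first by rewrite normr0.
by rewrite expr2 ler_pM2l// normr_gt0.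
Qed.

Lemma complexification_scale_real (a : R) (w : HC) :
  a%:C *: w = (a *: w.1, a *: w.2).
Proof.
have -> : a%:C *: w = ((a%:C *: w).1, (a%:C *: w).2) by [].
by rewrite scaleC1 scaleC2 /= !scale0r subr0 addr0.
Qed.

(** Outside the disk the scalar z - a dominates L - a, so (z - a) - (L - a) is an admissible
    perturbation of an invertible scalar. *)
Lemma spectrum_shift_bound L (a r : R) (z : R[i]) : linear L -> 0 <= r ->
  (forall x, `|L x - a *: x| <= r * `|x|) -> spectrum L z ->
  cmod (z - a%:C) <= r.
Proof.
move=> linL r0 Lr zL; rewrite leNgt; apply/negP => rz; apply: zL.
pose E := complexify (fun x => L x - a *: x).
have EE w : E w = complexify L w - a%:C *: w.
  by rewrite complexification_scale_real.
have linE : linear E.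
  apply: complexify_linear => b x y; rewrite linL scalerDr scalerBr opprD.
  by rewrite addrACA !scalerA mulrC.
have z0 : z - a%:C != 0 by rewrite -cmod_gt0 (le_lt_trans _ rz).
have h : boundedly_invertible (fun w : HC => (z - a%:C) *: w - E w).
  apply: (@boundedly_invertible_perturb _ _ _ _ (cmod (z - a%:C)) `|r|) => //.
  - by move=> b x y; rewrite scalerDr !scalerA mulrC.
  - exact: boundedly_invertible_scale.
  - by move=> w; rewrite cnormZ.
  - exact: complexify_bounded.
  - by rewrite normr_ge0 ger0_norm.
have N1 : (-1 : R[i]) != 0 by rewrite oppr_eq0 oner_eq0.
have := boundedly_invertible_comp (boundedly_invertible_scale N1) h.
congr boundedly_invertible; apply/funext => w /=.
by rewrite EE scaleN1r opprB scalerBl opprB subrKA.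
Qed.

Lemma resolvent_spectrum_disk M (z : R[i]) : normal_maximal_monotone M ->
  spectrum (resolvent M) z -> cmod (z - 2^-1) <= 2^-1.
Proof.
move=> nM zL; have [_ _ [[linL _] _]] := nM.
have -> : 2^-1 = (2^-1)%:C :> R[i] by rewrite fmorphV rmorph_nat.
apply: (spectrum_shift_bound linL _ _ zL) => // x.
exact/firm_half_norm/resolvent_firm.
Qed.

Lemma floor_has_lbound L : has_lbound (floor_distances L).
Proof. by exists 0 => _ [z _ <-]; exact: cmod_ge0. Qed.

Lemma spectral_floor_le L (z : R[i]) : spectrum L z ->
  spectral_floor L <= cmod (1 - z).
Proof. by move=> zL; apply: (ge_inf (floor_has_lbound L)); exists z. Qed.

Lemma spectral_floor_ge L (s : R) : normal_operator L ->
  (exists x : H, x != 0) -> (forall z : R[i], spectrum L z -> s <= cmod (1 - z)) ->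
  s <= spectral_floor L.
Proof.
move=> norL nontriv sL; apply: lb_le_inf => [|_ [z zL <-]]; last exact: sL.
have [z zL] := normal_spectrum_nonempty norL nontriv.
by exists (cmod (1 - z)), z.
Qed.

Lemma floor_has_inf L : normal_operator L -> (exists x : H, x != 0) ->
  has_inf (floor_distances L).
Proof.
move=> norL nontriv; split; last exact: floor_has_lbound.
have [z zL] := normal_spectrum_nonempty norL nontriv.
by exists (cmod (1 - z)), z.
Qed.

(** Turns an estimate relative to each fixed point of the resolvent into one in the distance,
    without choosing a nearest zero. *)
Lemma le_dist_to M y (c k : R) : normal_maximal_monotone M -> 0 <= k ->
  (forall z, resolvent M z = z -> c <= k * `|y - z|) ->
  c <= k * dist_to (zeros M) y.
Proof.
move=> nM k0 h.
have Z0 : resolvent M 0 = 0.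
  by apply/(zerosE _ nM); have [[]] := nM.
have [k00|kn0] := eqVneq k 0.
  by have := h 0 Z0; rewrite k00 !mul0r.
have {kn0 k0} kp : 0 < k by rewrite lt0r kn0.
rewrite mulrC -ler_pdivrMr//; apply: lb_le_inf.
  by exists `|y - 0|, 0 => //; apply/(zerosE _ nM).
by move=> _ [z /(zerosE _ nM) /h hz <-]; rewrite ler_pdivrMr// mulrC.
Qed.

Lemma dist_to_zero M y : normal_maximal_monotone M ->
  (forall z, resolvent M z = z -> z = 0) -> dist_to (zeros M) y = `|y|.
Proof.
move=> nM Z.
suff -> : zeros M = [set 0].
  rewrite /dist_to; have -> : [set `|y - z| | z in [set 0]] = [set `|y| ].
    by rewrite image_set1 subr0.
  by rewrite inf1.
apply/seteqP; split=> [z /(zerosE _ nM)/Z//|_ ->].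
by have [[]] := nM.
Qed.

(** The factor 'X - 1 annihilates the fixed point z, so y may be shifted by z; this is how the
    distance to the zero set enters every upper bound. *)
Lemma residual_opoly M (p : {poly R}) y z : normal_maximal_monotone M ->
  resolvent M z = z ->
  residual (resolvent M) (opoly (resolvent M) p y) =
  opoly (resolvent M) (('X - 1) * p) (y - z).
Proof.
move=> [_ _ [[linL _] _]]; case: (linear_pack linL) => f -> fz.
rewrite /residual opolyBx (opoly_fix _ fz) hornerM !hornerE subrr mul0r.
by rewrite scale0r subr0 opolyM opolyB opolyX opoly1.
Qed.

(** The relation L^-1 - I, multivalued when L has a kernel. *)
Definition relation_of L : H -> set H := fun y => [set u | y = L (y + u)].

Lemma relation_of_resolvent L : resolvent (relation_of L) = L.
Proof.
apply/funext => x; rewrite /resolvent /relation_of /=.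
by apply: xget_unique => [|y] /=; rewrite addrC subrK.
Qed.

(** Maximality is Minty's argument: L is defined everywhere, so a pair (x, u) of a monotone
    extension can be tested against y = L (x + u), which forces x = y. *)
Lemma relation_of_normal L : normal_operator L ->
  (forall x, `|L x| ^+ 2 <= dot (L x) x) ->
  normal_maximal_monotone (relation_of L).
Proof.
move=> norL firm; have [[linL _] _] := norL.
have mono : monotone_relation (relation_of L).
  move=> x u y v /= xE yE; have := firm (x - y + (u - v)).
  have -> : L (x - y + (u - v)) = x - y.
    rewrite addrACA -opprD [in RHS]xE [in RHS]yE.
    by case: (linear_pack linL) => f ->; rewrite linearB.
  by rewrite dotDr dot_norm lerDl.
split; last by rewrite relation_of_resolvent.
- split=> [|a x u y v /= xE yE].
    by case: (linear_pack linL) => f eL; rewrite /relation_of /= eL addr0 linear0.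
  by rewrite /relation_of /= [in LHS]xE [in LHS]yE -linL scalerDr addrACA.
- split=> // N monoN MN x u Nxu; rewrite /relation_of /=.
  set y := L (x + u).
  have My : relation_of L y (x + u - y) by rewrite /relation_of /= addrC subrK.
  have := monoN _ _ _ _ Nxu (MN _ _ My).
  have -> : u - (x + u - y) = - (x - y).
    by rewrite !opprD opprK !addrA [u - x]addrC addrK addrC.
  by rewrite dotNr oppr_ge0 dot_norm => /norm_sqr_eq0/subr0_eq.
Qed.

End Resolvents.

(** * Methods and polynomials *)

Section Methods.
Context {R : realType}.
Local Open Scope complex_scope.

Section Polynomials.
Context {H : hilbertType R}.
Implicit Types (L : H -> H) (p : {poly R}).

Lemma combination_opoly (L : {linear H -> H}) (y0 : H) n (h : seq H)
    (w : nat -> R) :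
  (forall i, (i < size h)%N -> exists p,
    [/\ (size p <= n)%N, p.[1] = 1 & h`_i = opoly L p y0]) ->
  \sum_(i < size h) w i = 1 ->
  exists p, [/\ (size p <= n)%N, p.[1] = 1 & combination w h = opoly L p y0].
Proof.
move=> hp w1.
have /choice[p pP] : forall i : 'I_(size h), exists p,
    [/\ (size p <= n)%N, p.[1] = 1 & h`_i = opoly L p y0].
  by move=> i; exact: hp.
exists (\sum_(i < size h) w i *: p i); split.
- rewrite (leq_trans (size_sum _ _ _))//; apply/bigmax_leqP => i _.
  by rewrite (leq_trans (size_scale_leq _ _))//; case: (pP i).
- rewrite horner_sum -[RHS]w1; apply: eq_bigr => i _.
  by rewrite hornerZ; case: (pP i) => _ -> _; rewrite mulr1.
- rewrite opoly_sum; apply: eq_bigr => i _.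
  by rewrite opolyZ; case: (pP i) => _ _ ->.
Qed.

Lemma size_history (A : method R) L (y0 : H) k :
  size (history A L y0 k) = k.+1.
Proof. by elim: k => //= k IH; rewrite size_rcons IH. Qed.

Lemma history_opoly (A : method R) (L : {linear H -> H}) (y0 : H) k i :
  (i <= k)%N -> exists p,
  [/\ (size p <= k.+1)%N, p.[1] = 1 & (history A L y0 k)`_i = opoly L p y0].
Proof.
elim: k i => [|k IH] i ik.
  move: ik; rewrite leqn0 => /eqP ->; exists 1.
  by rewrite size_poly1 hornerC opoly1.
rewrite /= nth_rcons size_history ltnS; case: leqP => [{}/IH[p [sp p1 ->]]|ki].
  by exists p; split => //; rewrite (leq_trans sp).
have -> : i = k.+1 by apply/anti_leq; rewrite ik ki.
rewrite eqxx.
have [||p [sp p1 ->]] := @combination_opoly L y0 k.+1 (history A L y0 k)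
  (query_coef A (history A L y0 k)).
- by move=> j; rewrite size_history ltnS => /IH.
- by rewrite query_coef_sum1// size_history.
exists ('X * p); split; last by rewrite opolyM opolyX.
  have [->|p0] := eqVneq p 0; first by rewrite mulr0 size_poly0.
  by rewrite mulrC size_mulX.
by rewrite hornerM hornerX mul1r.
Qed.

Lemma iterate_opoly (A : method R) L (y0 : H) K : linear L -> exists p,
  [/\ (size p <= K.+1)%N, p.[1] = 1 & iterate A L y0 K = opoly L p y0].
Proof.
case/linear_pack => f ->; case: K => [|K].
  by exists 1; rewrite size_poly1 hornerC opoly1.
apply: combination_opoly; last by rewrite output_coef_sum1// size_history.
by move=> i; rewrite size_history ltnS; exact: history_opoly.
Qed.

End Polynomials.

Lemma sum_indicator_last n : (0 < n)%N -> \sum_(i < n) ((i : nat) == n.-1)%:R = 1 :> R.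
Proof.
case: n => // n _; rewrite big_ord_recr /= eqxx big1 ?add0r// => i _.
by rewrite ltn_eqF.
Qed.

(** The method always queries the last entry of the history, which therefore lists the powers of L
    on y_0; the output weights are the coefficients of p_K, whose sum is p_K(1) = 1. The index K is
    recovered as the length of the history minus one. *)
Lemma polynomial_method (p : nat -> {poly R}) :
  (forall K, (size (p K) <= K.+1)%N) -> (forall K, (p K).[1] = 1) ->
  exists A : method R, forall (H : hilbertType R) (L : H -> H) (y0 : H) K,
    linear L -> iterate A L y0 K = opoly L (p K) y0.
Proof.
move=> sp p1.
have qc (H : hilbertType R) (h : seq H) : (0 < size h)%N ->
    \sum_(i < size h) ((i : nat) == (size h).-1)%:R = 1 :> R.
  exact: sum_indicator_last.
have oc (H : hilbertType R) (h : seq H) : (0 < size h)%N ->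
    \sum_(i < size h) (p (size h).-1)`_i = 1.
  case: (size h) => // n _; rewrite -(p1 n) (horner_coef_wide _ (sp n)).
  by apply: eq_bigr => i _; rewrite expr1n mulr1.
pose A := @Method R (fun H h i => (i == (size h).-1)%:R)
  (fun H h i => (p (size h).-1)`_i) qc oc.
exists A => H L y0 K /linear_pack[f ->].
have hist k : history A f y0 k = mkseq (fun i => iter i f y0) k.+1.
  elim: k => // k IH; rewrite mkseqS [LHS]/= -/(history A f y0 k) IH.
  congr rcons; rewrite iterS; congr (f _); rewrite /combination size_mkseq.
  rewrite big_ord_recr /= eqxx scale1r.
  rewrite nth_mkseq// big1 ?add0r// => i _.
  by rewrite ltn_eqF ?scale0r.
case: K => [|K].
  have c1 : (p 0)`_0 = 1.
    by have := p1 0; rewrite {1}(size1_polyC (sp 0)) hornerC.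
  by rewrite (size1_polyC (sp 0)) opolyC c1 scale1r.
rewrite /= -/(history A f y0 K.+1) hist /combination size_mkseq.
rewrite (opoly_widen _ _ (sp K.+1)); apply: eq_bigr => i _.
by rewrite nth_mkseq// [output_coef _ _]/= size_map size_iota.
Qed.

(* At [L] this is the ergodic mean of the nonexpansive reflection [2 L - 1]. *)
Definition cesaro_poly (K : nat) : {poly R} :=
  K.+1%:R^-1 *: \sum_(k < K.+1) (2 *: 'X - 1) ^+ k.

Lemma size_reflection : (size (2 *: 'X - 1 : {poly R})%R <= 2)%N.
Proof.
rewrite (leq_trans (size_polyD _ _))// geq_max size_polyN size_poly1 andbT.
by rewrite (leq_trans (size_scale_leq _ _))// size_polyX.
Qed.

Lemma size_cesaro_poly K : (size (cesaro_poly K) <= K.+1)%N.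
Proof.
rewrite (leq_trans (size_scale_leq _ _))// (leq_trans (size_sum _ _ _))//.
apply/bigmax_leqP => k _; rewrite (leq_trans (size_poly_exp_leq _ _))//.
have s1 : ((size (2 *: 'X - 1 : {poly R})%R).-1 <= 1)%N.
  by have := size_reflection; case: (size _) => [|[|[|]]].
by rewrite ltnS (leq_trans (leq_mul s1 (leqnn k)))// mul1n leq_ord.
Qed.

Lemma cesaro_poly1 K : (cesaro_poly K).[1] = 1.
Proof.
rewrite hornerZ horner_sum (eq_bigr (fun=> 1)) => [|k _].
  by rewrite sumr_const card_ord mulVf.
rewrite horner_exp !hornerE; have -> : 2 - 1 = 1 :> R by lra.
by rewrite expr1n.
Qed.

(** Since 2X - 1 - 1 = 2 (X - 1), multiplying the mean by X - 1 telescopes to ((2X - 1)^(K+1) - 1) /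
    (2 (K + 1)); the numerator costs a factor 2 because 2 L - 1 is nonexpansive. *)
Lemma cesaro_residual (H : hilbertType R) (M : H -> set H) (y z : H) K :
  normal_maximal_monotone M -> resolvent M z = z ->
  `|residual (resolvent M) (opoly (resolvent M) (cesaro_poly K) y)| <=
  K.+1%:R^-1 * `|y - z|.
Proof.
move=> nM Lz; rewrite (residual_opoly _ _ nM Lz).
have [_ _ [[linL _] _]] := nM.
have firm x := firm_half_norm (resolvent_firm x nM).
case: (linear_pack linL) firm => f -> firm.
have -> : ('X - 1) * cesaro_poly K =
    (2 * K.+1%:R)^-1 *: ((2 *: 'X - 1) ^+ K.+1 - 1).
  have E : 2 *: 'X - 1 - 1 = 2 *: ('X - 1) :> {poly R}.
    by rewrite scalerBr -addrA -opprD [2 *: 1]scaler_nat mulr2n.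
  rewrite subrX1 /cesaro_poly E -scalerAl scalerA -scalerAr.
  by rewrite invfM mulrAC mulVf ?mul1r// pnatr_eq0.
rewrite opolyZ normrZ opolyB opoly1.
have T1 n x : `|opoly f ((2 *: 'X - 1) ^+ n) x| <= `|x|.
  elim: n => [|n IH]; first by rewrite expr0 opoly1.
  rewrite exprS opolyM (le_trans _ IH)// opolyB opolyZ opolyX opoly1.
  set w := opoly _ _ _; have := firm w.
  have -> : 2 *: f w - w = 2 *: (f w - 2^-1 *: w).
    by rewrite scalerBr scalerA mulfV// scale1r.
  by rewrite normrZ gtr0_norm// => h; lra.
rewrite gtr0_norm ?invr_gt0// invfM mulrAC mulrC ler_wpM2l ?invr_ge0//.
have := le_trans (ler_normB _ _) (lerD (T1 K.+1 (y - z)) (lexx `|y - z|)).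
by lra.
Qed.

End Methods.

(** * Block multiplication operators *)

Section BlockMultiplication.
Context {R : realType} {n : nat}.
Local Notation B := (blocks R n).
Implicit Types (c : 'I_n -> R[i]) (x y : B).
Local Open Scope complex_scope.

Definition blockmul c (x : B) : B := [ffun j => (c j * (x j : R[i]) : Rcomplex R)].

Lemma blockmulE c x j : blockmul c x j = c j * x j :> R[i].
Proof. by rewrite ffunE. Qed.

Lemma block_scaleE (a : R) x j : (a *: x) j = a%:C * x j :> R[i].
Proof.
by rewrite ffunE; case: (x j) => u v; congr Complex; rewrite mul0r ?subr0 ?addr0.
Qed.

Lemma block_addE x y j : (x + y) j = (x j : R[i]) + y j :> R[i].
Proof. by rewrite ffunE. Qed.

Lemma block_oppE x j : (- x) j = - (x j : R[i]) :> R[i].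
Proof. by rewrite ffunE. Qed.

Lemma block_subE x y j : (x - y) j = (x j : R[i]) - y j :> R[i].
Proof. by rewrite block_addE block_oppE. Qed.

Lemma block_ext x y : (forall j, x j = y j :> R[i]) -> x = y.
Proof. by move=> h; apply/ffunP. Qed.

Lemma blockmul_linear c : linear (blockmul c).
Proof.
move=> a x y; apply: block_ext => j.
by rewrite block_addE block_scaleE !blockmulE block_addE block_scaleE; ring.
Qed.

Lemma block_norm_sqr x : `|x| ^+ 2 = \sum_j cmod (x j) ^+ 2.
Proof. by rewrite [LHS]sqr_sqrtr// sumr_ge0// => j _; exact: sqr_ge0. Qed.

Lemma blockmul_norm_sqr c x :
  `|blockmul c x| ^+ 2 = \sum_j cmod (c j) ^+ 2 * cmod (x j) ^+ 2.
Proof.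
by rewrite block_norm_sqr; apply: eq_bigr => j _; rewrite blockmulE cmodM exprMn.
Qed.

Lemma blockmul_adjoint c x y :
  dot (blockmul c x) y = dot x (blockmul (conjc \o c) y).
Proof.
apply: eq_bigr => j _; rewrite !blockmulE /=.
by case: (c j) (x j) (y j) => [a b] [x1 x2] [y1 y2] /=; ring.
Qed.

Lemma blockmul_comp c d x : blockmul c (blockmul d x) = blockmul (fun j => c j * d j) x.
Proof. by apply: block_ext => j; rewrite !blockmulE mulrA. Qed.

Lemma blockmul_norm_le c x (r : R) : 0 <= r -> (forall j, cmod (c j) <= r) ->
  `|blockmul c x| <= r * `|x|.
Proof.
move=> r0 cr; rewrite -(@ler_pXn2r _ 2)// ?nnegrE ?mulr_ge0// exprMn.
rewrite blockmul_norm_sqr block_norm_sqr mulr_sumr; apply: ler_sum => j _.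
by rewrite ler_wpM2r ?sqr_ge0// ler_pXn2r ?nnegrE ?cmod_ge0.
Qed.

Lemma blockmul_norm_ge c x (r : R) : 0 <= r -> (forall j, r <= cmod (c j)) ->
  r * `|x| <= `|blockmul c x|.
Proof.
move=> r0 cr; rewrite -(@ler_pXn2r _ 2)// ?nnegrE ?mulr_ge0// exprMn.
rewrite blockmul_norm_sqr block_norm_sqr mulr_sumr; apply: ler_sum => j _.
by rewrite ler_wpM2r ?sqr_ge0// ler_pXn2r ?nnegrE ?cmod_ge0.
Qed.

Lemma blockmul_normal c : normal_operator (blockmul c).
Proof.
split.
  split; first exact: blockmul_linear.
  exists (\sum_j cmod (c j)) => x; apply: blockmul_norm_le => [|j].
    by apply: sumr_ge0 => j _; exact: cmod_ge0.
  by rewrite (bigD1 j)//= lerDl sumr_ge0// => i _; exact: cmod_ge0.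
exists (blockmul (conjc \o c)); split; first exact: blockmul_adjoint.
by move=> x; apply: block_ext => j; rewrite !blockmulE mulrCA.
Qed.

Lemma blockmul_firm c x : (forall j, cmod (c j) ^+ 2 <= Re (c j)) ->
  `|blockmul c x| ^+ 2 <= dot (blockmul c x) x.
Proof.
move=> cRe; rewrite blockmul_norm_sqr; apply: ler_sum => j _.
have -> : Re (blockmul c x j) * Re (x j) + Im (blockmul c x j) * Im (x j) =
    Re (c j) * cmod (x j) ^+ 2.
  rewrite blockmulE cmod_sqr.
  by case: (c j) (x j) => [a b] [x1 x2] /=; ring.
by rewrite ler_wpM2r ?sqr_ge0.
Qed.

Lemma blockmul_opoly c (p : {poly R}) x :
  opoly (blockmul c) p x =
  blockmul (fun j => (map_poly (real_complex R) p).[c j]) x.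
Proof.
have [T eT] := linear_pack (blockmul_linear c).
rewrite eT; elim/poly_ind: p x => [|p a IH] x.
  rewrite opoly0p; apply: block_ext => j.
  by rewrite blockmulE rmorph0 horner0 mul0r ffunE.
rewrite opolyD opolyC opolyMX IH -eT; apply: block_ext => j.
rewrite block_addE block_scaleE !blockmulE rmorphD rmorphM /= map_polyX.
by rewrite map_polyC /= hornerD hornerM hornerX hornerC; ring.
Qed.

(** The imaginary unit i of a block and the imaginary unit I of the complexification differ. On e -
    I (i e) they act alike, so this vector, the pair [(e, ie)], is an eigenvector for [c j]. *)
Lemma blockmul_spectrum c j : spectrum (blockmul c) (c j).
Proof.
move=> /boundedly_invertible_below[k k0].
pose e : B := [ffun i => (i == j)%:R : Rcomplex R].
pose ie : B := [ffun i => - 'i * (i == j)%:R : Rcomplex R].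
move=> /(_ (e, ie)) ; set v := complexify _ _ - _.
have -> : v = 0.
  have E1 : v.1 = 0.
    apply: block_ext => i; rewrite [v.1]/(blockmul c e - (Re (c j) *: e - Im (c j) *: ie)).
    rewrite !block_subE !block_scaleE blockmulE !ffunE.
    have [->|_] := eqVneq i j; last by rewrite !mulr0 !subrr.
    by rewrite !mulr1; case: (c j) => a b; congr Complex => /=; ring.
  have E2 : v.2 = 0.
    apply: block_ext => i; rewrite [v.2]/(blockmul c ie - (Re (c j) *: ie + Im (c j) *: e)).
    rewrite block_subE block_addE !block_scaleE blockmulE !ffunE.
    have [->|_] := eqVneq i j; last by rewrite !mulr0 addr0 subrr.
    by rewrite !mulr1; case: (c j) => a b; congr Complex => /=; ring.
  by case: v E1 E2 => a b /= -> ->.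
rewrite cnorm0 pmulr_rle0// leNgt cnorm_gt0//.
apply/negP => /eqP[/ffunP/(_ j)]; rewrite !ffunE eqxx => /eqP.
by rewrite oner_eq0.
Qed.

End BlockMultiplication.

(** The hypotheses make 1 - L invertible with lower bound r, and subtracting a scalar 1 - z of
    modulus less than r keeps it invertible. *)
Lemma spectrum_away_from_one (R : realType) (H : hilbertType R) (L : H -> H)
    (r : R) (z : R[i]) : linear L -> 0 < r ->
  (forall x, r * `|x| <= `|x - L x|) -> (forall y, exists x, x - L x = y) ->
  spectrum L z -> r <= cmod (1 - z).
Proof.
move=> linL r0 Lr Lonto zL; rewrite leNgt; apply/negP => zr; apply: zL.
pose D x := x - L x.
have linD : linear D.
  move=> a x y; rewrite /D; case: (linear_pack linL) => f ->.
  by rewrite linearP scalerBr opprD addrACA.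
have DE (u : complexification H) : complexify D u = u - complexify L u by [].
have below (u : complexification H) : r * cnorm u <= cnorm (complexify D u).
  rewrite -(@ler_pXn2r _ 2)// ?nnegrE ?mulr_ge0 ?cnorm_ge0 ?(ltW r0)//.
  rewrite exprMn !cnorm_sqr mulrDr -!exprMn /= lerD//.
    by rewrite ler_pXn2r ?nnegrE ?mulr_ge0 ?(ltW r0)//; exact: Lr.
  by rewrite ler_pXn2r ?nnegrE ?mulr_ge0 ?(ltW r0)//; exact: Lr.
have h : boundedly_invertible (fun u : complexification H => complexify D u - (1 - z) *: u).
  apply: (@boundedly_invertible_perturb _ _ _ _ r (cmod (1 - z))) => //.
  - exact: complexify_linear.
  - by move=> b x y; rewrite scalerDr !scalerA mulrC.
  - apply: (boundedly_invertible_intro _ r0 below); first exact: complexify_linear.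
    move=> [y1 y2]; have [x1 e1] := Lonto y1; have [x2 e2] := Lonto y2.
    by exists (x1, x2); rewrite /complexify /D /= e1 e2.
  - by move=> u; rewrite cnormZ.
  - by rewrite cmod_ge0.
have N1 : (-1 : R[i]) != 0 by rewrite oppr_eq0 oner_eq0.
have := boundedly_invertible_comp (boundedly_invertible_scale N1) h.
congr boundedly_invertible; apply/funext => w /=.
rewrite DE scaleN1r opprB scalerBl scale1r opprB.
by rewrite addrC subrKA.
Qed.

(** * The extremal instance *)

Section ExtremalInstance.
Context {R : realType} (K : nat).
Local Notation n := K.+1.
Local Notation B := (blocks R n).
Implicit Types (j : 'I_n) (x y u : B) (a : R).
Local Open Scope complex_scope.

Definition halfphi j : R := phi R j / 2.

Lemma halfphiE j : halfphi j = (2 * j + 1)%:R * (pi / (2 * n%:R)).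
Proof.
have n0 : n%:R != 0 :> R by rewrite pnatr_eq0.
rewrite /halfphi /phi; move: (pi : R) ((2 * j + 1)%:R : R) (n%:R : R) n0.
by move=> p m N N0; field.
Qed.

Definition pi2n : R := pi / (2 * n%:R).

Lemma pi2n_gt0 : 0 < pi2n.
Proof. by rewrite divr_gt0 ?pi_gt0// mulr_gt0. Qed.

Lemma pi_pi2n : pi = (2 * n)%:R * pi2n.
Proof. by rewrite /pi2n natrM mulrC divfK// mulf_neq0. Qed.

Lemma halfphi_bounds j : pi2n <= halfphi j <= pi - pi2n.
Proof.
rewrite halfphiE -/pi2n; apply/andP; split.
  by rewrite ler_peMl ?(ltW pi2n_gt0)// ler1n addn1.
have -> : pi - pi2n = (2 * n - 1)%:R * pi2n.
  by rewrite natrB// mulrBl mul1r -pi_pi2n.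
rewrite ler_pM2r ?pi2n_gt0// ler_nat.
by rewrite leq_subRL// addnC -addnA -mulnSr leq_mul2l ltn_ord.
Qed.

Lemma halfphi_itv j : 0 < halfphi j < pi.
Proof.
have /andP[h1 h2] := halfphi_bounds j; have := pi2n_gt0.
by move=> h0; apply/andP; split; lra.
Qed.

Lemma sin_halfphi_gt0 j : 0 < sin (halfphi j).
Proof. exact: sin_gt0_pi (halfphi_itv j). Qed.

(** sin b - sin a = 2 cos((a + b) / 2) sin((b - a) / 2), with both factors nonnegative. *)
Lemma sin_monotone_arch (a b : R) : 0 <= a -> a <= b -> b <= pi - a ->
  sin a <= sin b.
Proof.
move=> a0 ab bpa; set s := (a + b) / 2; set d := (b - a) / 2.
have -> : a = s - d by rewrite /s /d; lra.
have -> : b = s + d by rewrite /s /d; lra.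
rewrite sinB sinD -subr_ge0.
have -> : sin s * cos d + cos s * sin d - (sin s * cos d - cos s * sin d) =
  (cos s * sin d) *+ 2 by rewrite mulr2n; lra.
have c0 : 0 <= cos s by apply: cos_ge0_pihalf; rewrite /s; lra.
have s0 : 0 <= sin d by apply: sin_ge0_pi; rewrite /d; lra.
by rewrite mulrn_wge0// mulr_ge0.
Qed.

Lemma sin_halfphi_ge j : sin pi2n <= sin (halfphi j).
Proof.
have /andP[h1 h2] := halfphi_bounds j.
exact: sin_monotone_arch (ltW pi2n_gt0) h1 h2.
Qed.

Lemma halfphi0 : halfphi ord0 = pi2n.
Proof. by rewrite halfphiE mul1r. Qed.

Lemma phi_pi j : (phi R j == pi) = (cos (halfphi j) == 0).
Proof.
have -> : phi R j = halfphi j *+ 2 by rewrite /halfphi mulr2n -splitr.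
have /andP[h0 hp] := halfphi_itv j.
apply/eqP/eqP => [e|c0].
  have -> : halfphi j = pi / 2 by rewrite -e mulr2n; lra.
  exact: cos_pihalf.
have -> : halfphi j = pi / 2.
  apply: (@cos_inj R); rewrite ?in_itv /= ?c0 ?cos_pihalf//.
    by rewrite (ltW h0) (ltW hp).
  by have := pi_gt0 R => p0; apply/andP; split; lra.
by rewrite mulr2n; lra.
Qed.

(** (1 + omega_j) / 2 in half-angle form, cos h exp(i h) with h = phi_j / 2; it vanishes exactly on
    a block with phi_j = pi. *)
Definition zeta j : R[i] :=
  Complex (cos (halfphi j) ^+ 2) (cos (halfphi j) * sin (halfphi j)).

Lemma zetaE j : zeta j = (2^-1)%:C * (1 + uroot (pi / n%:R) j).
Proof.
have -> : uroot (pi / n%:R) j = expi (halfphi j *+ 2).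
  rewrite /uroot; congr expi; rewrite halfphiE.
  have n0 : n%:R != 0 :> R by rewrite pnatr_eq0.
  rewrite mulr2n natrD; move: (pi : R) ((2 * j)%:R : R) (n%:R : R) n0.
  by move=> p m N N0; field.
rewrite /zeta; move: (halfphi j) => h; apply/eqP; rewrite eq_complex /=.
rewrite cos_mulr2n sin_mulr2n; move: (cos h) (sin h) => c s.
by apply/andP; split; apply/eqP; lra.
Qed.

Lemma cmod_zeta j : cmod (zeta j) ^+ 2 = Re (zeta j).
Proof.
rewrite cmod_sqrE /=; have := cos2Dsin2 (halfphi j).
move: (cos _) (sin _) => c s cs.
have -> : (c * s) ^+ 2 = c ^+ 2 * s ^+ 2 by ring.
have -> : s ^+ 2 = 1 - c ^+ 2 by lra.
by ring.
Qed.

Lemma cmod_1zeta j : cmod (1 - zeta j) = sin (halfphi j).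
Proof.
have s0 := sin_halfphi_gt0 j.
apply: (@pexpIrn _ 2); rewrite ?nnegrE ?cmod_ge0 ?(ltW s0)//.
rewrite cmod_sqrE /=; have := cos2Dsin2 (halfphi j).
move: (cos _) (sin _) => c s cs.
have -> : (0 - c * s) ^+ 2 = c ^+ 2 * s ^+ 2 by ring.
have -> : s ^+ 2 = 1 - c ^+ 2 by lra.
by ring.
Qed.

(* [zeta j] lies on the circle |z|^2 = Re z through 0 and 1. *)
Lemma cmod_1azeta a j : sin (halfphi j) <= cmod (1 - a%:C * zeta j).
Proof.
rewrite -cmod_1zeta ler_cmod -subr_ge0.
have := cmod_zeta j; rewrite !cmod_sqrE; case: (zeta j) => u v /= h.
have -> : (1 - (a * u - 0 * v)) ^+ 2 + (0 - (a * v + 0 * u)) ^+ 2 -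
    ((1 - u) ^+ 2 + (0 - v) ^+ 2) =
    1 - 2 * a * u + a ^+ 2 * (u ^+ 2 + v ^+ 2) - (1 - 2 * u + (u ^+ 2 + v ^+ 2)).
  by ring.
rewrite h; have u0 : 0 <= u by rewrite -h addr_ge0// sqr_ge0.
have -> : 1 - 2 * a * u + a ^+ 2 * u - (1 - 2 * u + u) = (1 - a) ^+ 2 * u by ring.
by rewrite mulr_ge0// sqr_ge0.
Qed.

Definition scaled_zeta a j : R[i] := a%:C * zeta j.

Lemma scaled_zeta_firm a j : 0 <= a <= 1 ->
  cmod (scaled_zeta a j) ^+ 2 <= Re (scaled_zeta a j).
Proof.
move=> /andP[a0 a1]; rewrite cmodM exprMn cmod_zeta cmod_real ger0_norm//.
have -> : Re (scaled_zeta a j) = a * Re (zeta j).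
  by rewrite /scaled_zeta; case: (zeta j) => u v /=; ring.
rewrite -cmod_zeta ler_wpM2r ?sqr_ge0// expr2.
by rewrite ler_piMl.
Qed.

Lemma zeta1 j : scaled_zeta 1 j = zeta j.
Proof. by rewrite /scaled_zeta mul1r. Qed.

Lemma zeta_unscale j : cos (halfphi j) != 0 ->
  zeta j * (1 - Complex 0 (tan (halfphi j))) = 1.
Proof.
rewrite /zeta /tan; have := cos2Dsin2 (halfphi j).
move: (cos _) (sin _) => c s cs c0.
apply/eqP; rewrite eq_complex /=; apply/andP; split; apply/eqP.
  rewrite -[RHS]cs; field; exact: c0.
by field.
Qed.

Lemma extremal_relation :
  @extremal_operator R K = relation_of (blockmul zeta).
Proof.
have Ntan j (z : R[i]) : Complex 0 (- tan (halfphi j)) * z =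
    (1 - Complex 0 (tan (halfphi j))) * z - z.
  have -> : Complex 0 (- tan (halfphi j)) = - Complex 0 (tan (halfphi j)).
    by congr Complex; rewrite oppr0.
  by rewrite mulNr mulrBl mul1r addrAC subrr add0r.
have z0 j : cos (halfphi j) = 0 -> zeta j = 0.
  by move=> c0; rewrite /zeta c0 expr0n mul0r.
apply/funext => x; apply/seteqP; split=> u /= h.
  apply: block_ext => j; rewrite blockmulE block_addE.
  have := h j; rewrite phi_pi; case: eqVneq => c0.
    by move=> ->; rewrite z0// mul0r.
  rewrite -/(halfphi j) => ->; rewrite [_ * x j]Ntan addrC subrK mulrA.
  by rewrite zeta_unscale// mul1r.
move=> j; rewrite phi_pi; have xj : x j = zeta j * ((x j : R[i]) + u j) :> R[i].
  by rewrite {1}h blockmulE block_addE.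
case: eqVneq => c0.
  by rewrite xj z0// mul0r.
rewrite -/(halfphi j) [_ * x j]Ntan [in X in X - _]xj mulrA [_ * zeta j]mulrC.
by rewrite zeta_unscale// mul1r addrAC subrr add0r.
Qed.

Lemma blockmul_zeta_firm a x : 0 <= a <= 1 ->
  `|blockmul (scaled_zeta a) x| ^+ 2 <= dot (blockmul (scaled_zeta a) x) x.
Proof. by move=> a01; apply: blockmul_firm => j; exact: scaled_zeta_firm. Qed.

Lemma scaled_relation_normal a : 0 <= a <= 1 ->
  normal_maximal_monotone (relation_of (blockmul (scaled_zeta a))).
Proof.
move=> a01; apply: relation_of_normal; first exact: blockmul_normal.
by move=> x; exact: blockmul_zeta_firm.
Qed.

Lemma zetaS : zeta = scaled_zeta 1.
Proof. by apply/funext => j; rewrite zeta1. Qed.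

(** The eigenvalues c of the resolvent satisfy the circle equation c + conj c = 2 c conj c, which is
    what exchanges the blockwise graph y = conj c (y + w) of the adjoint with the graph y = c (y -
    w) of -M. *)
Lemma extremal_skew_adjoint : skew_adjoint (@extremal_operator R K).
Proof.
have key (c w z : R[i]) : c + conjc c = 2 * (c * conjc c) ->
    w = conjc c * (w + z) -> w = c * (w - z).
  move=> h e.
  have e1 : 2 * (c * w) = (c + conjc c) * (w + z).
    by rewrite h {1}e; ring.
  have e2 : conjc c * (w + z) = w by rewrite -e.
  have -> : c * (w - z) = 2 * (c * w) - c * (w + z) by ring.
  by rewrite e1 mulrDl e2; ring.
have zc j : zeta j + conjc (zeta j) = 2 * (zeta j * conjc (zeta j)).
  rewrite -cmod_sqrC cmod_zeta; case: (zeta j) => u v; apply/eqP.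
  by rewrite eq_complex /=; apply/andP; split; apply/eqP; ring.
rewrite extremal_relation => y w; rewrite /adjoint_relation /relation_of /=.
(* The adjoint of L^-1 - I is the same construction for the adjoint of L. Pairs of the graph have
   the form (L d, d - L d), and the defect d itself is the test vector. *)
have -> : (forall x u, x = blockmul zeta (x + u) -> dot u y = dot x w) <->
    y = blockmul (conjc \o zeta) (y + w).
  split=> [h|yE x u xE].
    apply/subr0_eq/norm_sqr_eq0; set d := y - _; rewrite -dot_norm.
    have := h (blockmul zeta d) (d - blockmul zeta d).
    rewrite addrC subrK => /(_ erefl); rewrite dotBl => e.
    suff : dot d y - dot (blockmul zeta d) y - dot (blockmul zeta d) w = 0.
      by rewrite -addrA -opprD -dotDr blockmul_adjoint -dotBr => ->.
    by rewrite e subrr.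
  have : dot (x + u) y = dot x (y + w).
    by rewrite [in RHS]xE blockmul_adjoint -yE.
  by rewrite dotDl dotDr => /addrI.
split=> e; apply: block_ext => j; rewrite blockmulE ?block_subE ?block_addE.
  apply: key (zc j) _.
  by have := congr1 (fun f : B => f j : R[i]) e; rewrite blockmulE block_addE.
rewrite -[w j : R[i]]opprK; apply: key; last first.
  rewrite [conjc _]conjcK.
  by have := congr1 (fun f : B => f j : R[i]) e; rewrite blockmulE block_subE.
by rewrite [conjc _]conjcK addrC zc [_ * zeta j]mulrC.
Qed.

Lemma scaled_zeta_fix a x : blockmul (scaled_zeta a) x = x -> x = 0.
Proof.
move=> h; apply/norm_sqr_eq0; rewrite block_norm_sqr big1// => j _.
have s0 := lt_le_trans (sin_halfphi_gt0 j) (cmod_1azeta a j).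
have : (1 - scaled_zeta a j) * x j = 0 :> R[i].
  by rewrite mulrBl mul1r -blockmulE h subrr.
move/eqP; rewrite mulf_eq0 -[_ == 0 :> R[i]]cmod_eq0 gt_eqF//= => /eqP ->.
by rewrite cmod0 expr0n.
Qed.

Lemma uroot_expi j : uroot (pi / n%:R) j = 2 * zeta j - 1.
Proof.
rewrite zetaE mulrA -[2 * _](_ : 1 = _) ?mul1r ?[1 + _]addrC ?addrK//.
by rewrite fmorphV rmorph_nat mulfV// pnatr_eq0.
Qed.

Lemma uroot_pow j : (uroot (pi / n%:R) j) ^+ n = -1 :> R[i].
Proof.
rewrite /uroot -expiMn.
have -> : (pi / n%:R + pi * (2 * j)%:R / n%:R) *+ n = pi *+ (2 * j).+1 :> R.
  have n0 : n%:R != 0 :> R by rewrite pnatr_eq0.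
  rewrite -[LHS]mulr_natr -[RHS]mulr_natr -[(2 * j).+1]addn1 natrD.
  move: (pi : R) ((2 * j)%:R : R) (n%:R : R) n0.
  by move=> p m N N0; field.
rewrite expiMn /expi cospi sinpi.
have -> : Complex (-1 : R) 0 = -1 by congr Complex; rewrite oppr0.
by rewrite exprS exprM sqrrN !expr1n mulr1.
Qed.

(** The geometric sum equals (omega^n - 1) / (omega - 1) with omega^n = -1, of modulus 2 / |omega -
    1|. Written as squared values of a polynomial, the weights can be summed by Parseval. *)
Lemma extremal_weight_root j : extremal_weight R j =
  cmod (\sum_(k < n) (n%:R^-1)%:C * uroot (pi / n%:R) j ^+ k) ^+ 2.
Proof.
have s0 := sin_halfphi_gt0 j.
have n0 : 0 < n%:R :> R by rewrite ltr0n.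
rewrite -mulr_sumr cmodM cmod_real gtr0_norm ?invr_gt0//.
set S := \sum_(k < n) _.
have : cmod (uroot (pi / n%:R) j - 1) * cmod S = 2.
  rewrite -cmodM -subrX1 uroot_pow -opprD cmodN.
  by rewrite (_ : 1 + 1 = 2%:R :> R[i])// cmod_nat.
have -> : cmod (uroot (pi / n%:R) j - 1) = 2 * sin (halfphi j).
  rewrite uroot_expi -addrA -opprD (_ : 1 + 1 = 2 :> R[i])// -{2}[2]mulr1.
  by rewrite -mulrBr cmodM cmod_nat cmodC cmod_1zeta.
rewrite /extremal_weight -/(halfphi j).
move: (sin _) (cmod S) s0 => s c s0 h.
have -> : c = s^-1 by apply: (mulfI (lt0r_neq0 s0)); rewrite divff ?gt_eqF//; lra.
by rewrite invfM exprMn !exprVn.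
Qed.

Lemma extremal_weight_ge0 j : 0 <= extremal_weight R j.
Proof. by rewrite extremal_weight_root sqr_ge0. Qed.

Lemma extremal_start_norm (y0 : B) : extremal_start y0 -> `|y0| = 1.
Proof.
move=> y0E; apply: (@pexpIrn _ 2); rewrite ?nnegrE// expr1n block_norm_sqr.
under eq_bigr do rewrite y0E sqr_sqrtr ?extremal_weight_ge0//
  extremal_weight_root.
rewrite uroot_parseval sumr_const card_ord -(mulr_natl (_ ^+ 2)) mulrA -expr2.
by rewrite -exprMn mulfV ?expr1n// pnatr_eq0.
Qed.

Lemma scaled_residual_lower (A : method R) (y0 : B) a : extremal_start y0 ->
  0 < a <= 1 ->
  (n%:R * (2 / a - 1) ^+ K)^-1 <=
  `|residual (blockmul (scaled_zeta a))
             (iterate A (blockmul (scaled_zeta a)) y0 K)|.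
Proof.
move=> y0E /andP[a0 a1].
have [p [sp p1 ->]] := iterate_opoly A y0 K (blockmul_linear (scaled_zeta a)).
have n0 : 0 < n%:R :> R by rewrite ltr0n.
(* The preimage of 1 under w -> a (1 + w) / 2; the normalization p(1) = 1 becomes P(t) = 1, with t
   >= 1. *)
set t := 2 / a - 1.
have t1 : 1 <= t by rewrite /t lerBrDr ler_pdivlMr//; lra.
have tK0 : 0 < t ^+ K by rewrite exprn_gt0// (lt_le_trans _ t1).
pose P := p \Po ((a / 2) *: ('X + 1)).
have sP : (size P <= n)%N.
  rewrite (leq_trans (size_comp_poly_leq _ _))//.
  have -> : size ((a / 2) *: ('X + 1) : {poly R})%R = 2%N.
    rewrite size_scale ?mulf_neq0 ?invr_eq0 ?gt_eqF//.
    by rewrite -[1]opprK -[- 1]polyCN size_XsubC.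
  by rewrite muln1 ltnS; case: (size p) sp.
have PE j : (map_poly (real_complex R) P).[uroot (pi / n%:R) j] =
    (map_poly (real_complex R) p).[scaled_zeta a j].
  rewrite map_comp_poly horner_comp; congr (_.[_]).
  rewrite map_polyZ rmorphD /= map_polyX rmorph1 hornerZ !hornerE.
  by rewrite /scaled_zeta zetaE mulrA -rmorphM addrC.
set Q := \sum_(k < n) P`_k ^+ 2.
have QE : \sum_(j < n) cmod (map_poly (real_complex R) P).[uroot (pi / n%:R) j] ^+ 2
    = n%:R * Q.
  rewrite -(uroot_parseval (pi / n%:R)); apply: eq_bigr => j _; congr (cmod _ ^+ 2).
  rewrite (@horner_coef_wide _ n) ?size_map_poly//.
  by apply: eq_bigr => k _; rewrite coef_map.
(* Cauchy-Schwarz on P(t) = 1, where every power of t is bounded by t^K. *)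
have Q1 : 1 <= n%:R * (t ^+ K) ^+ 2 * Q.
  have Pt : P.[t] = 1.
    rewrite horner_comp (_ : (_ *: _).[t] = 1)//.
    by rewrite !hornerE /t; field; rewrite gt_eqF.
  have := sum_sqr_le (fun k : 'I_n => P`_k * t ^+ k).
  rewrite -horner_coef_wide// Pt expr1n => /le_trans; apply.
  rewrite -mulrA ler_pM2l// mulr_sumr; apply: ler_sum => k _.
  rewrite exprMn mulrC ler_wpM2r ?sqr_ge0// ler_pXn2r ?nnegrE ?exprn_ge0//;
    rewrite ?(le_trans ler01)//.
  by rewrite ler_weXn2l// -ltnS ltn_ord.
rewrite -(@ler_pXn2r _ 2)// ?nnegrE ?invr_ge0 ?mulr_ge0 ?(ltW tK0) ?(ltW n0)//.
have -> : `|residual (blockmul (scaled_zeta a))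
    (opoly (blockmul (scaled_zeta a)) p y0)| ^+ 2 =
    \sum_j cmod (1 - scaled_zeta a j) ^+ 2 * extremal_weight R j *
      cmod (map_poly (real_complex R) P).[uroot (pi / n%:R) j] ^+ 2.
  rewrite block_norm_sqr; apply: eq_bigr => j _.
  rewrite block_subE blockmulE blockmul_opoly blockmulE -PE -{2}[_ * y0 j]mul1r.
  rewrite -mulrBl !cmodM !exprMn y0E (sqr_sqrtr (extremal_weight_ge0 j)).
  rewrite [LHS]mulrA [LHS]mulrAC; congr (_ ^+ 2 * _ * _); exact: cmodC.
(* The factor |1 - a zeta_j| is at least sin(phi_j / 2), so its square times the weight is at least
   n^-2 on each block. *)
apply: (@le_trans _ _ (n%:R ^- 2 * (n%:R * Q))); last first.
  rewrite -QE mulr_sumr; apply: ler_sum => j _; rewrite ler_wpM2r ?sqr_ge0//.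
  have s0 := sin_halfphi_gt0 j; rewrite /extremal_weight -/(halfphi j).
  rewrite [(_ * sin _ ^+ 2)^-1]invfM mulrCA ler_peMr ?invr_ge0 ?sqr_ge0//.
  rewrite -exprVn -exprMn.
  rewrite -[leLHS](expr1n _ 2) ler_pXn2r ?nnegrE ?mulr_ge0 ?cmod_ge0 ?invr_ge0
    ?(ltW s0)//.
  by rewrite ler_pdivlMr// mul1r cmod_1azeta.
rewrite exprVn exprMn invfM ler_pM2l ?invr_gt0 ?exprn_gt0//.
rewrite -[leLHS]mul1r ler_pdivrMr; first by rewrite mulrAC.
by rewrite exprn_gt0.
Qed.

Lemma blocks_nontrivial : exists x : B, x != 0.
Proof.
exists [ffun=> 1 : Rcomplex R]; apply/negP => /eqP/ffunP/(_ ord0).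
by rewrite !ffunE => /eqP; rewrite oner_eq0.
Qed.

Lemma extremal_floor : spectral_floor (blockmul zeta) = sin pi2n.
Proof.
apply/le_anti/andP; split.
  rewrite -halfphi0 -cmod_1zeta; apply: spectral_floor_le.
  exact: blockmul_spectrum.
have s0 : 0 < sin pi2n by rewrite -halfphi0 sin_halfphi_gt0.
apply: spectral_floor_ge => [||z]; first exact: blockmul_normal.
  exact: blocks_nontrivial.
have subE x : x - blockmul zeta x = blockmul (fun j => 1 - zeta j) x.
  by apply: block_ext => j; rewrite block_subE !blockmulE mulrBl mul1r.
apply: spectrum_away_from_one => // [|x|y]; first exact: blockmul_linear.
  rewrite subE blockmul_norm_ge ?(ltW s0)// => j.
  by rewrite cmod_1zeta sin_halfphi_ge.
exists (blockmul (fun j => (1 - zeta j)^-1) y); rewrite subE blockmul_comp.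
apply: block_ext => j; rewrite blockmulE mulfV ?mul1r//.
by rewrite -cmod_gt0 cmod_1zeta sin_halfphi_gt0.
Qed.

(** As |zeta_j| <= 1, the spectrum lies in the disk of radius a about 0, whose distance to 1 is 1 -
    a. *)
Lemma scaled_floor a : 0 <= a -> a <= 1 ->
  1 - a <= spectral_floor (blockmul (scaled_zeta a)).
Proof.
move=> a0 a1; apply: spectral_floor_ge => [||z zL].
- exact: blockmul_normal.
- exact: blocks_nontrivial.
have : cmod (z - 0%:C) <= a.
  apply: (spectrum_shift_bound (blockmul_linear _) a0 _ zL) => x.
  rewrite scale0r subr0; apply: blockmul_norm_le => // j.
  rewrite cmodM cmod_real ger0_norm// ler_piMr//.
  rewrite -(@ler_pXn2r _ 2)// ?nnegrE ?cmod_ge0// expr1n cmod_zeta.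
  by rewrite /= -[leRHS](cos2Dsin2 (halfphi j)) lerDl sqr_ge0.
rewrite subr0 => h; have := cmodD (1 - z) z; rewrite subrK cmod1.
by lra.
Qed.

End ExtremalInstance.

(** * The Chebyshev number *)

Section ChebyshevNumber.
Context {R : realType}.
Implicit Types (q : {poly R[i]}) (z w : R[i]) (s : R) (m : nat).
Local Open Scope complex_scope.

Definition punctured_disk s : set R[i] :=
  [set z | s <= cmod (z - 1) /\ cmod z <= 1].

Definition disk_sup s q : R :=
  sup [set cmod q.[z] | z in punctured_disk s].

Lemma disk_sup_ub s q z : punctured_disk s z -> cmod q.[z] <= disk_sup s q.
Proof.
move=> zD; apply: ub_le_sup; last by exists z.
exists (\sum_(i < size q) cmod q`_i) => _ [w [_ w1] <-].
rewrite horner_coef (le_trans (cmod_sum _))//; apply: ler_sum => i _.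
by rewrite cmodM cmodX ler_piMr ?cmod_ge0// exprn_ile1// cmod_ge0.
Qed.

Lemma disk_sup_ge0 s q : 0 <= disk_sup s q.
Proof.
have [[z zD]|D0] := pselect (punctured_disk s !=set0).
  exact: le_trans (cmod_ge0 _) (disk_sup_ub q zD).
(* The set is empty for s > 2, where [sup] takes its default value 0. *)
rewrite /disk_sup (_ : [set _ | _ in _] = set0) ?sup0//.
by apply/seteqP; split=> // x [z zD _]; apply: D0; exists z.
Qed.

Lemma le_chebyshev m s (c r : R) : 0 <= r ->
  (forall q, q.[1] = 1 -> (size q <= m.+1)%N -> c <= disk_sup s q * r) ->
  c <= chebyshev_number m s * r.
Proof.
move=> r0 h; have h1 : (1 : {poly R[i]}).[1] = 1 by rewrite hornerC.
have s1 : (size (1%R : {poly R[i]}) <= m.+1)%N by rewrite size_poly1.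
have [e|rn0] := eqVneq r 0.
  by have := h _ h1 s1; rewrite e !mulr0.
have {r0 rn0} r0 : 0 < r by rewrite lt0r rn0.
rewrite -ler_pdivrMr//; apply: lb_le_inf; first by exists (disk_sup s 1%R), 1%R.
by move=> _ [q [q1 sq] <-]; rewrite ler_pdivrMr//; exact: h.
Qed.

(** The competitor (1 + z) / 2 suffices: by the parallelogram law |1 + z|^2 + |1 - z|^2 <= 4, so its
    squared modulus is at most 1 - s^2 / 4. *)
Lemma chebyshev_lt1 m s : 0 < s -> (0 < m)%N -> chebyshev_number m s < 1.
Proof.
move=> s0 m0; pose q : {poly R[i]} := (2^-1) *: ('X + 1).
have sq : (size q <= m.+1)%N.
  rewrite (leq_trans (size_scale_leq _ _))//.
  by rewrite -[1]opprK -[- 1]polyCN size_XsubC.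
have q1 : q.[1] = 1.
  by rewrite hornerZ !hornerE mulVf// (_ : 1 + 1 = 2%:R)// pnatr_eq0.
have lb : has_lbound [set disk_sup s q | q in
    [set q : {poly R[i]} | q.[1] = 1 /\ (size q <= m.+1)%N]].
  by exists 0 => _ [p _ <-]; exact: disk_sup_ge0.
apply: (@le_lt_trans _ _ (disk_sup s q)).
  by apply: ge_inf => //; exists q.
have [[z0 z0D]|D0] := pselect (punctured_disk s !=set0); last first.
  rewrite /disk_sup (_ : [set _ | _ in _] = set0) ?sup0//.
  by apply/seteqP; split=> // x [z zD _]; apply: D0; exists z.
have qz z : punctured_disk s z -> cmod q.[z] ^+ 2 <= 1 - s ^+ 2 / 4.
  move=> [sz z1]; rewrite hornerZ !hornerE cmodM cmodV cmod_nat exprMn.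
  have : s ^+ 2 <= cmod (z - 1) ^+ 2 by rewrite ler_pXn2r ?nnegrE ?cmod_ge0 ?(ltW s0).
  have : cmod z ^+ 2 <= 1 by rewrite exprn_ile1// cmod_ge0.
  rewrite !cmod_sqrE; case: z {sz z1} => a b /= h1 h2.
  by rewrite exprVn; lra.
have b0 : 0 <= 1 - s ^+ 2 / 4 by exact: le_trans (sqr_ge0 _) (qz _ z0D).
apply: (@le_lt_trans _ _ (Num.sqrt (1 - s ^+ 2 / 4))).
  apply: ge_sup; first by exists (cmod q.[z0]), z0.
  move=> _ [z /qz zq <-]; rewrite -(@ler_pXn2r _ 2)// ?nnegrE ?cmod_ge0 ?sqrtr_ge0//.
  by rewrite sqr_sqrtr.
rewrite -[ltRHS]sqrtr1 ltr_sqrt// ltrBlDr ltrDl divr_gt0// exprn_gt0//.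
Qed.

(** A point where the circles |z| = 1 and |z - 1| = s meet; the other one is its conjugate. *)
Definition corner s : R[i] := Complex (1 - s ^+ 2 / 2) (s * Num.sqrt (1 - s ^+ 2 / 4)).

Lemma corner_im s : 0 < s <= 1 -> Im (corner s) ^+ 2 = s ^+ 2 * (1 - s ^+ 2 / 4).
Proof.
move=> /andP[s0 s1]; rewrite exprMn sqr_sqrtr// subr_ge0 ler_pdivrMr//.
by rewrite mul1r (le_trans (exprn_ile1 _ (ltW s0) s1))// ler1n.
Qed.

Lemma corner_disk s : 0 < s <= 1 ->
  punctured_disk s (corner s) /\ punctured_disk s (conjc (corner s)).
Proof.
move=> s01; have h := corner_im s01; have /andP[s0 s1] := s01.
have zD : punctured_disk s (corner s).
  split.
    rewrite -(@ler_pXn2r _ 2)// ?nnegrE ?cmod_ge0 ?(ltW s0)// cmod_sqrE Im_sub.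
    by rewrite [Im 1]/= subr0 h Re_sub /=; lra.
  rewrite -(@ler_pXn2r _ 2)// ?nnegrE ?cmod_ge0// cmod_sqrE h /=; lra.
split=> //; case: zD => sz z1; split; last by rewrite cmod_conj.
have -> : conjc (corner s) - 1 = conjc (corner s - 1).
  by congr Complex; rewrite /=; ring.
by rewrite cmod_conj.
Qed.

Lemma disk_sup_degree1 q s : 0 < s <= 1 -> q.[1] = 1 -> (size q <= 2)%N ->
  1 - s ^+ 2 <= disk_sup s q ^+ 2.
Proof.
move=> s01 q1 sq; have [z1 z2] := corner_disk s01.
have qE z : q.[z] = 1 + q`_1 * (z - 1).
  have c0 : q`_0 = 1 - q`_1.
    by rewrite -q1 (horner_coef_wide _ sq) !big_ord_recr big_ord0 /= expr1n
      !mulr1 add0r addrK.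
  by rewrite (horner_coef_wide _ sq) !big_ord_recr big_ord0 /= c0; ring.
have sqD z : punctured_disk s z -> cmod q.[z] ^+ 2 <= disk_sup s q ^+ 2.
  by move=> zD; rewrite ler_pXn2r ?nnegrE ?cmod_ge0 ?disk_sup_ge0 ?disk_sup_ub.
have := sqD _ z1; have := sqD _ z2; rewrite !qE.
have := corner_im s01; rewrite !cmod_sqrE; move: (disk_sup s q ^+ 2) => D2.
rewrite /corner; move: (s * Num.sqrt _) => b.
case: (q`_1) => u v /= hb.
have : 0 <= s ^+ 2 * ((u - 2^-1) ^+ 2 + v ^+ 2).
  by rewrite mulr_ge0 ?addr_ge0 ?sqr_ge0.
have : 0 <= s ^+ 2 by rewrite sqr_ge0.
move: (s ^+ 2) hb => t hb t0 h h2 h1.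
have e : u ^+ 2 * b ^+ 2 = u ^+ 2 * (t * (1 - t / 4)) by rewrite hb.
have e' : v ^+ 2 * b ^+ 2 = v ^+ 2 * (t * (1 - t / 4)) by rewrite hb.
by nra.
Qed.

Lemma disk_sup_degree2 q s : 0 < s <= 1 -> q.[1] = 1 -> (size q <= 3)%N ->
  1 - s ^+ 2 <= disk_sup s q.
Proof.
move=> s01 q1 sq; have [z1 z2] := corner_disk s01; have /andP[s0 s1] := s01.
have zN1 : punctured_disk s (-1).
  split; last by rewrite cmodN cmod1.
  by rewrite -opprD cmodN (_ : 1 + 1 = 2%:R)// cmod_nat; lra.
set x := 1 - s ^+ 2 / 2.
(* A functional on three points of the region that equals (1 + x) q(1) for all q of degree at most
   2. Its weights have total modulus 3 - x, whence the supremum is at least (1 + x) / (3 - x) = (4 -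
   s^2) / (4 + s^2). *)
have key : q.[corner s] * conjc (corner s) + q.[conjc (corner s)] * corner s +
    (1 - x)%:C * q.[-1] = (1 + x)%:C.
  have c0 : q`_0 = 1 - q`_1 - q`_2.
    by rewrite -q1 (horner_coef_wide _ sq) !big_ord_recr big_ord0 /= !expr1n
      !mulr1 add0r; ring.
  have zz : corner s * conjc (corner s) = 1.
    rewrite -cmod_sqrC cmod_sqrE corner_im// /= (_ : _ + _ = 1)//; lra.
  have zs : conjc (corner s) = (2 * x)%:C - corner s.
    by rewrite /corner; congr Complex; rewrite /x /=; ring.
  have eB (t : R) : (1 - t)%:C = 1 - t%:C by rewrite rmorphB rmorph1.
  have eD (t : R) : (1 + t)%:C = 1 + t%:C by rewrite rmorphD rmorph1.
  have eM (t : R) : (2 * t)%:C = 2 * t%:C by rewrite rmorphM rmorph_nat.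
  rewrite (eB x) (eD x); move: zz zs; rewrite (eM x).
  move: (x%:C) (corner s) (conjc (corner s)) => X z w zz ws.
  rewrite !(horner_coef_wide _ sq) !big_ord_recr !big_ord0 /= c0.
  rewrite !expr0 !expr1; move: (q`_1) (q`_2) => c1 c2.
  transitivity ((1 - c1 - c2) * (z + w) + c1 * (z * w) *+ 2 +
      c2 * (z * w) * (z + w) + (1 - X) * (1 - c1 *+ 2)); first by ring.
  by rewrite zz ws; ring.
have x1 : 0 <= 1 - x by rewrite /x; have := sqr_ge0 s; lra.
have sq1 : s ^+ 2 <= 1 by rewrite exprn_ile1// ltW.
have cn : cmod (corner s) = 1.
  apply: (@pexpIrn _ 2); rewrite ?nnegrE ?cmod_ge0// expr1n cmod_sqrE.
  by rewrite corner_im//=; lra.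
have x2 : 0 <= 1 + x by rewrite /x; lra.
have tot : 1 + x <= disk_sup s q + disk_sup s q + (1 - x) * disk_sup s q.
  rewrite -{1}(ger0_norm x2) -(cmod_real (1 + x)) -key.
  rewrite (le_trans (cmodD _ _))// lerD//.
    rewrite (le_trans (cmodD _ _))// lerD// cmodM ?cmod_conj cn mulr1.
      exact: disk_sup_ub.
    exact: disk_sup_ub.
  by rewrite cmodM cmod_real ger0_norm// ler_wpM2l// disk_sup_ub.
have t0 := sqr_ge0 s; have := disk_sup_ge0 s q.
move: tot; rewrite /x; move: (disk_sup s q) (s ^+ 2) t0 sq1.
by move=> D t t0 t1; nra.
Qed.

(* With [u = q * ((1 + X) / 2) ^ 2] the polynomial [u(z) + u(-z)] is even, hence
   of the form [P (z ^ 2)]; it halves the degree, and [z ^ 2 - 1] being a product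
   of two factors of modulus at most 2, both [z] and [-z] stay at distance [s]
   from 1 when [|z ^ 2 - 1| >= 2 s]. *)
Lemma squaring_trick q m s : (2 < m)%N -> q.[1] = 1 -> (size q <= m.+1)%N ->
  exists P : {poly R[i]}, [/\ (size P <= m)%N, P.[1] = 1 &
    forall w, cmod (2 * w - 1) <= 1 -> s <= cmod (w - 1) ->
      cmod P.[w] <= disk_sup s q].
Proof.
move=> m2 q1 sq; pose u := q * (2^-1 *: ('X + 1)) ^+ 2.
have s2 : (size (2^-1 *: ('X + 1) : {poly R[i]})%R <= 2)%N.
  rewrite (leq_trans (size_scale_leq _ _))//.
  by rewrite -[1]opprK -[- 1]polyCN size_XsubC.
have su : (size u <= m + 3)%N.
  rewrite (leq_trans (size_polyMleq _ _))// -subn1 leq_subLR.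
  rewrite expr2 (leq_trans (leq_add sq (size_polyMleq _ _)))//.
  rewrite add1n -[(m + 3).+1]addSn leq_add2l -ltnS prednK.
    by rewrite (leq_trans (leq_add s2 s2)).
  by rewrite addn_gt0 size_poly_gt0 scaler_eq0 invr_eq0 pnatr_eq0 /=
    -[1]opprK -[- 1]polyCN polyXsubC_eq0.
have uE z : u.[z] = q.[z] * ((1 + z) / 2) ^+ 2.
  rewrite hornerM horner_exp hornerZ hornerD hornerX hornerC.
  by rewrite [z + 1]addrC [_^-1 * _]mulrC.
have evenE z : (even_poly u).[z ^+ 2] = (u.[z] + u.[- z]) / 2.
  have h y : u.[y] = (even_poly u).[y ^+ 2] + (odd_poly u).[y ^+ 2] * y.
    by rewrite -{1}(poly_even_odd u) hornerD hornerM !horner_comp !hornerXn hornerX.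
  by rewrite !h sqrrN; field.
pose E := 2 *: even_poly u.
have EE z : E.[z ^+ 2] = u.[z] + u.[- z].
  by rewrite hornerZ evenE; field.
pose l : {poly R[i]} := 2 *: 'X - 1.
have lE w : l.[w] = 2 * w - 1 by rewrite !hornerE.
have sl : (size l <= 2)%N.
  rewrite (leq_trans (size_polyD _ _))// geq_max size_polyN size_poly1 andbT.
  by rewrite (leq_trans (size_scale_leq _ _))// size_polyX.
exists (E \Po l); split.
- rewrite (leq_trans (size_comp_poly_leq _ _))//.
  (* Here m >= 3 is used: u has size at most m + 3, and half of this, rounded up, is at most m. *)
  have sE : (size E <= m)%N.
    rewrite (leq_trans (size_scale_leq _ _))// (leq_trans (size_even_poly _))//.
    rewrite (leq_trans (uphalf_leq su))//.
    by rewrite leq_uphalf_double -addnn leq_add2l.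
  have m0 : (0 < m)%N by exact: leq_trans m2.
  rewrite -[leqRHS](prednK m0) ltnS.
  have [sl1 sE1] : ((size l).-1 <= 1)%N /\ ((size E).-1 <= m.-1)%N.
    by split; rewrite -!subn1 ?leq_sub2r// leq_subLR.
  by rewrite (leq_trans (leq_mul sE1 sl1))// muln1.
(* The factor ((1 + X) / 2)^2 is 1 at 1 and vanishes at -1, so only q(1) survives. *)
- rewrite horner_comp lE (_ : 2 * 1 - 1 = 1 ^+ 2); last by ring.
  by rewrite EE !uE q1 subrr mul0r expr0n mulr0 addr0; field.
- move=> w w1 sw; rewrite horner_comp lE.
  set z := sqrtc (2 * w - 1); have zE : z ^+ 2 = 2 * w - 1 by exact: sqr_sqrtc.
  rewrite -zE EE.
  have z1 : cmod z <= 1.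
    by rewrite -(@ler_pXn2r _ 2)// ?nnegrE ?cmod_ge0// -cmodX expr1n zE.
  have prod : 2 * s <= cmod (z - 1) * cmod (z + 1).
    have -> : cmod (z - 1) * cmod (z + 1) = 2 * cmod (w - 1).
      rewrite -cmodM -[in RHS](@cmod_nat R 2) -cmodM; congr cmod.
      rewrite -subr_sqr expr1n zE; ring.
    by rewrite ler_pM2l.
  have le2 : cmod (z - 1) <= 2 /\ cmod (z + 1) <= 2.
    split; [apply: (le_trans (cmodB _ _))|apply: (le_trans (cmodD _ _))];
      by rewrite cmod1; lra.
  have [a2 b2] := le2; have a0 := cmod_ge0 (z - 1); have b0 := cmod_ge0 (z + 1).
  have zD : punctured_disk s z by split => //; nra.
  have zND : punctured_disk s (- z).
    by split; rewrite ?cmodN// -opprD cmodN; nra.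
  have e (y v : R[i]) : cmod (y * (v / 2) ^+ 2) = cmod y * (cmod v / 2) ^+ 2.
    by rewrite cmodM cmodX [cmod (v / 2)]cmodM cmodV cmod_nat.
  rewrite !uE (le_trans (cmodD _ _))// !e.
  have D0 := disk_sup_ge0 s q.
  have h1 := ler_wpM2r (sqr_ge0 (cmod (1 + z) / 2)) (disk_sup_ub q zD).
  have h2 := ler_wpM2r (sqr_ge0 (cmod (1 - z) / 2)) (disk_sup_ub q zND).
  (* The two weights add up to (1 + |z|^2) / 2 by the parallelogram law. *)
  apply: (le_trans (lerD h1 h2)); rewrite -mulrDr ler_piMr// !exprMn.
  have : cmod z ^+ 2 <= 1 by rewrite exprn_ile1// cmod_ge0.
  rewrite !cmod_sqrE; case: (z) => a b /= h.
  by rewrite exprVn; lra.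
Qed.

End ChebyshevNumber.

(** * GMRES and Anderson acceleration *)

Section Rates.
Context {R : realType} {H : hilbertType R}.
Implicit Types (M : H -> set H) (L : H -> H) (p : {poly R}) (q : {poly R[i]}).
Local Open Scope complex_scope.

Lemma le_sqr (a b : R) : 0 <= a -> a <= b -> a ^+ 2 <= b ^+ 2.
Proof. by move=> a0 ab; rewrite ler_pXn2r ?nnegrE// (le_trans a0 ab). Qed.

Lemma resolvent_spectrum_lens M (s : R) (z : R[i]) : normal_maximal_monotone M ->
  s <= spectral_floor (resolvent M) -> spectrum (resolvent M) z ->
  [/\ s <= cmod (z - 1), cmod (2 * z - 1) <= 1 & cmod z ^+ 2 <= Re z].
Proof.
move=> nM sM zL; have disk := resolvent_spectrum_disk nM zL; split.
- by rewrite cmodC (le_trans sM)// spectral_floor_le.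
- have -> : 2 * z - 1 = 2 * (z - 2^-1) by field.
  by rewrite cmodM cmod_nat; lra.
- move: (le_sqr (cmod_ge0 _) disk).
  have -> : 2^-1 = (2^-1)%:C :> R[i] by rewrite fmorphV rmorph_nat.
  by rewrite !cmod_sqrE; case: (z) => a b /=; rewrite exprVn; lra.
Qed.

Lemma resolvent_spectrum_punctured M (s : R) (z : R[i]) :
  normal_maximal_monotone M -> s <= spectral_floor (resolvent M) ->
  spectrum (resolvent M) z -> punctured_disk s z.
Proof.
move=> nM sM /(resolvent_spectrum_lens nM sM)[sz z2 _]; split => //.
have := cmodD (2^-1 * (2 * z - 1)) 2^-1.
have -> : 2^-1 * (2 * z - 1) + 2^-1 = z by field.
by rewrite cmodM cmodV cmod_nat; lra.
Qed.

Lemma resolvent_poly_disk M (s : R) q : normal_maximal_monotone M ->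
  s <= spectral_floor (resolvent M) ->
  forall x, `|opoly (resolvent M) (poly_Re q) x| <= disk_sup s q * `|x|.
Proof.
move=> nM sM; have [_ _ norL] := nM; apply: normal_poly_Re_bound => // z zL.
by apply: disk_sup_ub; exact: (resolvent_spectrum_punctured nM sM zL).
Qed.

(** On the spectrum |z|^2 <= Re z and |z - 1|^2 >= s^2; eliminating Re z leaves |z|^2 <= 1 - s^2. *)
Lemma resolvent_contraction M (s : R) : normal_maximal_monotone M ->
  s <= spectral_floor (resolvent M) -> 0 < s <= 1 ->
  forall x, `|resolvent M x| ^+ 2 <= (1 - s ^+ 2) * `|x| ^+ 2.
Proof.
move=> nM sM /andP[s0 s1] x; have [_ _ norL] := nM.
have b0 : 0 <= 1 - s ^+ 2 by rewrite subr_ge0 exprn_ile1// ltW.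
suff : `|opoly (resolvent M) 'X x| <= Num.sqrt (1 - s ^+ 2) * `|x|.
  have [[linL _] _] := norL; case: (linear_pack linL) => f ->.
  rewrite opolyX => /(le_sqr (normr_ge0 _)) h; apply: le_trans h _.
  by rewrite exprMn sqr_sqrtr.
apply: normal_real_poly_bound => // z zL; rewrite map_polyX hornerX.
rewrite -(@ler_pXn2r _ 2)// ?nnegrE ?cmod_ge0 ?sqrtr_ge0// sqr_sqrtr//.
have [sz _ zRe] := resolvent_spectrum_lens nM sM zL.
move: (le_sqr (ltW s0) sz).
move: zRe; rewrite !cmod_sqrE; case: (z) => a b /=.
by lra.
Qed.

Lemma spectral_floor_le1 M (s : R) : normal_maximal_monotone M -> 0 < s ->
  s <= spectral_floor (resolvent M) -> s <= 1.
Proof.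
move=> nM s0 sM; have [z zL] : exists z, spectrum (resolvent M) z.
  apply: contrapT => /forallNP h; move: sM; rewrite leNgt => /negP; apply.
  (* On an empty spectrum the floor would be the default infimum 0, against s > 0. *)
  rewrite /spectral_floor (_ : floor_distances _ = set0) ?inf0//.
  by apply/seteqP; split=> // x [z zL _]; exact: (h z zL).
have [sz _ zRe] := resolvent_spectrum_lens nM sM zL.
rewrite -(@ler_pXn2r _ 2)// ?nnegrE ?(ltW s0)// expr1n.
move: (le_sqr (ltW s0) sz).
move: zRe; rewrite !cmod_sqrE; case: (z) => a b /=.
move: (s ^+ 2) => t; move: (sqr_ge0 a) (sqr_ge0 b).
by move=> a0 b0 h1 h2; lra.
Qed.

(** This is the shape of a Krylov step: the correction g(L) r changes the residual r into (1 + (X -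
    1) g)(L) r. *)
Lemma poly_sub1_factor p m : p.[1] = 1 -> (size p <= m.+1)%N ->
  exists2 g : {poly R}, p = 1 + ('X - 1) * g & (size g <= m)%N.
Proof.
move=> p1 sp; have : root (p - 1) 1 by rewrite rootE !hornerE p1 subrr.
move=> /factor_theorem[g gE]; exists g.
  by rewrite mulrC -(polyC1 R) -gE polyC1 addrC subrK.
have [->|g0] := eqVneq g 0; first by rewrite size_poly0.
have : (size (g * ('X - 1%:P))%R <= m.+1)%N.
  by rewrite -gE (leq_trans (size_polyD _ _))// geq_max sp size_polyN size_poly1.
by rewrite size_Mmonic ?monicXsubC// size_XsubC addn2.
Qed.

Lemma gmres_cycle M (s : R) m (z : nat -> H) c : normal_maximal_monotone M ->
  s <= spectral_floor (resolvent M) -> gmres_restarted m (resolvent M) z ->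
  `|residual (resolvent M) (z c.+1)| <=
  chebyshev_number m s * `|residual (resolvent M) (z c)|.
Proof.
move=> nM sM /(_ c)[a [-> amin]]; apply: le_chebyshev => // q q1 sq.
apply: le_trans (resolvent_poly_disk q nM sM (residual (resolvent M) (z c))).
have [||g gE sg] := @poly_sub1_factor (poly_Re q) m.
- by rewrite horner_sum_Re q1.
- exact: leq_trans (size_poly_Re _) sq.
apply: (le_trans (amin (fun i => g`_i))).
have [_ _ [[linL _] _]] := nM.
rewrite gE; case: (linear_pack linL) => f ->.
set r := residual f (z c).
have -> : \sum_(i < m) g`_i *: iter i f r = opoly f g r.
  by rewrite -(opoly_widen _ _ sg).
rewrite opolyD opoly1 opolyM opolyB opolyX opoly1 {1}/residual linearD.
by rewrite [in leLHS]opprD addrACA.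
Qed.

(** * One cycle of Anderson acceleration, indexed from 0 *)

Section AndersonCycle.
Variables (f : {linear H -> H}) (u : nat -> H) (m : nat) (gam : nat -> nat -> R).
Hypothesis firm : forall x, `|f x| ^+ 2 <= dot (f x) x.
Hypothesis gam1 : forall i, (i < m)%N -> \sum_(l < i.+1) gam i l = 1.
Hypothesis gam_min : forall i, (i < m)%N -> forall del : nat -> R,
  \sum_(l < i.+1) del l = 1 ->
  `|\sum_(l < i.+1) gam i l *: residual f (u l)| <=
  `|\sum_(l < i.+1) del l *: residual f (u l)|.
Hypothesis uS : forall i, (i < m)%N ->
  u i.+1 = \sum_(l < i.+1) gam i l *: f (u l).

Definition cycle_residual i := \sum_(l < i.+1) gam i l *: residual f (u l).

Lemma combination_residual n (del : nat -> R) :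
  \sum_(l < n) del l *: residual f (u l) =
  residual f (\sum_(l < n) del l *: u l).
Proof.
rewrite /residual linear_sum -sumrB; apply: eq_bigr => l _.
by rewrite linearZ scalerBr.
Qed.

Lemma cycle_next i : (i < m)%N -> u i.+1 = f (\sum_(l < i.+1) gam i l *: u l).
Proof.
move=> im; rewrite uS// linear_sum; apply: eq_bigr => l _.
by rewrite linearZ.
Qed.

Lemma cycle_poly i : (i <= m)%N ->
  exists p, [/\ (size p <= i.+1)%N, p.[1] = 1 & u i = opoly f p (u 0)].
Proof.
have [n] := ubnP i; elim: n i => // n IH [|i] ni im.
  by exists 1; rewrite size_poly1 hornerC opoly1.
have /choice[P PE] : forall l : 'I_i.+1, exists p,
    [/\ (size p <= i.+1)%N, p.[1] = 1 & u l = opoly f p (u 0)].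
  move=> l; have [||p [sp p1 pE]] := IH l.
  - by rewrite (leq_ltn_trans (leq_ord l)).
  - exact: leq_trans (leq_ord l) (ltnW im).
  - exists p; split => //; rewrite (leq_trans sp)//.
exists ('X * \sum_(l < i.+1) gam i l *: P l); split.
- rewrite (leq_trans (size_polyMleq _ _))// size_polyX /= ltnS.
  rewrite (leq_trans (size_sum _ _ _))//; apply/bigmax_leqP => l _.
  by rewrite (leq_trans (size_scale_leq _ _))//; case: (PE l).
- rewrite hornerM hornerX mul1r horner_sum -[RHS](gam1 im).
  by apply: eq_bigr => l _; rewrite hornerZ; case: (PE l) => _ -> _; rewrite mulr1.
- rewrite cycle_next// opolyM opolyX opoly_sum; congr (f _).
  by apply: eq_bigr => l _; rewrite opolyZ; case: (PE l) => _ _ ->.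
Qed.

Lemma cycle_mix_poly i : (i < m)%N -> exists p, [/\ (size p <= i.+1)%N, p.[1] = 1 &
  \sum_(l < i.+1) gam i l *: u l = opoly f p (u 0)].
Proof.
move=> im.
have /choice[P PE] : forall l : 'I_i.+1, exists p,
    [/\ (size p <= i.+1)%N, p.[1] = 1 & u l = opoly f p (u 0)].
  move=> l; have [|p [sp p1 pE]] := @cycle_poly l.
    exact: leq_trans (leq_ord l) (ltnW im).
  by exists p; split => //; rewrite (leq_trans sp).
exists (\sum_(l < i.+1) gam i l *: P l); split.
- rewrite (leq_trans (size_sum _ _ _))//; apply/bigmax_leqP => l _.
  by rewrite (leq_trans (size_scale_leq _ _))//; case: (PE l).
- rewrite horner_sum -[RHS](gam1 im).
  by apply: eq_bigr => l _; rewrite hornerZ; case: (PE l) => _ -> _; rewrite mulr1.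
- rewrite opoly_sum.
  by apply: eq_bigr => l _; rewrite opolyZ; case: (PE l) => _ _ ->.
Qed.

(* A firmly nonexpansive linear map shortens every nonzero residual: otherwise
   [rho = L w - w] would be fixed, and firmness along [w - t rho] would be
   violated for large t. *)
Lemma residual_strict w : `|residual f w| <= `|f (residual f w)| ->
  residual f w = 0.
Proof.
have fixed (x : H) : `|x| <= `|f x| -> f x = x.
  move=> /(le_sqr (normr_ge0 _)) h.
  apply/subr0_eq/norm_sqr_eq0; rewrite -dot_norm dotBl !dotBr (dotC x (f x)).
  by rewrite !dot_norm; have := firm x; lra.
move=> /fixed; set rho := residual f w => fix_rho.
have line t : dot (f w) rho <= t * `|rho| ^+ 2.
  have := firm (w - t *: rho); rewrite linearB linearZ /= fix_rho.
  set v := f w - t *: rho; have -> : w - t *: rho = v - rho.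
    by rewrite /v /rho /residual opprB addrAC addrCA subrr addr0.
  rewrite (dotBr v v rho) dot_norm lerDl oppr_ge0 /v (dotBl _ (t *: rho)).
  by rewrite dotZl dot_norm; lra.
apply/norm_sqr_eq0; rewrite leNgt; apply/negP => r0.
have := line ((dot (f w) rho - 1) / `|rho| ^+ 2).
by rewrite divfK ?gt_eqF//; lra.
Qed.

(** Polynomials are not normalized at 1 here: the induction on i subtracts a multiple of X p from D,
    which changes the value at 1. *)
Definition full_krylov i := forall D : {poly R}, (size D <= i.+1)%N ->
  exists del : nat -> R, \sum_(l < i.+1) del l *: u l = opoly f D (u 0) /\
    \sum_(l < i.+1) del l = D.[1].

Lemma full_krylov_optimal i : (i < m)%N -> full_krylov i -> forall p,
  (size p <= i.+1)%N -> p.[1] = 1 ->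
  `|cycle_residual i| <= `|opoly f p (residual f (u 0))|.
Proof.
move=> im full p sp p1; have [del [delE del1]] := full p sp.
rewrite p1 in del1; apply: (le_trans (gam_min im del1)).
rewrite combination_residual delE /residual opolyBx -opoly_comm.
exact: lexx.
Qed.

(** Extending the previous weights by zero is admissible in the larger window. *)
Lemma cycle_solved i : (i.+1 < m)%N -> cycle_residual i = 0 ->
  cycle_residual i.+1 = 0.
Proof.
move=> im r0; apply/normr0_eq0/le_anti; rewrite normr_ge0 andbT.
pose del l := if (l <= i)%N then gam i l else 0.
have delE (V : lmodType R) (g : nat -> V) :
    \sum_(l < i.+2) del l *: g l = \sum_(l < i.+1) gam i l *: g l.
  rewrite big_ord_recr /= /del ltnn scale0r addr0.
  by apply: eq_bigr => l _; rewrite -ltnS ltn_ord.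
have del1 : \sum_(l < i.+2) del l = 1.
  rewrite -(gam1 (ltnW im)); have := delE R^o (fun=> 1).
  under eq_bigr do rewrite [_ *: _]mulr1.
  by under [in RHS]eq_bigr do rewrite [_ *: _]mulr1.
apply: (le_trans (gam_min im del1)).
by rewrite (delE _ (fun l => residual f (u l))) -/(cycle_residual i) r0 normr0.
Qed.

(* No stagnation: if the minimizing polynomial had degree less than i, then
   multiplying it by X would stay in the current affine hull without
   increasing the residual. *)
Lemma cycle_full_or_solved i : (i < m)%N -> cycle_residual i = 0 \/ full_krylov i.
Proof.
elim: i => [|i IH] im.
  right=> D sD; exists (fun=> D`_0); rewrite !big_ord1 (size1_polyC sD).
  by rewrite opolyC hornerC coefC.
have im' := ltnW im; case: (IH im') => [/(cycle_solved im)|full]; first by left.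
have [p [sp p1 pE]] := cycle_mix_poly im'.
have rE : cycle_residual i = residual f (opoly f p (u 0)).
  by rewrite /cycle_residual combination_residual pE.
have [spi|spi] := leqP (size p) i.
  left; apply: (cycle_solved im).
  rewrite rE; apply: residual_strict; rewrite -rE.
  have sXp : (size ('X * p)%R <= i.+1)%N.
    by rewrite (leq_trans (size_polyMleq _ _))// size_polyX.
  have Xp1 : ('X * p).[1] = 1 by rewrite hornerM hornerX mul1r.
  have := full_krylov_optimal im' full sXp Xp1.
  by rewrite opolyM opolyX rE /residual opolyBx -opoly_comm.
have {}spi : size p = i.+1 by apply/anti_leq; rewrite sp spi.
right=> D sD.
have lp : p`_i != 0.
  have : lead_coef p != 0 by rewrite lead_coef_eq0 -size_poly_gt0 spi.
  by rewrite lead_coefE spi.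
(* X p represents the new iterate and has exact degree i + 1, so a multiple of it removes the top
   coefficient of D. *)
pose c := D`_i.+1 / p`_i.
have [|del [delE del1]] := full (D - c *: ('X * p)).
  apply/leq_sizeP => j; rewrite leq_eqVlt => /orP[/eqP <-|ij].
    by rewrite coefB coefZ coefXM /= /c divfK// subrr.
  rewrite coefB coefZ coefXM (nth_default 0 (leq_trans sD ij)).
  case: j ij => // j ij /=.
  by rewrite nth_default ?mulr0 ?subr0// spi.
exists (fun l => if (l <= i)%N then del l else c).
have sumE (V : lmodType R) (g : nat -> V) :
    \sum_(l < i.+2) (if (l <= i)%N then del l else c) *: g l =
    \sum_(l < i.+1) del l *: g l + c *: g i.+1.
  rewrite big_ord_recr /= ltnn; congr (_ + _).
  by apply: eq_bigr => l _; rewrite -ltnS ltn_ord.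
split.
  rewrite (sumE _ u) delE cycle_next// pE opolyB opolyZ opolyM opolyX.
  by rewrite subrK.
have := sumE R^o (fun=> 1).
under eq_bigr do rewrite [_ *: _]mulr1.
under [in RHS]eq_bigr do rewrite [_ *: _]mulr1.
move=> ->; rewrite del1 hornerD hornerN hornerZ hornerM hornerX p1 mul1r.
by rewrite [_ *: 1]mulr1 mulr1 subrK.
Qed.

Lemma cycle_optimal i p : (i < m)%N -> (size p <= i.+1)%N -> p.[1] = 1 ->
  `|cycle_residual i| <= `|opoly f p (residual f (u 0))|.
Proof.
move=> im sp p1; case: (cycle_full_or_solved im) => [->|full].
  by rewrite normr0.
exact: full_krylov_optimal.
Qed.

Lemma cycle_output i : (i < m)%N -> residual f (u i.+1) = f (cycle_residual i).
Proof.
move=> im; rewrite cycle_next// /cycle_residual combination_residual.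
by rewrite /residual linearB.
Qed.

End AndersonCycle.
Lemma sum_shift (V : nmodType) W n (F : nat -> V) :
  \sum_(W <= j < (W + n)%N) F j = \sum_(l < n) F (W + l)%N.
Proof.
rewrite -{1}[W]add0n big_addn addKn big_mkord.
by apply: eq_bigr => l _; rewrite addnC.
Qed.

Lemma anderson_cycle M (s : R) m (y : nat -> H) c : normal_maximal_monotone M ->
  0 < s -> s <= spectral_floor (resolvent M) -> (0 < m)%N ->
  anderson_restarted m (resolvent M) y ->
  `|residual (resolvent M) (y (m * c.+1)%N)| <=
  chebyshev_number m s * `|residual (resolvent M) (y (m * c)%N)|.
Proof.
move=> nM s0 sM m0 /choice[g gP].
have s01 : 0 < s <= 1 by rewrite s0 (spectral_floor_le1 nM s0 sM).
have contr := resolvent_contraction nM sM s01.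
have firm x := resolvent_firm x nM.
have [_ _ norL] := nM; have [[linL _] _] := norL.
have pbound := fun q => @normal_poly_Re_bound _ _ (resolvent M) q ^~ norL.
apply: le_chebyshev => // q q1 sq.
have {}pbound (P : {poly R[i]}) : (forall w, cmod (2 * w - 1) <= 1 ->
    s <= cmod (w - 1) -> cmod P.[w] <= disk_sup s q) ->
    forall x, `|opoly (resolvent M) (poly_Re P) x| <= disk_sup s q * `|x|.
  move=> PD; apply: pbound => z zL.
  by have [sz z1 _] := resolvent_spectrum_lens nM sM zL; exact: PD.
move: gP contr firm pbound; case: (linear_pack linL) => f -> gP contr firm pbound.
pose W := (m * c)%N; pose u l := y (W + l)%N.
pose gam i l := g (W + i)%N (W + l)%N.
have WE i : (i < m)%N -> (m * ((W + i) %/ m))%N = W.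
  by move=> im; rewrite /W [(m * c)%N]mulnC divnMDl// divn_small// addn0 mulnC.
have gam1 i : (i < m)%N -> \sum_(l < i.+1) gam i l = 1.
  move=> im; have [+ _ _] := gP (W + i)%N.
  by rewrite WE// -addnS sum_shift.
have gam_min i : (i < m)%N -> forall del : nat -> R, \sum_(l < i.+1) del l = 1 ->
    `|\sum_(l < i.+1) gam i l *: residual f (u l)| <=
    `|\sum_(l < i.+1) del l *: residual f (u l)|.
  move=> im del del1; have [_ + _] := gP (W + i)%N.
  pose del' j := del (j - W)%N.
  have delE l : del' (W + l)%N = del l by rewrite /del' addKn.
  have del1' : \sum_(W <= j < (W + i).+1) del' j = 1.
    by rewrite -addnS sum_shift -del1; apply: eq_bigr => l _; rewrite delE.
  rewrite WE// => /(_ _ del1'); rewrite -addnS !sum_shift.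
  by under [X in _ <= `|X|]eq_bigr do rewrite delE.
have uS i : (i < m)%N -> u i.+1 = \sum_(l < i.+1) gam i l *: f (u l).
  move=> im; have [_ _] := gP (W + i)%N.
  by rewrite WE// -!addnS sum_shift.
have opt := cycle_optimal firm gam1 gam_min uS.
have m1 : (m.-1 < m)%N by rewrite prednK.
have -> : y (m * c.+1)%N = u m.-1.+1 by rewrite /u prednK// mulnS addnC.
have -> : y (m * c)%N = u 0 by rewrite /u addn0.
rewrite (cycle_output uS m1); set rho := cycle_residual _ _ _ _ in opt *.
have D0 := disk_sup_ge0 s q.
have b0 : 0 <= 1 - s ^+ 2.
  by case/andP: s01 => _ s1; rewrite subr_ge0 exprn_ile1// ltW.
have {}opt p : (size p <= m)%N -> p.[1] = 1 ->
    `|rho| <= `|opoly f p (residual f (u 0))|.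
  by rewrite -[in (_ <= m)%N](prednK m0); exact: opt.
move: opt; move: (residual f (u 0)) (rho) => r {}rho opt.
have := m0; rewrite leq_eqVlt => /orP[/eqP me|]; last rewrite leq_eqVlt => /orP[/eqP me|m3].
- have h : `|rho| <= `|r|.
    have := opt 1; rewrite size_poly1 hornerC opoly1; exact.
  have {}h := le_sqr (normr_ge0 _) h.
  rewrite -(@ler_pXn2r _ 2)// ?nnegrE ?mulr_ge0// exprMn.
  apply: (le_trans (contr rho)); apply: ler_pM => //.
  by apply: disk_sup_degree1; rewrite // me.
(* Competing with 'X rather than 1 makes L act twice in total, and each action gains 1 - s^2 in the
   squared norm. *)
- have h : `|rho| <= `|f r|.
    by have := opt 'X; rewrite size_polyX hornerX opolyX; apply; rewrite // -me.
  have {}h := le_sqr (normr_ge0 _) h.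
  rewrite -(@ler_pXn2r _ 2)// ?nnegrE ?mulr_ge0// exprMn.
  apply: (le_trans (contr rho)).
  apply: (le_trans (ler_wpM2l b0 (le_trans h (contr r)))).
  rewrite mulrA -expr2 ler_wpM2r ?sqr_ge0// le_sqr//.
  by apply: disk_sup_degree2; rewrite // me.
- have [P [sP P1 PD]] := squaring_trick s m3 q1 sq.
  apply: (le_trans (firm_norm (firm rho))).
  apply: le_trans (pbound P PD r); apply: opt.
    exact: leq_trans (size_poly_Re _) sP.
  by rewrite horner_sum_Re P1.
Qed.

End Rates.

(** * Minimax values *)

Section Minimax.
Context {R : realType}.
Local Open Scope complex_scope.

Lemma size_qJ K : (size (qJ K : {poly R}) <= K.+1)%N.
Proof.
rewrite /qJ; set N := K.+2./2; have N0 : (0 < N)%N by rewrite half_gt0.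
have sS : (size (N%:R^-1 *: \sum_(j < N) 'X^j : {poly R})%R <= N)%N.
  rewrite (leq_trans (size_scale_leq _ _))// (leq_trans (size_sum _ _ _))//.
  by apply/bigmax_leqP => j _; rewrite size_polyXn.
rewrite expr2 (leq_trans (size_polyMleq _ _))//.
rewrite (leq_trans (_ : _ <= (N + N).-1)%N)//.
  by rewrite -!subn1 leq_sub2r// leq_add.
rewrite addnn -ltnS prednK ?double_gt0//.
by rewrite -[leqRHS](odd_double_half K.+2) leq_addl.
Qed.

Lemma qJ1 K : (qJ K : {poly R}).[1] = 1.
Proof.
have N0 : K.+2./2%:R != 0 :> R by rewrite pnatr_eq0 -lt0n half_gt0.
rewrite /qJ horner_exp hornerZ horner_sum (eq_bigr (fun=> 1)) => [|j _].
  by rewrite sumr_const card_ord mulVf// expr1n.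
by rewrite hornerXn expr1n.
Qed.

(** With S the sum of the w^j for j < N, |w - 1| |S| = |w^N - 1| <= 2, so |w - 1| |S / N|^2 <= 4 /
    (N^2 s); K + 1 <= 2 N turns this into the constant 16. *)
Lemma qJ_residual (H : hilbertType R) (M : H -> set H) K (s : R) y :
  normal_maximal_monotone M -> 0 < s -> s <= spectral_floor (resolvent M) ->
  `|residual (resolvent M) (opoly (resolvent M) (qJ K) y)| <=
  16 * dist_to (zeros M) y / (K.+1%:R ^+ 2 * s).
Proof.
move=> nM s0 sM; have n0 : 0 < K.+1%:R :> R by rewrite ltr0n.
have d0 : 0 < K.+1%:R ^+ 2 * s by rewrite mulr_gt0 ?exprn_gt0.
rewrite mulrAC; apply: le_dist_to => // [|z Lz].
  by rewrite divr_ge0 ?(ltW d0).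
rewrite (residual_opoly _ _ nM Lz).
have [_ _ norL] := nM; apply: normal_real_poly_bound => // w wL.
have [sw _ _] := resolvent_spectrum_lens nM sM wL.
have [_ w1] := resolvent_spectrum_punctured nM sM wL.
set N := K.+2./2.
have N0 : 0 < N%:R :> R by rewrite ltr0n half_gt0.
have KN : K.+1%:R <= 2 * N%:R :> R.
  rewrite -natrM ler_nat -ltnS mul2n.
  by rewrite -[K.+2](odd_double_half K.+2) -/N; case: (odd _).
rewrite rmorphM hornerM rmorphXn horner_exp /= map_polyZ hornerZ fmorphV rmorph_nat.
rewrite rmorph_sum horner_sum /= rmorphB rmorph1 /= map_polyX hornerD hornerN hornerX hornerC.
under eq_bigr do rewrite map_polyXn hornerXn.
set S := \sum_(j < N) w ^+ j.
have aS : cmod (w - 1) * cmod S <= 2.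
  rewrite -cmodM -subrX1 (le_trans (cmodB _ _))// cmod1 cmodX.
  by rewrite (_ : 2 = 1 + 1)// lerD2r exprn_ile1// cmod_ge0.
rewrite cmodM cmodX cmodM cmodV cmod_nat.
have S0 := cmod_ge0 S; move: (cmod (w - 1)) (cmod S) sw aS S0 => a t sa aS t0.
have a0 : 0 < a by exact: lt_le_trans sa.
rewrite ler_pdivlMr// exprMn exprVn.
have -> : a * (N%:R ^- 2 * t ^+ 2) * (K.+1%:R ^+ 2 * s) =
  (a * t ^+ 2 * s) * ((K.+1%:R / N%:R) ^+ 2) by field; rewrite gt_eqF.
have h1 : a * t ^+ 2 * s <= 4.
  apply: (@le_trans _ _ ((a * t) ^+ 2)).
    rewrite exprMn [a ^+ 2]expr2 -mulrA [_ * s]mulrC mulrA.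
    by rewrite ler_wpM2r ?sqr_ge0// ler_wpM2l// ltW.
  by have := le_sqr (mulr_ge0 (ltW a0) t0) aS; lra.
have h2 : (K.+1%:R / N%:R) ^+ 2 <= 4 :> R.
  have : K.+1%:R / N%:R <= 2 :> R by rewrite ler_pdivrMr.
  by move=> /le_sqr h; have := h (divr_ge0 (ltW n0) (ltW N0)); lra.
rewrite (_ : 16 = 4 * 4); last by lra.
apply: ler_pM => //; rewrite ?sqr_ge0//.
by rewrite !mulr_ge0 ?sqr_ge0// ltW.
Qed.

Lemma minimax_ge K (C : instance_class R) (c : R) (H : hilbertType R)
    (M : H -> set H) (y0 : H) : C H M y0 ->
  (forall A : method R, c <= `|residual (resolvent M) (iterate A (resolvent M) y0 K)|) ->
  (c%:E <= minimax K C)%E.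
Proof.
move=> CM lower; apply: le_ereal_inf_tmp => _ [A ->].
apply: (@le_trans _ _ (`|residual (resolvent M) (iterate A (resolvent M) y0 K)|)%:E).
  by rewrite lee_fin.
by apply: ereal_sup_ubound; exists H, M, y0.
Qed.

Lemma minimax_le K (C : instance_class R) :
  (forall H M y0, C H M y0 -> @normal_instances R H M y0) ->
  (minimax K C <= (K.+1%:R^-1)%:E)%E.
Proof.
move=> Cnormal; have [A AE] := @polynomial_method R (@cesaro_poly R)
  (@size_cesaro_poly R) (@cesaro_poly1 R).
apply: (@le_trans _ _ (worst_residual A K C)).
  by apply: ereal_inf_lbound; exists A.
apply: ge_ereal_sup => _ [H [M [y0 [/Cnormal[nM d1] ->]]]].
have [_ _ [[linL _] _]] := nM.
rewrite lee_fin AE//.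
suff : `|residual (resolvent M) (opoly (resolvent M) (cesaro_poly K) y0)| <=
    K.+1%:R^-1 * dist_to (zeros M) y0 by rewrite d1 mulr1.
by apply: le_dist_to => // z Lz; exact: cesaro_residual.
Qed.

Definition canonical_start K : blocks R K.+1 :=
  [ffun j => Complex (Num.sqrt (extremal_weight R j)) 0 : Rcomplex R].

Lemma canonical_start_extremal K : extremal_start (canonical_start K).
Proof.
by move=> j; rewrite ffunE cmod_real ger0_norm// sqrtr_ge0.
Qed.

Lemma scaled_instance K (a : R) (y0 : blocks R K.+1) : extremal_start y0 ->
  0 <= a <= 1 -> normal_instances (relation_of (blockmul (scaled_zeta a))) y0.
Proof.
move=> y0E a01; have nM := scaled_relation_normal K a01; split => //.
rewrite dist_to_zero ?extremal_start_norm// relation_of_resolvent => z.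
exact: scaled_zeta_fix.
Qed.

Lemma extremal_instance K (y0 : blocks R K.+1) : extremal_start y0 ->
  normal_instances (@extremal_operator R K) y0.
Proof.
by move=> y0E; rewrite extremal_relation zetaS; apply: scaled_instance; rewrite // ler01 lexx.
Qed.

Lemma extremal_resolvent K : resolvent (@extremal_operator R K) = blockmul (@zeta R K).
Proof. by rewrite extremal_relation relation_of_resolvent. Qed.

Lemma extremal_lower K (A : method R) (y0 : blocks R K.+1) : extremal_start y0 ->
  K.+1%:R^-1 <= `|residual (blockmul (@zeta R K)) (iterate A (blockmul (@zeta R K)) y0 K)|.
Proof.
move=> y0E; rewrite zetaS.
have := @scaled_residual_lower R K A y0 1 y0E; rewrite ltr01 lexx => /(_ isT).
by rewrite divr1 (_ : 2 - 1 = 1) ?expr1n ?mulr1//; lra.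
Qed.

Lemma minimax_floor_lower K (s : R) : 0 < s -> s <= 2^-1 ->
  ((K.+1%:R^-1 * expR (- (4 * (s * K%:R))))%:E <=
   minimax K (@normal_instances_floor R s))%E.
Proof.
move=> s0 s2; pose a := 1 - s.
have a01 : 0 < a <= 1 by rewrite /a; apply/andP; split; lra.
have [a0 a1] := andP a01.
have y0E := @canonical_start_extremal K.
apply: (@minimax_ge _ _ _ _ (relation_of (blockmul (scaled_zeta a)))
  (canonical_start K)).
  split; first by apply: scaled_instance; rewrite // (ltW a0).
  rewrite relation_of_resolvent; apply: le_trans (@scaled_floor R K a (ltW a0) a1).
  by rewrite /a; lra.
move=> A; rewrite relation_of_resolvent.
apply: le_trans (scaled_residual_lower A y0E a01).
rewrite invfM ler_pM2l ?invr_gt0// expRN lef_pV2 ?posrE ?expR_gt0 ?exprn_gt0//.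
  (* For s <= 1/2 one has (1 + s) / (1 - s) <= 1 + 4 s. *)
  have t1 : 2 / a - 1 <= expR (4 * s).
    apply: le_trans (expR_ge1Dx _).
    by rewrite lerBlDr ler_pdivrMr// /a; nra.
  have -> : expR (4 * (s * K%:R)) = expR (4 * s) ^+ K.
    by rewrite -expRM_natl; congr expR; ring.
  apply: lerXn2r; rewrite ?nnegrE ?expR_ge0//.
  by rewrite subr_ge0 ler_pdivlMr//; lra.
by rewrite subr_gt0 ltr_pdivlMr//; lra.
Qed.

End Minimax.

Lemma limn_einf_ge (R : realType) (u : nat -> \bar R) (c : \bar R) :
  (\forall n \near \oo, (c <= u n)%E) -> (c <= limn_einf u)%E.
Proof.
move=> [N _ Nu]; rewrite limn_einf_lim; apply: lime_ge; first exact: is_cvg_einfs.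
exists N => // n /= Nn; apply: le_ereal_inf_tmp => _ [k /= nk <-].
by apply: Nu; exact: leq_trans nk.
Qed.

Theorem theorem6p1 (R : realType) :
  (* spectrum and spectral floor *)
  (forall (H : hilbertType R) (M : H -> set H), normal_maximal_monotone M ->
     (forall z : R[i], spectrum (resolvent M) z ->
        cmod (z - 2^-1) <= 2^-1) /\
     ((exists x : H, x != 0) -> has_inf (floor_distances (resolvent M))))
  /\
  (* (i) *)
  (forall (H : hilbertType R) (M : H -> set H) (K : nat),
     normal_maximal_monotone M -> (1 <= K)%N ->
     let L := resolvent M in let s := spectral_floor L in
     0 < s ->
     forall y0 : H,
       `|residual L (poly_op (qJ K) L y0)| <=
         16 * dist_to (zeros M) y0 / (K.+1%:R ^+ 2 * s))
  /\
  (* (ii) *)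
  (forall (K : nat) (y0 : blocks R K.+1), (1 <= K)%N -> extremal_start y0 ->
     let M : blocks R K.+1 -> set (blocks R K.+1) := @extremal_operator R K in
     let L := resolvent M in
     [/\ skew_adjoint M,
         normal_maximal_monotone M,
         spectral_floor L = sin (pi / (2 * K.+1%:R)),
         `|y0| = 1 /\ dist_to (zeros M) y0 = 1
       & forall A : method R,
           K.+1%:R^-1 <= `|residual L (iterate A L y0 K)|])
  /\
  (* (iii)(a) *)
  ((forall s : nat -> R, (forall K, 0 < s K) ->
      (exists B : R, forall K, s K * K%:R <= B) ->
      (0 < limn_einf
             (fun K => K%:R%:E * minimax K (normal_instances_floor (s K))))%E)
   /\
   (forall K : nat, (1 <= K)%N ->
      minimax K (normal_instances_floor (sin (pi / (2 * K.+1%:R)) : R)) =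
        (K.+1%:R^-1)%:E))
  /\
  (* (iii)(b) *)
  ((forall s : nat -> R, (forall K, 0 < s K) ->
      s K * K%:R @[K --> \oo] --> +oo ->
      exists A : method R, forall eps : R, 0 < eps ->
        \forall K \near \oo,
          forall (H : hilbertType R) (M : H -> set H) (y0 : H),
            normal_maximal_monotone M -> s K <= spectral_floor (resolvent M) ->
            `|residual (resolvent M) (iterate A (resolvent M) y0 K)| <=
              eps * (dist_to (zeros M) y0 / K%:R))
   /\
   (forall (s : R) (m : nat), 0 < s -> (1 <= m)%N ->
      chebyshev_number m s < 1 /\
      forall (H : hilbertType R) (M : H -> set H),
        normal_maximal_monotone M ->
        let L := resolvent M in
        s <= spectral_floor L ->
        (forall y : nat -> H, anderson_restarted m L y -> forall c : nat,
           `|residual L (y (m * c.+1)%N)| <=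
             chebyshev_number m s * `|residual L (y (m * c)%N)|) /\
        (forall z : nat -> H, gmres_restarted m L z -> forall c : nat,
           `|residual L (z c.+1)| <=
             chebyshev_number m s * `|residual L (z c)|)))
  /\
  (* exact minimax *)
  (forall K : nat, (1 <= K)%N ->
     minimax K (@normal_instances R) = (K.+1%:R^-1)%:E).
Proof.
split.
  move=> H M nM; split; first by move=> z; exact: resolvent_spectrum_disk.
  by have [_ _ norL] := nM; exact: floor_has_inf.
split; first by move=> H M K nM _ L s s0 y0; exact: qJ_residual.
split.
  move=> K y0 K1 y0E M L; have [nM d1] := extremal_instance y0E.
  rewrite /L /M extremal_resolvent; split.
  - exact: extremal_skew_adjoint.
  - exact: nM.
  - exact: extremal_floor.
  - by rewrite extremal_start_norm.
  - by move=> A; exact: extremal_lower.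
(* The extremal instance has exactly this floor, so it is admissible; the upper bound is inherited
   from the whole normal class. *)
have minimax_floor K : minimax K (normal_instances_floor (sin (pi / (2 * K.+1%:R)) : R)) =
    (K.+1%:R^-1)%:E.
  apply/le_anti/andP; split; first by apply: minimax_le => H M y0 [].
  have y0E := @canonical_start_extremal R K.
  apply: (minimax_ge (M := @extremal_operator R K) (y0 := @canonical_start R K)).
    split; first exact: extremal_instance.
    by rewrite extremal_resolvent extremal_floor.
  by move=> A; rewrite extremal_resolvent; exact: extremal_lower.
split; first (split=> [s s0 [B sB]|K _]; last exact: minimax_floor).
  (* The factor 1/2 bounds K / (K + 1) from below for K >= 1. *)
  apply: (@lt_le_trans _ _ (2^-1 * expR (- (4 * B)))%:E).
    by rewrite lte_fin mulr_gt0// expR_gt0.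
  apply: limn_einf_ge; near=> K.
  have K1 : (1 <= K)%N by near: K; exact: nbhs_infty_ge.
  have K0 : 0 < K%:R :> R by rewrite ltr0n.
  (* Makes s_K <= B / K <= 1/2, the range of the exponential lower bound. *)
  have KB : 2 * B <= K%:R by near: K; exact: nbhs_infty_ger.
  have sK2 : s K <= 2^-1.
    rewrite -(ler_pM2r K0) (le_trans (sB K))//; lra.
  have := minimax_floor_lower K (s0 K) sK2.
  move=> /(lee_wpmul2l _) => /(_ K%:R%:E); rewrite lee_fin ler0n => /(_ isT).
  apply: le_trans; rewrite -EFinM lee_fin (mulrA K%:R) ler_pM// ?expR_ge0//.
    have : 1 <= K%:R :> R by rewrite ler1n.
    by rewrite ler_pdivlMr// -[K.+1%:R]natr1; lra.
  by rewrite ler_expR lerN2 ler_pM2l// sB.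
split; last first.
  move=> K K1; apply/le_anti/andP; split; first by apply: minimax_le.
  have y0E := @canonical_start_extremal R K.
  apply: (minimax_ge (M := @extremal_operator R K) (y0 := @canonical_start R K)).
    exact: extremal_instance.
  by move=> A; rewrite extremal_resolvent; exact: extremal_lower.
split.
  move=> s s0 sK; have [A AE] := @polynomial_method R (@qJ R) (@size_qJ R) (@qJ1 R).
  exists A => eps eps0; near=> K => H M y0 nM sM.
  have K0 : 0 < K%:R :> R by rewrite ltr0n; near: K; exact: nbhs_infty_gt.
  (* Exactly what brings 16 / ((K + 1)^2 s_K) below eps / K. *)
  have sKe : 16 / eps <= s K * K%:R.
    by near: K; move/cvgryPge : sK; exact.
  have [_ _ [[linL _] _]] := nM.
  rewrite AE// (le_trans (qJ_residual K y0 nM (s0 K) sM))//.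
  set d := dist_to _ _; have d0 : 0 <= d.
    by rewrite -[leRHS]mul1r; apply: le_dist_to => // z _; rewrite mul1r.
  have key : 16 / (K.+1%:R ^+ 2 * s K) <= eps / K%:R.
    rewrite ler_pdivrMr ?mulr_gt0 ?exprn_gt0// mulrAC ler_pdivlMr//.
    rewrite ler_pdivrMr// in sKe.
    apply: (@le_trans _ _ (K%:R * (s K * K%:R * eps))).
      by rewrite mulrC ler_wpM2l.
    have -> : K%:R * (s K * K%:R * eps) = (s K * eps) * K%:R ^+ 2 by ring.
    have -> : eps * (K.+1%:R ^+ 2 * s K) = (s K * eps) * K.+1%:R ^+ 2 by ring.
    rewrite ler_wpM2l ?mulr_ge0 ?(ltW (s0 K)) ?(ltW eps0)//.
    by rewrite ler_pXn2r ?nnegrE// ler_nat.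
  by rewrite mulrAC [eps * _]mulrCA [16 / _ * _]mulrC ler_wpM2l.
move=> s m s0 m0; split; first exact: chebyshev_lt1.
move=> H M nM L sM; split=> [y yA c|z zG c].
  exact: anderson_cycle.
exact: gmres_cycle.
Unshelve. all: by end_near. Qed.
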